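(* Let $\varepsilon>0$, $h=\sigma^s$ with $s>1$, and let $k:=\max\lbrace P,m\rbrace$. Let $u\in W^{k+1,2}(\Omega)$ and let the particle approximation $u_h\in W^{-(m+1),2}(\Omega)$ satisfy $$\|u_h-u\|_{W^{-(m+1),2}(\Omega)}\leq Ch^{m+1}\|u\|_{W^{m+1,2}(\Omega)}.$$ Then for $\sigma>0$ small enough the solution $u_\sigma\in V_\sigma^P(\Omega_\sigma)$ of the perturbed variational problem $$A_h(u_\sigma,v_\sigma)=\langle u_h,v_\sigma\rangle\qquad\forall v_\sigma\in V_\sigma^P(\Omega_\sigma)$$ satisfies $$\|u-u_\sigma\|_{L^2(\Omega)}\leq C(\varepsilon)\bigl(\sigma^{P+1}+h^{m+1}\sigma^{-(m+1)}\bigr)\|u\|_{W^{k+1,2}(\Omega)},$$ where the constant $C(\varepsilon)$ is independent of $\sigma$, $u$, and the position of $\partial\Omega$ relative to the Cartesian grid.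
   Context: Grid. Let $d\in\mathbb{N}$, $P\in\mathbb{N}_0$, $\sigma>0$. For $i\in\mathbb{Z}^d$ let $x_i:=(i_1\sigma,\ldots,i_d\sigma)$ be the Cartesian grid points (nodes), $\Omega_i:=\prod_{l=1}^d((i_l-1)\sigma,(i_l+1)\sigma)$ the patches, $\omega_i:=\prod_{l=1}^d((i_l-\tfrac12)\sigma,(i_l+\tfrac12)\sigma)$ the patch-cores, and $Q_i:=\prod_{l=1}^d(i_l\sigma,(i_l+1)\sigma)$ the elements. Partition of unity. Let $\zeta:\mathbb{R}\to\mathbb{R}$, $\zeta(x)=K^{-1}\exp(-1/(1-4x^2))$ for $|x|<\tfrac12$ and $\zeta(x)=0$ otherwise, with $K>0$ such that $\|\zeta\|_{L^1(\mathbb{R})}=1$; on $\mathbb{R}^d$ put $\zeta(x)=\prod_{l=1}^d\zeta(x_l)$ and $\zeta_\sigma(x)=\sigma^{-d}\zeta(x/\sigma)$. Set $\varphi_i:=\chi_{\omega_i}\star\zeta_\sigma$ (convolution with the characteristic function of $\omega_i$). The $\varphi_i$ are $C^\infty$, have support $\operatorname{clos}\Omega_i$, and sum to $1$. Domains. $\Omega\subset\mathbb{R}^d$ is a bounded domain for which Stein's extension theorem holds (there is a bounded linear extension operator $W^{k,2}(\Omega)\to W^{k,2}(\mathbb{R}^d)$ for every $k\in\mathbb{N}$). The fictitious domain is $\Omega_\sigma:=\operatorname{int}\bigcup\lbrace\operatorname{clos}Q_i\mid\operatorname{meas}_d(Q_i\cap\Omega)>0\rbrace$; the cut part is $\Omega_\sigma^\Gamma:=\operatorname{int}\bigcup\lbrace\operatorname{clos}Q_i\mid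 Q_i\subset\Omega_\sigma,\ Q_i\not\subset\Omega\rbrace$; the uncut part is $\Omega_\sigma^\circ:=\operatorname{int}\bigcup\lbrace\operatorname{clos}Q_i\mid Q_i\subset\Omega_\sigma,\ Q_i\subset\Omega\rbrace$. One writes $Q_i\in\Omega_\sigma^\Gamma$ for $Q_i\subset\Omega_\sigma^\Gamma$, and similarly for the other domains. Two elements are neighbors if they share at least one grid node. Standing assumption: for every $Q_i\in\Omega_\sigma^\Gamma$ there is a finite sequence $(Q_i=Q_{i,1},\ldots,Q_{i,K})$ of elements in $\Omega_\sigma^\Gamma$ with $K$ bounded independently of $\sigma$, any two subsequent elements being neighbors, and $Q_{i,K}$ having a neighbor in $\Omega_\sigma^\circ$ (if necessary, this is enforced by moving additional elements from $\Omega_\sigma^\circ$ to $\Omega_\sigma^\Gamma$). Space and forms. $V_\sigma^P(\Omega_\sigma)$ is the span of the functions $\varphi_i x^\alpha$, $|\alpha|\leq P$, $i\in\mathbb{Z}^d$, restricted to $\Omega_\sigma$. The stabilization form is $$j(u,v):=\sigma^{2(P+1)}\sum_{Q_i\in\Omega_\sigma^\Gamma}\sum_{|\alpha|=P+1}\int_{Q_i}(\partial^\alpha u)(\partial^\alpha v)\,\mathrm{d}x.$$ Local approximation (Bramble--Hilbert) assumption. For all $i$ with $\Omega_i\cap\Omega_\sigma\neq\emptyset$ and all $w\in W^{P+1,2}(\Omega_\sigma\cap\Omega_i)$ there is a polynomial $v_i$ of total degree at most $P$ with $|w-v_i|_{W^{k,2}(\Omega_\sigma\cap\Omega_i)}\leq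 C\sigma^{P+1-k}|w|_{W^{P+1,2}(\Omega_\sigma\cap\Omega_i)}$ for all $k\in\mathbb{N}_0$, $k\leq P+1$, with $C$ independent of $\sigma$ and $w$ (and of how $\partial\Omega$ intersects the grid). Here $|w|_{W^{k,2}}^2=\sum_{|\alpha|=k}\|\partial^\alpha w\|_{L^2}^2$. Dual spaces. $W^{-k,2}(\Omega):=W^{k,2}(\Omega)'$ is the dual of the full space $W^{k,2}(\Omega)$ (not of $W^{k,2}_0(\Omega)$), $\langle\cdot,\cdot\rangle$ is the duality pairing, and functions in $L^2(\Omega)$ act on $W^{k,2}(\Omega)$ by integration over $\Omega$; $\langle u_h,v_\sigma\rangle$ means $u_h$ applied to the restriction $v_\sigma|_\Omega$. Quadrature. Let $m\in\mathbb{N}_0$ with $m+1>d/2$. For the mesh-width $h>0$ there is given a quadrature rule $I_m$ (a linear functional, a finite weighted sum of point values at nodes in $\Omega$) with $\bigl|\int_\Omega f\,\mathrm{d}x-I_m(f)\bigr|\leq Ch^{m+1}|f|_{W^{m+1,1}(\Omega)}$ for $f\in W^{m+1,1}(\Omega)$, where $|f|_{W^{m+1,1}(\Omega)}=\sum_{|\alpha|=m+1}\|\partial^\alpha f\|_{L^1(\Omega)}$ and $C$ is independent of $f$ and $h$. The approximate forms are $a_h(u_\sigma,v_\sigma):=I_m(u_\sigma v_\sigma)$ and $A_h(u_\sigma,v_\sigma):=a_h(u_\sigma,v_\sigma)+\varepsilon j(u_\sigma,v_\sigma)$. The constant $C$ in the error bound for $u_h$ is independent of $u$ and $h$. *)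

(* Defs.v *)
From HB Require Import structures.
From mathcomp Require Import all_boot all_order all_algebra.
From mathcomp Require Import all_classical all_reals all_analysis.

Set Implicit Arguments.
Unset Strict Implicit.
Unset Printing Implicit Defensive.
Import Order.TTheory GRing.Theory Num.Theory.
Import numFieldNormedType.Exports.

Local Open Scope classical_set_scope.
Local Open Scope ring_scope.

(* The sigma-algebra generated by the coordinates (the Borel one); same
   construction as the library's instance on tuples. *)
Definition measure_rV_display : measure_display -> measure_display.
Proof. exact. Qed.

Section measurable_rV.
Context {disp : measure_display} {T : measurableType disp}.
Variable n : nat.

Let coords : 'I_n -> 'rV[T]_n -> T := fun i x => x ord0 i.

Let rV_set0 : g_sigma_preimage coords set0.
Proof. exact: sigma_algebra0. Qed.

Let rV_setC A : g_sigma_preimage coords A -> g_sigma_preimage coords (~` A).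
Proof. exact: sigma_algebraC. Qed.

Let rV_bigcup (F : (set 'rV[T]_n)^nat) : (forall i, g_sigma_preimage coords (F i)) ->
  g_sigma_preimage coords (\bigcup_i (F i)).
Proof. exact: sigma_algebra_bigcup. Qed.

HB.instance Definition _ := @isMeasurable.Build (measure_rV_display disp)
  'rV[T]_n (g_sigma_preimage coords) rV_set0 rV_setC rV_bigcup.

End measurable_rV.


Section lebesgue_rV.
Variable R : realType.

Definition cons_rV n (p : 'rV[R]_n * measurableTypeR R) : 'rV[R]_n.+1 :=
  \row_i oapp (p.1 ord0) (p.2 : R) (unlift ord0 i).

Lemma measurable_cons_rV n : measurable_fun setT (@cons_rV n).
Proof.
have coord m (j : 'I_m) (B : set R) : measurable B ->
    measurable [set v : 'rV[R]_m | B (v ord0 j)].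
  move=> mB; apply: sub_sigma_algebra; rewrite -bigcup_seq/=.
  by exists j; [rewrite /= mem_index_enum | exists B => //; rewrite setTI].
apply: (@measurability _ _ _ _ _ _ (\big[setU/set0]_(i < n.+1)
  preimage_set_system setT (fun v : 'rV[R]_n.+1 => v ord0 i) measurable)) => //.
move=> _ [B] + <-; rewrite -bigcup_seq => -[i _] [C mC <-].
rewrite !setTI; have [j|] := unliftP ord0 i => [->|->].
- rewrite (_ : _ @^-1` _ = fst @^-1` [set v : 'rV_n | C (v ord0 j)]).
    by rewrite -[X in measurable X]setTI; apply: measurable_fst => //; exact: coord.
  by apply/seteqP; split=> p /=; rewrite /cons_rV mxE liftK.
- rewrite (_ : _ @^-1` _ = snd @^-1` C).
    by rewrite -[X in measurable X]setTI; exact: measurable_snd.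
  by apply/seteqP; split=> p /=; rewrite /cons_rV mxE unlift_none.
Qed.

Definition cons_measure n (m : {measure set 'rV[R]_n -> \bar R}) :
    set 'rV[R]_n.+1 -> \bar R :=
  pushforward (m \x @lebesgue_measure R)%E (@cons_rV n).

HB.instance Definition _ n m := Measure.copy (@cons_measure n m)
  (measure_function_pushforward__canonical__measure_function_Measure
    (m \x @lebesgue_measure R)%E (@measurable_cons_rV n)).

Fixpoint lebesgue_rV n : {measure set 'rV[R]_n -> \bar R} :=
  match n with
  | 0 => \d_(0 : 'rV[R]_0)
  | n'.+1 => cons_measure (lebesgue_rV n')
  end.

End lebesgue_rV.

Section multi_index.
Variables (R : realType) (d : nat).
Implicit Types (f g : 'rV[R]_d -> R) (D : set 'rV[R]_d).

(* Multi-indices with entries at most k; every alpha with |alpha| <= k is one. *)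
Definition mindex k := {ffun 'I_d -> 'I_k.+1}.

Definition mdeg k (a : mindex k) : nat := (\sum_l a l)%N.

Definition monomial k (a : mindex k) (x : 'rV[R]_d) : R :=
  \prod_l x ord0 l ^+ a l.

Definition multipoly k (c : mindex k -> R) (x : 'rV[R]_d) : R :=
  \sum_(a : mindex k | (mdeg a <= k)%N) c a * monomial a x.

Definition iter_partial (s : seq 'I_d) f : 'rV[R]_d -> R :=
  foldr (fun l g => 'D_(delta_mx ord0 l) g) f s.

Definition partial k (a : mindex k) f : 'rV[R]_d -> R :=
  iter_partial (flatten [seq nseq (a l) l | l <- enum 'I_d]) f.

Definition smooth f := forall s x, differentiable (iter_partial s f) x.

Definition test_function D f := smooth f /\
  exists K, [/\ compact K, K `<=` D & forall x, ~ K x -> f x = 0].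

End multi_index.

Section sobolev.
Variables (R : realType) (d : nat).
Local Notation mu := (lebesgue_rV R d).
Implicit Types (f g : 'rV[R]_d -> R) (D : set 'rV[R]_d).

Definition loc_integrable D f := measurable_fun D f /\
  forall K, compact K -> K `<=` D -> mu.-integrable K (EFin \o f).

Definition weak_derivative D k (a : mindex d k) f g :=
  [/\ loc_integrable D f, loc_integrable D g &
  forall psi, test_function D psi ->
    \int[mu]_(x in D) (f x * partial a psi x) =
    (-1) ^+ mdeg a * \int[mu]_(x in D) (g x * psi x)].

(* The weak derivative (unique up to a null set), when there is one. *)
Definition weakD D k (a : mindex d k) f : 'rV[R]_d -> R :=
  get (weak_derivative D a f).

Definition Lp_norm D (p : R) f : \bar R :=
  'N[mu]_p%:E [EFin \o (f \_ D)].

(* Membership in W^{k,p}(D). Functions stand for their classes modulo equality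
   almost everywhere on D; values outside D are irrelevant. *)
Definition sobolev D k (p : R) f :=
  forall a : mindex d k, (mdeg a <= k)%N ->
    exists2 g, weak_derivative D a f g & (Lp_norm D p g < +oo)%E.

Definition sobolev_seminorm D k (p : R) f : \bar R :=
  ((\sum_(a : mindex d k | mdeg a == k) Lp_norm D p (weakD D a f) `^ p) `^ p^-1)%E.

Definition sobolev_norm D k (p : R) f : \bar R :=
  ((\sum_(a : mindex d k | (mdeg a <= k)%N) Lp_norm D p (weakD D a f) `^ p)
     `^ p^-1)%E.

(* W^{-k,2}(D), the dual of the whole of W^{k,2}(D). *)
Definition sobolev_dual D k (F : ('rV[R]_d -> R) -> R) :=
  (forall c f g, sobolev D k 2 f -> sobolev D k 2 g ->
     F (fun x => c * f x + g x) = c * F f + F g) /\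
  exists M : R, forall f, sobolev D k 2 f ->
     (`|F f|%:E <= M%:E * sobolev_norm D k 2 f)%E.

Definition sobolev_dual_norm D k (F : ('rV[R]_d -> R) -> R) : \bar R :=
  ereal_sup [set `|F v|%:E | v in
    [set v | sobolev D k 2 v /\ (sobolev_norm D k 2 v <= 1)%E]].

Definition L2_functional D f (v : 'rV[R]_d -> R) : R :=
  \int[mu]_(x in D) (f x * v x).

Definition bounded_domain D := [/\ D !=set0, open D, connected D & bounded_set D].

Definition stein_extension D := forall k : nat,
  exists E : ('rV[R]_d -> R) -> 'rV[R]_d -> R,
  [/\ forall f, sobolev D k 2 f ->
        sobolev setT k 2 (E f) /\ {ae mu, forall x, D x -> E f x = f x},
      forall c f g, sobolev D k 2 f -> sobolev D k 2 g ->
        {ae mu, forall x, E (fun y => c * f y + g y) x = c * E f x + E g x} &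
      exists M : R, forall f, sobolev D k 2 f ->
        (sobolev_norm setT k 2 (E f) <= M%:E * sobolev_norm D k 2 f)%E].

End sobolev.

Section grid.
Variables (R : realType) (d : nat) (sigma : R).
Local Notation mu := (lebesgue_rV R d).
Implicit Types (i j : 'rV[int]_d) (Omega : set 'rV[R]_d).

Definition node i : 'rV[R]_d := \row_l ((i ord0 l)%:~R * sigma).

Definition patch_of i : set 'rV[R]_d := [set x | forall l,
  ((i ord0 l)%:~R - 1) * sigma < x ord0 l < ((i ord0 l)%:~R + 1) * sigma].

Definition core_of i : set 'rV[R]_d := [set x | forall l,
  ((i ord0 l)%:~R - 2^-1) * sigma < x ord0 l < ((i ord0 l)%:~R + 2^-1) * sigma].

Definition element i : set 'rV[R]_d := [set x | forall l,
  (i ord0 l)%:~R * sigma < x ord0 l < ((i ord0 l)%:~R + 1) * sigma].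

Definition merge_elements (I : set 'rV[int]_d) : set 'rV[R]_d :=
  (\bigcup_(i in I) closure (element i))°.

Definition fictitious Omega : set 'rV[R]_d :=
  merge_elements [set i | (0 < mu (element i `&` Omega))%E].

(* M is the set of the elements inside Omega that are moved from the uncut to
   the cut part. *)
Definition cut_part Omega (M : set 'rV[int]_d) : set 'rV[R]_d :=
  merge_elements [set i | element i `<=` fictitious Omega /\
    (~ element i `<=` Omega \/ M i)].

Definition uncut_part Omega (M : set 'rV[int]_d) : set 'rV[R]_d :=
  merge_elements [set i | [/\ element i `<=` fictitious Omega,
    element i `<=` Omega & ~ M i]].

Definition neighbors i j :=
  exists n, closure (element i) (node n) /\ closure (element j) (node n).

Definition cut_chains Omega M (K : nat) :=
  forall i, element i `<=` cut_part Omega M ->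
  exists n (q : nat -> 'rV[int]_d),
    [/\ (n.+1 <= K)%N, q 0%N = i,
        forall l, (l <= n)%N -> element (q l) `<=` cut_part Omega M,
        forall l, (l < n)%N -> neighbors (q l) (q l.+1) &
        exists j, element j `<=` uncut_part Omega M /\ neighbors (q n) j].

Definition bramble_hilbert Omega (P : nat) (C : R) :=
  forall i, patch_of i `&` fictitious Omega !=set0 ->
  let D := fictitious Omega `&` patch_of i in
  forall w, sobolev D P.+1 2 w ->
  exists c : mindex d P -> R, forall k, (k <= P.+1)%N ->
    (sobolev_seminorm D k 2 (fun x => w x - multipoly c x)%R <=
     (C * sigma ^+ (P.+1 - k))%:E * sobolev_seminorm D P.+1 2 w)%E.

Definition bump_profile (t : R) : R :=
  if `|t| < 2^-1 then expR (- (1 - 4 * t ^+ 2)^-1) else 0.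

Definition mollifier1 (t : R) : R :=
  (\int[@lebesgue_measure R]_s bump_profile s)^-1 * bump_profile t.

Definition mollifier (x : 'rV[R]_d) : R :=
  sigma ^- d * \prod_l mollifier1 ((sigma^-1 *: x) ord0 l).

Definition convolution (f g : 'rV[R]_d -> R) (x : 'rV[R]_d) : R :=
  \int[mu]_y (f y * g (x - y)).

Definition pu i : 'rV[R]_d -> R := convolution \1_(core_of i) mollifier.

(* V_sigma^P: restrictions to the fictitious domain of finite linear
   combinations; the restriction is extended by zero, so that two elements of
   the space are equal iff they agree on the fictitious domain. *)
Definition trial_space Omega (P : nat) : set ('rV[R]_d -> R) :=
  [set v | exists (s : seq 'rV[int]_d) (c : 'rV[int]_d -> mindex d P -> R),
    v = (fun x => \sum_(i <- s) \sum_(a : mindex d P | (mdeg a <= P)%N)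
          c i a * (pu i x * monomial a x)) \_ (fictitious Omega)].

(* Trial functions are smooth on the (open) elements, so the derivatives here
   are the classical ones. *)
Definition stabilization Omega M (P : nat) (u v : 'rV[R]_d -> R) : R :=
  sigma ^+ (2 * P.+1) *
  \sum_(i \in [set i | element i `<=` cut_part Omega M])
    \sum_(a : mindex d P.+1 | mdeg a == P.+1)
      \int[mu]_(x in element i) (partial a u x * partial a v x).

End grid.

Section quadrature.
Variables (R : realType) (d : nat).
Local Notation mu := (lebesgue_rV R d).

(* A rule is its list of (weight, node) pairs. *)
Definition quad (I : seq (R * 'rV[R]_d)) (f : 'rV[R]_d -> R) : R :=
  \sum_(q <- I) q.1 * f q.2.

(* Point values of a class in W^{m+1,1}(Omega) are those of its continuous
   representative. *)
Definition quadrature_rule (Omega : set 'rV[R]_d) (m : nat) (h C : R)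
    (I : seq (R * 'rV[R]_d)) :=
  (forall q, q \in I -> Omega q.2) /\
  forall f, {within Omega, continuous f} -> sobolev Omega m.+1 1 f ->
    (`|\int[mu]_(x in Omega) f x - quad I f|%:E <=
     (C * h ^+ m.+1)%:E * sobolev_seminorm Omega m.+1 1 f)%E.

Definition stabilized_form Omega M (P : nat) (sigma eps : R) I
    (u v : 'rV[R]_d -> R) : R :=
  quad I (fun x => u x * v x) + eps * stabilization sigma Omega M P u v.

End quadrature.

(* Main.v *)
(* Let N(g)^2 be the sum of the squared L^2-norms of a trial function g over the
   elements of Omega_sigma. On each element a rescaled trial function is a
   combination of finitely many fixed smooth functions, so |g|_{W^n} is bounded by
   C sigma^-n N(g), however the boundary cuts the grid. If g vanishes on Q_j and
   its derivatives of order P+1 vanish on a neighbour Q_i, then g is a polynomial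
   on Q_i whose derivatives vanish at a shared node, hence g = 0 on Q_i; by finite
   dimension this turns into
     |g|^2_{Q_i} <= C (|g|^2_{Q_j} + sigma^{2(P+1)} sum_alpha |d^alpha g|^2_{Q_i}),
   and summing along the chains gives N(g)^2 <= C (|g|^2_Omega + j(g, g)).
   The quadrature error of a product g g' is at most C (h/sigma)^{m+1} N(g) N(g'),
   and h/sigma = sigma^{s-1} is small, so A_h is coercive with respect to N.
   Finally let v = sum_i phi_i v_i, with v_i the Bramble-Hilbert polynomials of the
   Stein extension of u, and e = u_sigma - v. Then A_h(e, e) is the sum of
   <u_h - u, e>, (u - v, e)_Omega, the quadrature error of v e and -eps j(v, e),
   each of which is at most C (sigma^{P+1} + (h/sigma)^{m+1}) ||u|| N(e). *)
From HB Require Import structures.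
Require Import Defs.
From mathcomp Require Import all_boot all_order all_algebra.
From mathcomp Require Import all_classical all_reals all_analysis.
From mathcomp Require Import measurable_realfun ring lra zify.
Set Implicit Arguments.
Unset Strict Implicit.
Unset Printing Implicit Defensive.
Import Order.TTheory GRing.Theory Num.Theory.
Import numFieldNormedType.Exports.
Local Open Scope classical_set_scope.
Local Open Scope ring_scope.

(** * Smooth functions of one variable *)

(** No constant may depend on how the boundary cuts the grid. So every local estimate is made on
    whole elements, rescaled to the unit cube, and Stein's extension is conjugated with
    translations, so that one operator norm serves every position of the domain. The
    finite-dimensional step uses no compactness: a linear functional that vanishes on the null
    vectors of a positive semidefinite form is bounded by that form, with a constant read off from a
    pseudo-inverse. The generating families may be dependent, so the forms are only semidefinite.
    The same linear algebra ([qform_solve]) yields the discrete solution. Smoothness is handled by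
    two inductive predicates, [sm] and [smd], closed under differentiation and large enough for
    trial functions and cutoffs; only test functions remain arbitrary. Since [weakD] picks some
    representative, the fundamental lemma of the calculus of variations is needed before the norms
    of trial functions can be computed. Products are estimated by Young's inequality with a free
    weight t, which is optimised only at the end ([young_cs]). *)

Section smooth1.
Variable R : realType.
Implicit Types f g : R -> R.

(** Differentiating exp(-1/t) produces negative powers of t; with these included, the family is
    closed under differentiation up to linear combinations. *)
Definition flat (k : nat) (t : R) : R :=
  if 0 < t then t ^- k * expR (- t^-1) else 0.

(* [sm_prim] covers the convolution of the mollifier with an interval. *)
Inductive sm : (R -> R) -> Prop :=
| sm_cst c : sm (fun=> c)
| sm_id : sm (fun x => x)
| sm_add f g : sm f -> sm g -> sm (fun x => f x + g x)
| sm_mul f g : sm f -> sm g -> sm (fun x => f x * g x)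
| sm_flat k : sm (flat k)
| sm_exp : sm expR
| sm_comp f g : sm f -> sm g -> sm (fun x => f (g x))
| sm_prim f g : sm g -> (forall x, is_derive x (1:R) f (g x)) -> sm f.

(** For n > 0 put y = 1/(n t). Then y <= exp y, and the n-th power of this, y^n <= exp(1/t), is the
    claim inverted. *)
Lemma expRN_le_exp n (t : R) : 0 < t -> expR (- t^-1) <= (n%:R * t) ^+ n.
Proof.
move=> t0; case: n => [|n]; first by rewrite expr0 expR_le1 oppr_le0 invr_ge0 ltW.
rewrite expRN -[leRHS]invrK lef_pV2 ?posrE ?expR_gt0 ?invr_gt0 ?exprn_gt0 ?mulr_gt0//.
have -> : t^-1 = n.+1%:R * (n.+1%:R * t)^-1.
  by rewrite invfM mulrA mulfV// mul1r.
rewrite expRM_natl -exprVn lerXn2r ?nnegrE ?expR_ge0 ?invr_ge0 ?mulr_ge0 ?(ltW t0)//.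
by apply: le_trans (expR_ge1Dx _); rewrite lerDr.
Qed.

(** Two powers of [t]: the difference quotient at 0 uses up one of them and still tends to 0. *)
Lemma flat_le k (t : R) : `|flat k t| <= (k.+2%:R) ^+ k.+2 * t ^+ 2.
Proof.
rewrite /flat; case: ifPn => [t0|_]; last by rewrite normr0 mulr_ge0// sqr_ge0.
rewrite ger0_norm ?mulr_ge0 ?expR_ge0 ?invr_ge0 ?exprn_ge0 ?(ltW t0)//.
rewrite mulrC ler_pdivrMr ?exprn_gt0// (le_trans (expRN_le_exp k.+2 t0))//.
by rewrite exprMn (_ : t ^+ k.+2 = t ^+ 2 * t ^+ k) ?mulrA// -exprD.
Qed.

Lemma is_derive_mul (f g : R -> R) (x a b c : R) : is_derive x (1:R) f a ->
  is_derive x (1:R) g b -> c = f x * b + g x * a ->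
  is_derive x (1:R) (fun t => f t * g t) c.
Proof. by move=> fa gb ->; exact: is_deriveM. Qed.

Lemma is_derive_flat k (x : R) :
  is_derive x (1:R) (flat k) (flat k.+2 x - k%:R * flat k.+1 x).
Proof.
have [x0|x0|->] := ltgtP x 0.
- rewrite {2 3}/flat !ltNge (ltW x0) /= mulr0 subr0.
  suff : \forall y \near x, cst (0:R) y = flat k y.
    by move/near_eq_is_derive; apply; exact: is_derive_cst.
  near=> y; rewrite /flat ltNge (_ : y <= 0 = true)//.
  by apply: ltW; near: y; exact: lt_nbhsl.
- rewrite {2 3}/flat x0.
  apply: (@near_eq_is_derive _ _ _ (fun t : R => t^-1 ^+ k * expR (- t^-1))).
    near=> y; rewrite /flat exprVn (_ : 0 < y)//.
    by near: y; exact: lt_nbhsr.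
  have x0' : x != 0 by rewrite gt_eqF.
  have D1 : is_derive x (1:R) (fun t : R => t^-1) (- x ^- 2 *: 1) by apply: is_deriveV.
  have D2 : is_derive x (1:R) (fun t : R => expR (- t^-1)) (x ^- 2 * expR (- x^-1)).
    have H : is_derive x (1:R) (fun t : R => - t^-1) (x ^- 2).
      by apply: is_derive_eq; rewrite scaleNr opprK [_ *: _]mulr1.
    have H1 : is_derive (- x^-1) (1:R) expR (expR (- x^-1)) by exact: is_derive_expR.
    have := @is_derive1_comp _ expR (fun t : R => - t^-1) x _ _ H1 H; rewrite mulrC; exact.
  have D3 : is_derive x (1:R) (fun t : R => t^-1 ^+ k) (- k%:R * x^-1 ^+ k.+1).
    elim: k => [|k IH]; first by rewrite oppr0 mul0r; exact: is_derive_cst.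
    under eq_fun do rewrite exprS.
    apply: (is_derive_mul D1 IH).
    by rewrite /GRing.scale/= mulr1 -exprVn -nat1r !exprS expr0; ring.
  apply: (is_derive_mul D3 D2).
  by rewrite /GRing.scale/= -!exprVn !exprS expr0; ring.
- rewrite {2 3}/flat ltxx mulr0 subr0.
  have key : (fun h : R => h^-1 *: (flat k (h *: (1:R) + 0) - flat k 0)) @ 0^' --> (0:R).
    have cvg0 : ((k.+2%:R ^+ k.+2 : R) * `|h|) @[h --> (0:R)^'] --> (0 : R).
      rewrite -[X in _ --> X](mulr0 (k.+2%:R ^+ k.+2)); apply: cvgM; first exact: cvg_cst.
      rewrite -[X in _ --> X](@normr0 R R); apply: (@cvg_norm _ _ _ (nbhs 0^')).
      exact: nbhs_dnbhs.
    apply: norm_cvg0; apply: (@squeeze_cvgr _ _ _ _ (cst 0) (fun h => k.+2%:R ^+ k.+2 * `|h|)) => //; last exact: cvg_cst.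
    near=> h; rewrite normr_ge0 /=.
    have h0 : h != 0 by near: h; exact: nbhs_dnbhs_neq.
    rewrite /GRing.scale/= mulr1 addr0 {2}/flat ltxx subr0 normrM normfV.
    rewrite ler_pdivrMl ?normr_gt0// (le_trans (flat_le k h))//.
    by rewrite -(real_normK (num_real h)) [leRHS]mulrCA.
  apply: DeriveDef; first by apply/cvg_ex; exists 0.
  exact/cvg_lim.
Unshelve. all: by end_near. Qed.

(** The derivative stays in the class, so membership in [sm] gives derivatives of all orders. *)
Lemma sm_derive f : sm f -> exists2 f', sm f' & forall x, is_derive x (1:R) f (f' x).
Proof.
elim=> {f} [c||f g _ [f' sf' df] _ [g' sg' dg]|f g sf [f' sf' df] sg [g' sg' dg]|k||
  f g _ [f' sf' df] sg [g' sg' dg]|f g sg _ df].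
- by exists (fun=> 0); [exact: sm_cst|move=> x; exact: is_derive_cst].
- by exists (fun=> 1); [exact: sm_cst|move=> x; exact: is_derive_id].
- exists (fun x => f' x + g' x); first exact: sm_add.
  by move=> x; exact: is_deriveD.
- exists (fun x => f x * g' x + g x * f' x).
    by apply: sm_add; apply: sm_mul.
  by move=> x; exact: is_deriveM.
- exists (fun x => flat k.+2 x + (- k%:R) * flat k.+1 x).
    by apply: sm_add; [exact: sm_flat|apply: sm_mul; [exact: sm_cst|exact: sm_flat]].
  by move=> x; rewrite mulNr; exact: is_derive_flat.
- by exists expR; [exact: sm_exp|move=> x; exact: is_derive_expR].
- exists (fun x => f' (g x) * g' x).
    by apply: sm_mul => //; exact: sm_comp.
  by move=> x; apply: is_derive1_comp.
- by exists g.
Qed.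

Lemma sm_derivable f x : sm f -> derivable f x 1.
Proof. by move=> /sm_derive[f' _ /(_ x)[]]. Qed.

Lemma sm_derive1 f : sm f -> sm (derive1 f).
Proof.
move=> /sm_derive[f' sf' df]; suff -> : derive1 f = f' by [].
by apply/funext => x; rewrite derive1E; have [_] := df x.
Qed.

Lemma sm_continuous f : sm f -> continuous f.
Proof.
move=> sf x; apply: differentiable_continuous; apply/derivable1_diffP.
exact: sm_derivable.
Qed.

Lemma sm_opp f : sm f -> sm (fun x => - f x).
Proof.
move=> sf; rewrite (_ : (fun _ => _) = (fun x => (-1) * f x)).
  by apply: sm_mul => //; exact: sm_cst.
by apply/funext => x; rewrite mulN1r.
Qed.

Lemma sm_sub f g : sm f -> sm g -> sm (fun x => f x - g x).
Proof. by move=> sf sg; apply: sm_add => //; exact: sm_opp. Qed.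

Lemma sm_exprn f n : sm f -> sm (fun x => f x ^+ n).
Proof.
move=> sf; elim: n => [|n IH]; first exact: sm_cst.
by under eq_fun do rewrite exprS; exact: sm_mul.
Qed.

Lemma sm_affine f a b : sm f -> sm (fun x => f (a * x + b)).
Proof.
move=> sf; apply: (@sm_comp f (fun x => a * x + b)) => //.
apply: sm_add; last exact: sm_cst.
by apply: sm_mul; [exact: sm_cst|exact: sm_id].
Qed.

(** Partial fractions: 1/(1 - 4 t^2) = 1/(2 - 4 t) + 1/(2 + 4 t), and each factor switches off one
    side of the support. *)
Lemma bump_profileE : @bump_profile R = fun t => flat 0 ((- 4) * t + 2) * flat 0 (4 * t + 2).
Proof.
apply/funext => t; rewrite /bump_profile /flat !expr0 !invr1 !mul1r ltr_norml.
have [t1|t1] := ltP t 2^-1; last by rewrite andbF ifF ?mul0r//; apply/negbTE; rewrite -leNgt; lra.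
have [t2|t2] := ltP (- 2^-1) t; last first.
  by rewrite /= [X in _ * X]ifF ?mulr0//; apply/negbTE; rewrite -leNgt; lra.
rewrite /= !ifT; try lra.
rewrite -expRD; congr expR; field; apply/and3P; split; apply/eqP; nra.
Qed.

Lemma sm_bump_profile : sm (@bump_profile R).
Proof.
rewrite bump_profileE; apply: sm_mul; apply: sm_affine; exact: sm_flat.
Qed.

Lemma sm_mollifier1 : sm (@mollifier1 R).
Proof. by apply: sm_mul; [exact: sm_cst|exact: sm_bump_profile]. Qed.

Local Notation leb := (@lebesgue_measure R).

Lemma bump_profile_ge0 t : 0 <= bump_profile t :> R.
Proof. by rewrite /bump_profile; case: ifP => // _; exact: expR_ge0. Qed.

Lemma bump_profile_eq0 (t : R) : 2^-1 <= `|t| -> bump_profile t = 0.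
Proof. by rewrite /bump_profile ltNge => ->. Qed.

Lemma integrable_bump_profile : leb.-integrable setT (EFin \o @bump_profile R).
Proof.
have -> : EFin \o @bump_profile R = (EFin \o @bump_profile R) \_ `[-1, 1].
  apply/funext => t; rewrite patchE; case: ifPn => //.
  rewrite notin_setE/= in_itv/= => h; rewrite /= bump_profile_eq0//.
  by rewrite leNgt ltr_norml; apply/negP => /andP[t1 t2]; apply: h; lra.
apply/(@integrable_mkcond _ _ _ leb `[-1, 1]%classic) => //.
apply: continuous_compact_integrable; first exact: segment_compact.
by apply: continuous_subspaceT => x; exact: sm_continuous sm_bump_profile x.
Qed.

Lemma integrable_mollifier1 D : measurable D -> leb.-integrable D (EFin \o @mollifier1 R).
Proof.
move=> mD; apply: (@integrableS _ _ _ leb setT) => //.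
rewrite (_ : _ \o _ = (fun x => (\int[leb]_s bump_profile s)^-1%:E * (EFin \o @bump_profile R) x)%E).
  exact/integrableZl/integrable_bump_profile.
by apply/funext => x /=; rewrite -EFinM.
Qed.

Lemma Rintegral_bump_profile_gt0 : 0 < \int[leb]_s bump_profile s :> R.
Proof.
(* On [-1/4, 1/4] one has 1 - 4 x^2 >= 3/4, so the profile is at least [c] on an interval of length
   1/2. *)
pose c : R := expR (- (3 / 4)^-1).
have : c * 2^-1 <= \int[leb]_s bump_profile s :> R.
  have -> : c * 2^-1 = \int[leb]_(s in `[- 4^-1, 4^-1]) c.
    by rewrite Rintegral_cst//= lebesgue_measure_itv/= lte_fin ifT/=; [congr (_ * _)|]; lra.
  have mi : measurable (`[- 4^-1, 4^-1]%classic : set R) by [].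
  apply: (@le_trans _ _ (\int[leb]_(s in `[- 4^-1, 4^-1]) bump_profile s)).
    apply: le_Rintegral => //.
    - apply: (@measurable_bounded_integrable _ _ _ leb) => //.
        by rewrite /= lebesgue_measure_itv/=; case: ifP => // _; rewrite ltry.
      by exists `|c|; split => // y cy x _ /=; exact: ltW.
    - exact: integrableS integrable_bump_profile.
    - move=> x /=; rewrite in_itv/= => /andP[x1 x2].
      rewrite /bump_profile ifT; last by rewrite ltr_norml; lra.
      by rewrite /c ler_expR lerN2 lef_pV2 ?posrE; nra.
  rewrite [leRHS]Rintegral_mkcond [leLHS]Rintegral_mkcond; apply: le_Rintegral => //.
  - rewrite -restrict_EFin; apply/integrable_restrict => //; rewrite setTI.
    exact: integrableS integrable_bump_profile.
  - by rewrite -restrict_EFin; apply/integrable_restrict => //; rewrite setTI; exact: integrable_bump_profile.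
  - move=> x _; rewrite [leRHS]patchE mem_set// patchE; case: ifP => // _.
    exact: bump_profile_ge0.
by apply: lt_le_trans; rewrite mulr_gt0 ?expR_gt0.
Qed.

Lemma mollifier1_ge0 t : 0 <= mollifier1 t :> R.
Proof. by rewrite mulr_ge0 ?bump_profile_ge0// invr_ge0 ltW// Rintegral_bump_profile_gt0. Qed.

Lemma mollifier1_eq0 (t : R) : 2^-1 <= `|t| -> mollifier1 t = 0.
Proof. by rewrite /mollifier1 => /bump_profile_eq0 ->; rewrite mulr0. Qed.

Lemma Rintegral_mollifier1 : \int[leb]_t mollifier1 t = 1 :> R.
Proof.
rewrite RintegralZl//; last exact: integrable_bump_profile.
by rewrite mulVf// gt_eqF// Rintegral_bump_profile_gt0.
Qed.

Definition mollifier1_prim (x : R) : R := \int[leb]_(t in `]-oo, x]) mollifier1 t.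

Lemma is_derive_mollifier1_prim (x : R) :
  is_derive x (1:R) mollifier1_prim (mollifier1 x).
Proof.
have [||||dF F'] := @continuous_FTC1 R (@mollifier1 R) -oo%O x (x + 1).
- by rewrite ltrDl.
- exact: integrable_mollifier1.
- by rewrite ltNyr.
- exact/sm_continuous/sm_mollifier1.
- by apply: DeriveDef; [exact: dF|rewrite -derive1E; exact: F'].
Qed.

Lemma sm_mollifier1_prim : sm mollifier1_prim.
Proof. by apply: sm_prim sm_mollifier1 _ => x; exact: is_derive_mollifier1_prim. Qed.

Lemma mollifier1_prim0 (x : R) : x <= - 2^-1 -> mollifier1_prim x = 0.
Proof.
move=> x1; rewrite /mollifier1_prim (@eq_Rintegral _ _ _ leb _ (cst 0)) ?Rintegral_cst ?mul0r//.
move=> t; rewrite inE/= in_itv/= => tx; rewrite mollifier1_eq0//.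
by rewrite leNgt ltr_norml; apply/negP => /andP[]; lra.
Qed.

Lemma mollifier1_prim1 (x : R) : 2^-1 <= x -> mollifier1_prim x = 1.
Proof.
move=> x1; rewrite /mollifier1_prim Rintegral_mkcond -Rintegral_mollifier1.
apply: eq_Rintegral => t _; rewrite patchE; case: ifPn => // /negP.
rewrite inE/= in_itv/= => /negP; rewrite -ltNge => tx; rewrite mollifier1_eq0//.
by rewrite leNgt ltr_norml; apply/negP => /andP[]; lra.
Qed.

Lemma mollifier1_prim_le (x y : R) : x <= y -> mollifier1_prim x <= mollifier1_prim y.
Proof.
move=> xy; rewrite /mollifier1_prim [leRHS]Rintegral_mkcond [leLHS]Rintegral_mkcond.
apply: le_Rintegral => //.
- by rewrite -restrict_EFin; apply/integrable_restrict => //; rewrite setTI; exact: integrable_mollifier1.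
- by rewrite -restrict_EFin; apply/integrable_restrict => //; rewrite setTI; exact: integrable_mollifier1.
- move=> t _; rewrite !patchE; case: ifPn; rewrite ?inE ?notin_setE/= in_itv/= => tx.
    by rewrite ifT// inE/= in_itv/= (le_trans tx).
  by case: ifP => // _; exact: mollifier1_ge0.
Qed.

(* [pu sigma i x] is the product over [l] of [hat (x_l / sigma - i_l)] ([puE]). *)
Definition hat (t : R) : R := mollifier1_prim (t + 2^-1) - mollifier1_prim (t - 2^-1).

Lemma sm_hat : sm hat.
Proof.
have H b : sm (fun t => mollifier1_prim (t + b)).
  have := sm_affine 1 b sm_mollifier1_prim.
  by under eq_fun do rewrite mul1r.
by apply: sm_sub; exact: H.
Qed.

Lemma hat_ge0 t : 0 <= hat t.
Proof. by rewrite subr_ge0 mollifier1_prim_le//; lra. Qed.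

Lemma hat_eq0 t : 1 <= `|t| -> hat t = 0.
Proof.
rewrite leNgt ltr_norml negb_and -!leNgt => /orP[] h.
  by rewrite /hat !mollifier1_prim0 ?subrr//; lra.
by rewrite /hat !mollifier1_prim1 ?subrr//; lra.
Qed.

(** The sum telescopes to the primitive at t + 1/2 minus the primitive at t - 3/2, and the primitive
    is 1 to the right of 1/2 and 0 to the left of -1/2. *)
Lemma hat_partition t : 0 <= t <= 1 -> hat t + hat (t - 1) = 1.
Proof.
move=> /andP[t0 t1]; rewrite /hat (_ : t - 1 + 2^-1 = t - 2^-1); last lra.
by rewrite (@mollifier1_prim1 (t + 2^-1)) ?(@mollifier1_prim0 (t - 1 - 2^-1)); lra.
Qed.

End smooth1.

(** * Lebesgue measure on row vectors *)

Section measure_rV.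
Variable R : realType.
Local Notation leb := (@lebesgue_measure R).
Local Notation mu n := (lebesgue_rV R n).

Lemma measurable_coord_rV n (i : 'I_n) :
  measurable_fun setT (fun v : 'rV[R]_n => v ord0 i : measurableTypeR R).
Proof.
move=> _ B mB; rewrite setTI; apply: sub_sigma_algebra; rewrite -bigcup_seq/=.
by exists i; [rewrite /= mem_index_enum | exists B => //; rewrite setTI].
Qed.

Definition prod_set n (A : 'I_n -> set R) : set 'rV[R]_n :=
  [set x | forall l, A l (x ord0 l)].

Lemma measurable_prod_set n (A : 'I_n -> set R) :
  (forall l, measurable (A l)) -> measurable (prod_set A).
Proof.
move=> mA; rewrite (_ : prod_set A = \bigcap_(l in setT) ((fun x : 'rV[R]_n => x ord0 l) @^-1` A l)); last first.
  by apply/seteqP; split => [x Ax l _|x Ax l]; [exact: Ax|exact: Ax].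
apply: fin_bigcap_measurable; first exact: finite_finset.
by move=> l _; have := measurable_coord_rV l measurableT (mA l); rewrite setTI.
Qed.

(** The sigma-algebra is generated by the coordinates, so an open set is written as a countable
    union of cubes with rational centres and radii 1/(k+1); the cubes that leave [U] are replaced by
    the empty set. *)
Lemma open_measurable_rV n (U : set 'rV[R]_n) : open U -> measurable U.
Proof.
move=> oU.
pose B (q : 'rV[rat]_n * nat) : set 'rV[R]_n :=
  [set x | forall l, `|x ord0 l - ratr (q.1 ord0 l)| < q.2.+1%:R^-1].
have mB q : measurable (B q).
  rewrite (_ : B q = prod_set (fun l => [set t | `|t - ratr (q.1 ord0 l)| < q.2.+1%:R^-1]))//.
  apply: measurable_prod_set => l; apply: open_measurable.
  rewrite (_ : [set t | _] = ball (ratr (q.1 ord0 l) : R) q.2.+1%:R^-1); first exact: ball_open.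
  by apply/seteqP; split => t; rewrite /ball/= distrC.
have -> : U = \bigcup_q (if `[< B q `<=` U >] then B q else set0).
  apply/seteqP; split => [x Ux|x [q _]]; last by case: asboolP => // /[apply].
  have /nbhs_ballP[e /= e0 xeU] : nbhs x U by apply: open_nbhs_nbhs; split.
  have [k ke] : exists k, k.+1%:R^-1 < e / 2.
    have /ltr_add_invr[k] : 0 < e / 2 by rewrite divr_gt0.
    by rewrite add0r => H; exists k.
  have /choice[q qP] : forall l : 'I_n, exists q : rat, `|x ord0 l - ratr q| < k.+1%:R^-1.
    move=> l; have /rat_in_itvoo[q] : x ord0 l - k.+1%:R^-1 < x ord0 l + k.+1%:R^-1.
      by rewrite ltrD2l; apply: (@lt_trans _ _ 0); rewrite ?oppr_lt0 invr_gt0.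
    by rewrite in_itv/= => q1; exists q; rewrite ltr_distlC.
  have BU : B (\row_l q l, k) `<=` U.
    move=> y yq; apply: xeU; split => // i l; have -> : i = ord0 by exact: ord1.
    rewrite /ball/=; move: (yq l) (qP l) ke; rewrite /= mxE.
    move: (k.+1%:R^-1) => r; rewrite !ltr_norml => /andP[? ?] /andP[? ?] ?.
    by apply/andP; split; lra.
  by exists (\row_l q l, k) => //; rewrite asboolT// => l; rewrite mxE.
apply: countable_bigcupT_measurable; first exact: (@countableP ('rV[rat]_n * nat)%type setT).
by move=> q; case: ifP.
Qed.

Lemma continuous_measurable_rV n (f : 'rV[R]_n -> R) (D : set 'rV[R]_n) :
  continuous f -> measurable_fun D f.
Proof.
move=> cf; apply: measurable_funTS.
apply: (measurability _ (RGenOpens.measurableE R)).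
move=> _ [_ [a [b ->] <-]]; rewrite setTI; apply: open_measurable_rV.
by move/continuousP : cf; apply; exact: interval_open.
Qed.

Lemma cons_rV0 n (p : 'rV[R]_n * R) : cons_rV p ord0 ord0 = p.2.
Proof. by rewrite mxE unlift_none. Qed.

Lemma cons_rV_lift n (p : 'rV[R]_n * R) l : cons_rV p ord0 (lift ord0 l) = p.1 ord0 l.
Proof. by rewrite mxE liftK. Qed.

Lemma prod_set_cons n (A : 'I_n.+1 -> set R) :
  @cons_rV R n @^-1` prod_set A = prod_set (A \o lift ord0) `*` A ord0.
Proof.
apply/seteqP; split => [p Ap|p [Ap1 Ap2] l].
  by split => [l|]; [have := Ap (lift ord0 l); rewrite cons_rV_lift|have := Ap ord0; rewrite cons_rV0].
by case: (unliftP ord0 l) => [j|] ->; [rewrite cons_rV_lift; exact: Ap1|rewrite cons_rV0].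
Qed.

Lemma lebesgue_prod_set n (A : 'I_n -> set R) : (forall l, measurable (A l)) ->
  mu n (prod_set A) = (\prod_(l < n) leb (A l))%E.
Proof.
elim: n A => [A _|n IH A mA].
  rewrite big_ord0 /= diracE mem_set//; by case.
rewrite big_ord_recl [LHS]/= /cons_measure /pushforward prod_set_cons product_measure1E//.
- by rewrite muleC; congr (_ * _)%E; apply: IH => l; exact: mA.
- by apply: measurable_prod_set => l; exact: mA.
- exact: mA.
Qed.

Lemma sigma_finite_lebesgue_rV n : sigma_finite setT (mu n).
Proof.
exists (fun k => prod_set (fun=> `]- k%:R, k%:R[%classic)).
  apply/esym; rewrite -subTset => x _.
  exists (Num.truncn (`|x|)).+1 => // l; rewrite /= in_itv/= -ltr_norml.
  apply: le_lt_trans (truncnS_gt _).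
  rewrite /Num.norm/= mx_normE; exact: (le_bigmax _ (fun i : 'I_1 * 'I_n => `|x i.1 i.2|%:nng) (ord0, l)).
move=> k; split; first by apply: measurable_prod_set => l.
rewrite lebesgue_prod_set// ltey_eq; apply/orP; left; elim/big_ind : _ => //.
  by move=> a b; exact: fin_numM.
by move=> l _; rewrite lebesgue_measure_itv/=; case: ifP.
Qed.

(** The product theorems ask for a sigma-finite first factor. The values of [lebesgue_rV] are
    bundled measures, so the structure is put on this unbundled copy. *)
Definition sf_lebesgue_rV n : set 'rV[R]_n -> \bar R := lebesgue_rV R n.

HB.instance Definition _ n := Measure.copy (@sf_lebesgue_rV n) (Measure.sort (lebesgue_rV R n)).
HB.instance Definition _ n := @Measure_isSigmaFinite.Build _ _ _ (@sf_lebesgue_rV n)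
  (sigma_finite_lebesgue_rV n).

Lemma measurable_comp_cons_rV d (T : measurableType d) n (f : 'rV[R]_n.+1 -> T) :
  measurable_fun setT f -> measurable_fun setT (f \o @cons_rV R n).
Proof. by move=> mf; apply: measurableT_comp => //; exact: measurable_cons_rV. Qed.

Lemma tonelli_rV n (f : 'rV[R]_n.+1 -> \bar R) : measurable_fun setT f ->
  (forall x, 0 <= f x)%E ->
  (\int[mu n.+1]_x f x = \int[mu n]_x \int[leb]_t f (cons_rV (x, t)))%E.
Proof.
move=> mf f0; rewrite /lebesgue_rV -/lebesgue_rV.
rewrite ge0_integral_pushforward//; last exact: measurable_cons_rV.
rewrite preimage_setT.
exact: (@fubini_tonelli1 _ _ _ _ R (@sf_lebesgue_rV n) leb (f \o @cons_rV R n)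
  (measurable_comp_cons_rV mf) (fun=> f0 _)).
Qed.

Lemma integrable_comp_cons_rV n (f : 'rV[R]_n.+1 -> \bar R) :
  (mu n.+1).-integrable setT f ->
  ((@sf_lebesgue_rV n) \x leb)%E.-integrable setT (f \o @cons_rV R n).
Proof.
move=> /integrableP[mf fi]; apply/integrableP; split.
  exact: measurable_comp_cons_rV.
move: fi; rewrite /lebesgue_rV -/lebesgue_rV ge0_integral_pushforward//.
  exact: measurable_cons_rV.
exact: measurableT_comp.
Qed.

Lemma fubini_rV n (f : 'rV[R]_n.+1 -> \bar R) : (mu n.+1).-integrable setT f ->
  (\int[mu n.+1]_x f x = \int[mu n]_x \int[leb]_t f (cons_rV (x, t)))%E.
Proof.
move=> fi; have /integrableP[mf _] := fi.
have fi' := integrable_comp_cons_rV fi.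
have := @integral12_prod_meas1 _ _ _ _ R (@sf_lebesgue_rV n) leb _ fi'.
rewrite /fubini_F /= => ->.
rewrite /lebesgue_rV -/lebesgue_rV.
by rewrite (integral_pushforward (@measurable_cons_rV R n)).
Qed.

(** The first coordinate is integrated last, which leaves slices in the other coordinates for an
    induction on the dimension. *)
Lemma fubini_rV_swap n (f : 'rV[R]_n.+1 -> \bar R) : (mu n.+1).-integrable setT f ->
  (\int[mu n.+1]_x f x = \int[leb]_t \int[mu n]_x f (cons_rV (x, t)))%E.
Proof.
move=> fi; rewrite fubini_rV//.
exact: (@Fubini _ _ _ _ R (@sf_lebesgue_rV n) leb _ (integrable_comp_cons_rV fi)).
Qed.

Lemma measurable_prod_coord n (g : 'I_n -> R -> R) :
  (forall l, measurable_fun setT (g l)) ->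
  measurable_fun setT (fun x : 'rV[R]_n => \prod_(l < n) g l (x ord0 l)).
Proof.
move=> mg; apply: measurable_prod => l _.
exact: (measurableT_comp (mg l) (measurable_coord_rV l)).
Qed.

Lemma integral_prod_coord n (g : 'I_n -> R -> R) :
  (forall l, measurable_fun setT (g l)) -> (forall l t, 0 <= g l t) ->
  (\int[mu n]_x (\prod_(l < n) g l (x ord0 l))%:E =
   \prod_(l < n) \int[leb]_t (g l t)%:E)%E.
Proof.
elim: n g => [|n IH] g mg g0.
  under eq_integral do rewrite big_ord0.
  by rewrite big_ord0 integral_dirac//= diracE mem_set// mul1e.
rewrite tonelli_rV.
- rewrite big_ord_recl -IH => [|l|l t]; [|exact: mg|exact: g0].
  under eq_integral => x _.
    under eq_integral => t _ do
      rewrite big_ord_recl cons_rV0 (eq_bigr _ (fun l _ => congr1 (g _) (cons_rV_lift _ l))) /= mulrC EFinM.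
    rewrite ge0_integralZl_EFin//; last 3 first.
    - by move=> t _; rewrite lee_fin.
    - by apply/measurable_EFinP; exact: mg.
    - by apply: prodr_ge0.
    over.
  rewrite ge0_integralZr//.
  - by rewrite muleC.
  - apply/measurable_EFinP.
    by apply: (measurable_prod_coord (g := fun l => g (lift ord0 l))) => l; exact: mg.
  - by move=> x _; rewrite lee_fin prodr_ge0.
  - by apply: integral_ge0 => t _; rewrite lee_fin.
- by apply/measurable_EFinP; exact: measurable_prod_coord.
- by move=> x; rewrite lee_fin prodr_ge0.
Qed.

(** The pushforward of Lebesgue measure under t -> s t + b, multiplied by s, agrees with Lebesgue
    measure on half-open intervals, hence on all measurable sets. *)
Lemma integral_affine1 (s b : R) (f : R -> \bar R) : 0 < s ->
  measurable_fun setT f -> (forall x, 0 <= f x)%E ->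
  (\int[leb]_t f (s * t + b)%R = s^-1%:E * \int[leb]_t f t)%E.
Proof.
move=> s0 mf f0.
pose phi (t : measurableTypeR R) : measurableTypeR R := s * t + b.
have mphi : measurable_fun setT phi.
  apply: measurable_funD => //; exact: measurable_funM.
pose m := mscale (NngNum (ltW s0))
  (measure_function_pushforward__canonical__measure_function_Measure leb mphi).
have mE A : measurable A -> leb A = m A.
  apply: lebesgue_measure_unique => X [[a c] /= ac <-].
  rewrite /m /mscale/= /pushforward.
  rewrite (_ : phi @^-1` _ = `](a - b) / s, (c - b) / s]%classic); last first.
    apply/seteqP; split => t /=; rewrite !in_itv/= ltr_pdivrMr// ler_pdivlMr// /phi mulrC;
    by move=> /andP[? ?]; apply/andP; split; lra.
  rewrite !lebesgue_measure_itv/= !lte_fin ltr_pM2r ?invr_gt0// ltrD2r.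
  case: ifP => _; last by rewrite mule0.
  by rewrite -!EFinB -EFinM; congr EFin; field; rewrite gt_eqF.
rewrite [in RHS](eq_measure_integral m); last by move=> A mA _; exact: mE.
rewrite ge0_integral_mscale//= ge0_integral_pushforward//= preimage_setT.
by rewrite muleA -EFinM mulVf ?gt_eqF// mul1e.
Qed.

Lemma affine_cons_rV n (s : R) (b : 'rV[R]_n.+1) x t :
  s *: cons_rV (x, t) + b = cons_rV (s *: x + (\row_l b ord0 (lift ord0 l)), s * t + b ord0 ord0).
Proof.
apply/rowP => l; rewrite mxE [in LHS]mxE.
by case: (unliftP ord0 l) => [j|] ->; rewrite ?cons_rV_lift ?cons_rV0//= !mxE.
Qed.

Lemma measurable_affine_rV n (s : R) (b : 'rV[R]_n) :
  measurable_fun setT (fun x : 'rV[R]_n => s *: x + b).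
Proof.
apply: (@measurability _ _ _ _ _ _ (\big[setU/set0]_(i < n)
  preimage_set_system setT (fun v : 'rV[R]_n => v ord0 i) measurable)) => //.
move=> _ [B] + <-; rewrite -bigcup_seq => -[i _] [C mC <-].
rewrite !setTI.
suff : measurable_fun setT (fun x : 'rV[R]_n => s * x ord0 i + b ord0 i).
  move=> /(_ measurableT C mC); rewrite setTI => mH.
  rewrite (_ : _ @^-1` (_ @^-1` C) = (fun x : 'rV[R]_n => s * x ord0 i + b ord0 i) @^-1` C)//.
  by apply/seteqP; split => x /=; rewrite !mxE.
apply: measurable_funD => //; apply: measurable_funM => //.
exact: measurable_coord_rV.
Qed.

Lemma integral_affine n (s : R) (b : 'rV[R]_n) (f : 'rV[R]_n -> \bar R) : 0 < s ->
  measurable_fun setT f -> (forall x, 0 <= f x)%E ->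
  (\int[mu n]_x f (s *: x + b)%R = (s ^- n)%:E * \int[mu n]_x f x)%E.
Proof.
move=> s0; elim: n b f => [|n IH] b f mf f0.
  rewrite !integral_dirac//=; last by apply: measurableT_comp mf _; exact: measurable_affine_rV.
  by rewrite diracE mem_set// expr0 invr1 !mul1e; congr f; apply/rowP => -[].
rewrite !tonelli_rV//; last first.
  by apply: measurableT_comp mf _; exact: measurable_affine_rV.
under eq_integral => x _.
  under eq_integral do rewrite affine_cons_rV.
  rewrite (integral_affine1 _ s0 (f := fun t => f (cons_rV (_, t))))//; last first.
    apply: (measurableT_comp mf).
    apply: (measurableT_comp (@measurable_cons_rV R n)).
    exact: measurable_pair1.
  over.
have mF : measurable_fun setT (fun y => \int[leb]_t f (cons_rV (y, t)))%E.
  exact: (@measurable_fun_fubini_tonelli_F _ _ _ _ R leb (f \o @cons_rV R n)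
    (measurable_comp_cons_rV mf) (fun=> f0 _)).
rewrite ge0_integralZl_EFin; [|exact: measurableT| | |]; last 3 first.
- by move=> x _; apply: integral_ge0 => t _; exact: f0.
- by apply: (measurableT_comp mF); exact: measurable_affine_rV.
- by rewrite invr_ge0 ltW.
rewrite (IH _ (fun y => \int[leb]_t f (cons_rV (y, t)))%E)//; last first.
  by move=> x; exact: integral_ge0.
by rewrite muleA -EFinM -invfM -exprS.
Qed.

(** The integrand has the primitive -[mollifier1_prim] of (x - t)/sigma in the variable t; its
    values at the two ends of the core make up [hat]. *)
Lemma integral_core_mollifier (sigma i x : R) : 0 < sigma ->
  (\int[leb]_t (\1_(`](i - 2^-1) * sigma, (i + 2^-1) * sigma[%classic) t *
     (sigma^-1 * mollifier1 (sigma^-1 * (x - t))))%:E = (hat (x / sigma - i))%:E)%E.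
Proof.
move=> s0; have s00 : sigma != 0 by rewrite gt_eqF.
set a := (i - 2^-1) * sigma; set b := (i + 2^-1) * sigma.
have ab : a < b by rewrite /a /b ltr_pM2r//; lra.
pose f t := sigma^-1 * mollifier1 (sigma^-1 * (x - t)).
pose F t := - mollifier1_prim (sigma^-1 * (x - t)).
have aff g : sm g -> sm (fun t => g (sigma^-1 * (x - t))).
  move=> sg; have := sm_affine (- sigma^-1) (sigma^-1 * x) sg; congr sm.
  by apply/funext => t; congr g; ring.
have sF : sm F by apply/sm_opp/aff/sm_mollifier1_prim.
have sf : sm f by apply: sm_mul; [exact: sm_cst|apply/aff/sm_mollifier1].
have dF t : is_derive t (1:R) F (f t).
  have H : is_derive t (1:R) (fun t => sigma^-1 * (x - t)) (- sigma^-1).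
    apply: (is_derive_mul (is_derive_cst sigma^-1 t 1) (is_deriveB (is_derive_cst x t 1) (is_derive_id t 1))).
    by rewrite mulr0 addr0 sub0r mulrN1.
  have := @is_derive1_comp _ (@mollifier1_prim R) (fun t => sigma^-1 * (x - t)) t _ _
    (is_derive_mollifier1_prim _) H.
  by move=> /is_deriveN; rewrite /f mulrN opprK mulrC.
transitivity (\int[leb]_(t in `]a, b[) (f t)%:E)%E.
  rewrite [RHS]integral_mkcond; apply: eq_integral => t _.
  by rewrite patchE indicE; case: ifP; rewrite ?mul1r ?mul0r.
rewrite -(@integral_itv_bndoo _ a b _ true false); last first.
  apply/measurable_EFinP; apply: measurable_funTS.
  by apply: continuous_measurable_fun; exact: sm_continuous.
rewrite (@continuous_FTC2 _ f F)//.
- rewrite -EFinB /F /hat; congr EFin; rewrite opprK addrC; congr (mollifier1_prim _ - mollifier1_prim _).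
    by rewrite /a; field.
  by rewrite /b; field.
- by apply: continuous_subspaceT => t; exact: sm_continuous sf t.
- split => [t _||]; first by have [] := dF t.
  + by apply: cvg_at_right_filter; exact: sm_continuous sF a.
  + by apply: cvg_at_left_filter; exact: sm_continuous sF b.
- by move=> t _; rewrite derive1E; have [_] := dF t.
Qed.

(** The indicator of the core and the mollifier are both products over the coordinates, so the
    convolution splits into one-dimensional ones. This brings the partition of unity into the form
    that [smd] can express. *)
Lemma puE n (sigma : R) (i : 'rV[int]_n) : 0 < sigma ->
  pu sigma i = fun x => \prod_l hat (x ord0 l / sigma - (i ord0 l)%:~R).
Proof.
move=> s0; apply/funext => x; rewrite /pu /convolution /Rintegral.
pose g l t := \1_(`]((i ord0 l)%:~R - 2^-1) * sigma, ((i ord0 l)%:~R + 2^-1) * sigma[%classic) t *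
     (sigma^-1 * mollifier1 (sigma^-1 * (x ord0 l - t))).
under eq_integral => y _.
  rewrite (_ : \1_(core_of sigma i) y * mollifier sigma (x - y) = \prod_l g l (y ord0 l)); first over.
  rewrite /g big_split/= [X in _ = _ * X]big_split/= /mollifier prodr_const card_ord -exprVn; congr (_ * (_ * _)); last first.
    by apply: eq_bigr => l _; rewrite !mxE.
  have [iy|iy] := pselect (core_of sigma i y).
    rewrite indicE mem_set// big1// => l _; rewrite indicE mem_set//= in_itv/=; exact: iy.
  rewrite indicE memNset//; move: iy => /existsNP[l il].
  by rewrite (bigD1 l)//= indicE memNset ?mul0r//= in_itv/=.
rewrite integral_prod_coord.
- rewrite (eq_bigr (fun l => (hat (x ord0 l / sigma - (i ord0 l)%:~R))%:E)) => [|l _]; last first.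
    by rewrite integral_core_mollifier.
  by rewrite prodEFin.
- move=> l; apply: measurable_funM => //; apply: measurable_funM => //.
  apply: continuous_measurable_fun; apply: sm_continuous.
  apply: (sm_comp (@sm_mollifier1 R)); apply: sm_mul; first exact: sm_cst.
  by apply: sm_sub; [exact: sm_cst|exact: sm_id].
- move=> l t; rewrite mulr_ge0// mulr_ge0 ?mollifier1_ge0// invr_ge0 ltW//.
Qed.

End measure_rV.

(** * Smooth functions of several variables *)

Section smooth_rV.
Variables (R : realType) (d : nat).
Implicit Types f g : 'rV[R]_d -> R.
Local Notation E := (@delta_mx R 1 d ord0).

(** Functions built from functions of one coordinate by sums and products. The partition of unity,
    polynomials and the cutoffs of boxes are of this form, and commuting derivatives and affine
    substitution follow by induction on the predicate. *)
Inductive smd : ('rV[R]_d -> R) -> Prop :=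
| smd_cst c : smd (fun=> c)
| smd_coord (f : R -> R) l : sm f -> smd (fun x => f (x ord0 l))
| smd_add f g : smd f -> smd g -> smd (fun x => f x + g x)
| smd_mul f g : smd f -> smd g -> smd (fun x => f x * g x).

Lemma smd_differentiable f x : smd f -> differentiable f x.
Proof.
elim=> {f}[c|f l sf|f g _ df _ dg|f g _ df _ dg].
- exact: differentiable_cst.
- apply: (@differentiable_comp _ _ _ _ (fun y : 'rV[R]_d => y ord0 l : R) f).
    exact: differentiable_coord.
  by apply/derivable1_diffP; exact: sm_derivable.
- exact: differentiableD.
- exact: differentiableM.
Qed.

Lemma smd_derivable f x v : smd f -> derivable f x v.
Proof. by move=> sf; apply: diff_derivable; exact: smd_differentiable. Qed.

Lemma smd_continuous f : smd f -> continuous f.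
Proof. by move=> sf x; apply: differentiable_continuous; exact: smd_differentiable. Qed.

Definition pd l f : 'rV[R]_d -> R := 'D_(E l) f.

Lemma pd_cst l c : pd l (fun=> c) = fun=> 0.
Proof. by apply/funext => x; exact: derive_cst. Qed.

Lemma pd_coord l k (g : R -> R) : sm g ->
  pd l (fun x => g (x ord0 k)) = fun x => (k == l)%:R * derive1 g (x ord0 k).
Proof.
move=> sg; apply/funext => x; rewrite /pd /derive derive1E.
have [->|kl] := eqVneq k l.
  rewrite mul1r /derive.
  suff -> : (fun h : R => h^-1 *: (((fun y : 'rV[R]_d => g (y ord0 l)) \o shift x) (h *: E l) - g (x ord0 l))) =
    (fun h => h^-1 *: ((g \o shift (x ord0 l)) (h *: (1:R)) - g (x ord0 l))) by [].
  by apply/funext => h /=; rewrite !mxE !eqxx.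
rewrite mul0r; apply/cvg_lim => //; apply: cvg_near_cst; apply: nearW => h /=.
by rewrite !mxE (negbTE kl) andbF mulr0 add0r subrr scaler0.
Qed.

Lemma pd_add l f g : smd f -> smd g ->
  pd l (fun x => f x + g x) = fun x => pd l f x + pd l g x.
Proof. by move=> sf sg; apply/funext => x; rewrite /pd deriveD//; exact: smd_derivable. Qed.

Lemma pd_mul l f g : (forall x, derivable f x (E l)) -> (forall x, derivable g x (E l)) ->
  pd l (fun x => f x * g x) = fun x => f x * pd l g x + g x * pd l f x.
Proof. by move=> sf sg; apply/funext => x; rewrite /pd deriveM. Qed.

Lemma smd_pd_mul l f g : smd f -> smd g ->
  pd l (fun x => f x * g x) = fun x => f x * pd l g x + g x * pd l f x.
Proof. by move=> sf sg; apply: pd_mul => x; exact: smd_derivable. Qed.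

Lemma smd_pd l f : smd f -> smd (pd l f).
Proof.
elim=> {f}[c|f k sf|f g sf pf sg pg|f g sf pf sg pg].
- by rewrite pd_cst; exact: smd_cst.
- rewrite pd_coord//; apply: smd_mul; first exact: smd_cst.
  by apply: smd_coord; exact: sm_derive1.
- by rewrite pd_add//; exact: smd_add.
- rewrite pd_mul; [|by move=> x; exact: smd_derivable..].
  by apply: smd_add; exact: smd_mul.
Qed.

Lemma smd_iter_partial s f : smd f -> smd (iter_partial s f).
Proof. by move=> sf; elim: s => //= l s IH; exact: smd_pd. Qed.

Lemma smd_smooth f : smd f -> smooth f.
Proof. by move=> sf s x; apply: smd_differentiable; exact: smd_iter_partial. Qed.

(** By induction on the structure: for a function of one coordinate both orders give the same
    multiple of its second derivative, and sums and products inherit the symmetry. *)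
Lemma pd_comm l k f : smd f -> pd l (pd k f) = pd k (pd l f).
Proof.
have D g j x : smd g -> derivable g x (E j) by move=> ?; exact: smd_derivable.
elim=> {f}[c|f j sf|f g sf pf sg pg|f g sf pf sg pg].
- by rewrite !pd_cst.
- have sd := sm_derive1 sf.
  rewrite !pd_coord// (smd_pd_mul l (smd_cst _) (smd_coord _ sd)) (smd_pd_mul k (smd_cst _) (smd_coord _ sd)).
  rewrite !pd_cst !pd_coord//; apply/funext => x; rewrite !mulr0 !addr0.
  by rewrite mulrCA.
- rewrite (pd_add k sf sg) (pd_add l sf sg) pd_add; [|exact: smd_pd..].
  by rewrite pd_add; [rewrite pf pg|exact: smd_pd..].
- rewrite (smd_pd_mul k sf sg) (smd_pd_mul l sf sg).
  rewrite (pd_add l (smd_mul sf (smd_pd k sg)) (smd_mul sg (smd_pd k sf))).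
  rewrite (pd_add k (smd_mul sf (smd_pd l sg)) (smd_mul sg (smd_pd l sf))).
  rewrite (smd_pd_mul l sf (smd_pd k sg)) (smd_pd_mul l sg (smd_pd k sf)).
  rewrite (smd_pd_mul k sf (smd_pd l sg)) (smd_pd_mul k sg (smd_pd l sf)).
  rewrite pf pg; apply/funext => x.
  move: (pd k (pd l f) x) (pd k (pd l g) x) (pd k f x) (pd k g x) (pd l f x) (pd l g x) (f x) (g x).
  by move=> *; ring.
Qed.

Lemma iter_partial_rcons s l f : iter_partial (rcons s l) f = iter_partial s (pd l f).
Proof. by rewrite /iter_partial foldr_rcons. Qed.

Lemma iter_partial_comm s l f : smd f -> iter_partial s (pd l f) = pd l (iter_partial s f).
Proof.
move=> sf; elim: s => //= k s ->; apply: pd_comm; exact: smd_iter_partial.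
Qed.

Lemma iter_partial_add s f g : smd f -> smd g ->
  iter_partial s (fun x => f x + g x) = fun x => iter_partial s f x + iter_partial s g x.
Proof.
by move=> sf sg; elim: s => //= l s ->; rewrite -/(pd l _) pd_add//; exact: smd_iter_partial.
Qed.

Lemma iter_partial_scale s c f : smd f ->
  iter_partial s (fun x => c * f x) = fun x => c * iter_partial s f x.
Proof.
move=> sf; elim: s => //= l s ->; rewrite -/(pd l _) pd_mul; last 2 first.
- by move=> x; apply: smd_derivable; exact: smd_cst.
- by move=> x; apply: smd_derivable; exact: smd_iter_partial.
by rewrite pd_cst; apply/funext => x; rewrite mulr0 addr0.
Qed.

Lemma smd_sum I (r : seq I) (p : pred I) (F : I -> 'rV[R]_d -> R) :
  (forall i, p i -> smd (F i)) -> smd (fun x => \sum_(i <- r | p i) F i x).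
Proof.
move=> sF; rewrite (_ : (fun _ => _) = \big[(fun f g x => f x + g x)/(fun=> 0)]_(i <- r | p i) F i).
  by elim/big_ind : _ => //; [exact: smd_cst|exact: smd_add].
by apply/funext => x; elim/big_rec2 : _ => // i f y pi ->.
Qed.

Lemma smd_prod I (r : seq I) (F : I -> 'rV[R]_d -> R) :
  (forall i, smd (F i)) -> smd (fun x => \prod_(i <- r) F i x).
Proof.
move=> sF; rewrite (_ : (fun _ => _) = \big[(fun f g x => f x * g x)/(fun=> 1)]_(i <- r) F i).
  by elim/big_ind : _ => //; [exact: smd_cst|exact: smd_mul].
by apply/funext => x; elim/big_rec2 : _ => // i f y pi ->.
Qed.

Lemma iter_partial_sum s I (r : seq I) (p : pred I) (F : I -> 'rV[R]_d -> R) :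
  (forall i, smd (F i)) ->
  iter_partial s (fun x => \sum_(i <- r | p i) F i x) =
  fun x => \sum_(i <- r | p i) iter_partial s (F i) x.
Proof.
move=> sF; elim: r => [|i r IH].
  under eq_fun do rewrite big_nil; under [in RHS]eq_fun do rewrite big_nil.
  by elim: s => //= l s ->; exact: pd_cst.
under eq_fun do rewrite big_cons; under [in RHS]eq_fun do rewrite big_cons.
case: (p i) => //; rewrite iter_partial_add//; last exact: smd_sum.
by rewrite IH.
Qed.

(** All ways of distributing the derivatives of a list over two factors: Leibniz' rule, with
    repetitions in place of binomial coefficients. *)
Fixpoint splits (s : seq 'I_d) : seq (seq 'I_d * seq 'I_d) :=
  if s is l :: s' then
    [seq (l :: p.1, p.2) | p <- splits s'] ++ [seq (p.1, l :: p.2) | p <- splits s']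
  else [:: ([::], [::])].

Lemma iter_partial_mul s f g : smd f -> smd g ->
  iter_partial s (fun x => f x * g x) =
  fun x => \sum_(p <- splits s) iter_partial p.1 f x * iter_partial p.2 g x.
Proof.
move=> sf sg; elim: s => [|l s /= ->]; first by apply/funext => x; rewrite big_seq1.
have := @iter_partial_sum [:: l] _ (splits s) xpredT (fun p x => iter_partial p.1 f x * iter_partial p.2 g x).
rewrite /= => ->; last first.
  by move=> p; apply: smd_mul; exact: smd_iter_partial.
apply/funext => x; rewrite big_cat !big_map/= addrC -big_split/=; apply: eq_bigr => p _.
apply: (etrans (congr1 (fun h => h x)
  (smd_pd_mul l (smd_iter_partial p.1 sf) (smd_iter_partial p.2 sg)))).
by congr (_ + _); rewrite mulrC.
Qed.

Lemma splits_size s p : p \in splits s -> (size p.1 + size p.2 = size s)%N.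
Proof.
elim: s p => [|l s IH] p /=; first by rewrite inE => /eqP ->.
by rewrite mem_cat => /orP[] /mapP[q /IH <- ->] /=; rewrite ?addnS.
Qed.

Lemma size_splits s : size (splits s) = (2 ^ size s)%N.
Proof. by elim: s => //= l s IH; rewrite size_cat !size_map IH expnS mul2n addnn. Qed.

(** Derivatives are local. This lets a truncated trial function be replaced by the smooth one on an
    element, and a function on a box by its local representation. *)
Lemma near_iter_partial s f g x : (\near x, f x = g x) ->
  iter_partial s f x = iter_partial s g x.
Proof.
elim: s x => [|l s IH] x fg /=; first exact: nbhs_singleton fg.
apply: near_eq_derive.
by have := near_join fg; apply: filterS => y; exact: IH.
Qed.

End smooth_rV.

(** * Integrals of partial derivatives of functions with bounded support *)

Section integration_by_parts.
Variable R : realType.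
Local Notation leb := (@lebesgue_measure R).
Local Notation mu n := (lebesgue_rV R n).
Local Notation E := (@delta_mx R 1 _ ord0).

Lemma compact_bounded_rV d (K : set 'rV[R]_d) : compact K ->
  exists2 M : R, 0 < M & forall x, K x -> forall l, `|x ord0 l| <= M.
Proof.
move=> /compact_bounded[M [_ HM]]; exists (`|M| + 1); first by rewrite ltr_wpDl.
move=> x Kx l; have /= := HM (`|M| + 1) _ x Kx.
rewrite ltr_pwDr// ?ler_norm// => /(_ isT); apply: le_trans.
rewrite /Num.norm/= mx_normE.
exact: (le_bigmax _ (fun i : 'I_1 * 'I_d => `|x i.1 i.2|%:nng) (ord0, l)).
Qed.

Definition cube d (M : R) : set 'rV[R]_d := prod_set (fun=> `[- M, M]%classic).

Lemma cubeE d M (x : 'rV[R]_d) : cube M x <-> forall l, `|x ord0 l| <= M.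
Proof. by split => xM l; have := xM l; rewrite /= in_itv/= ler_norml. Qed.

Lemma compact_cube d M : compact (@cube d M).
Proof. by apply: rV_compact => l; exact: segment_compact. Qed.

Lemma measurable_cube d M : measurable (@cube d M).
Proof. exact: measurable_prod_set. Qed.

Lemma lebesgue_cube_lty d M : (mu d (@cube d M) < +oo)%E.
Proof.
rewrite lebesgue_prod_set// ltey_eq; apply/orP; left; elim/big_ind : _ => //.
  by move=> a b; exact: fin_numM.
by move=> l _; rewrite lebesgue_measure_itv/=; case: ifP.
Qed.

Lemma continuous_bounded_compact d (K : set 'rV[R]_d) (f : 'rV[R]_d -> R) :
  compact K -> continuous f -> exists2 B : R, 0 < B & forall x, K x -> `|f x| <= B.
Proof.
move=> cK cf; have /compact_bounded[B [_ HB]] : compact (f @` K).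
  by apply: continuous_compact => //; exact: continuous_subspaceT.
exists (`|B| + 1); first by rewrite ltr_wpDl.
move=> x Kx; apply: (HB (`|B| + 1)); last by exists x.
by rewrite ltr_pwDr// ler_norm.
Qed.

(** Bounded support, phrased by coordinates so that it passes to slices and to partial
    derivatives. *)
Definition vanishes_off d (M : R) (f : 'rV[R]_d -> R) :=
  forall (x : 'rV[R]_d) l, M < `|x ord0 l| -> f x = 0.

Lemma integrable_bounded_support d M (f : 'rV[R]_d -> R) : continuous f ->
  vanishes_off M f -> (mu d).-integrable setT (EFin \o f).
Proof.
move=> cf f0; have -> : EFin \o f = (EFin \o f) \_ (cube M).
  apply/funext => x; rewrite patchE; case: ifPn => //; rewrite notin_setE => /cubeE.
  by move=> /existsNP[l /negP]; rewrite -ltNge => /f0 /= ->.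
apply/(@integrable_mkcond _ _ _ (mu d) (cube M)); first exact: measurable_cube.
apply: measurable_bounded_integrable.
- exact: measurable_cube.
- exact: lebesgue_cube_lty.
- exact: continuous_measurable_rV.
- have [B B0 HB] := continuous_bounded_compact (@compact_cube d M) cf.
  exists B; split; first exact: num_real.
  by move=> y By x Mx /=; rewrite (le_trans (HB _ Mx))// ltW.
Qed.

Lemma integral_derive1_eq0 (f : R -> R) (M : R) : (forall x, derivable f x 1) ->
  continuous (derive1 f) -> (forall x, M < `|x| -> f x = 0) ->
  (\int[leb]_x (derive1 f x)%:E = 0)%E.
Proof.
(* [N] is strictly larger than [M], so [f] vanishes at both ends of [-N, N] and near every point
   beyond. *)
move=> df cf f0; pose N : R := `|M| + 1.
have MN : M < N by rewrite ltr_pwDr// ler_norm.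
have N0 : 0 < N by rewrite ltr_wpDl.
have fN x : N <= `|x| -> f x = 0 by move=> Nx; apply: f0; exact: lt_le_trans Nx.
have f'N x : N < `|x| -> derive1 f x = 0.
  move=> Nx; rewrite derive1E -[RHS](derive_cst 0 x 1); apply: near_eq_derive.
  have : \forall y \near x, N < `|y|.
    have /cvgr_gt : `|y| @[y --> x] --> `|x| by exact: norm_continuous.
    exact.
  by apply: filterS => y Ny; rewrite fN ?ltW.
transitivity (\int[leb]_(x in `[(- N)%R, N]) (derive1 f x)%:E)%E.
  rewrite [RHS]integral_mkcond; apply: eq_integral => x _; rewrite patchE.
  case: ifPn => //; rewrite notin_setE/= in_itv/= -ler_norml => /negP; rewrite -ltNge => Nx.
  by rewrite f'N.
have contf x : {for x, continuous f}.
  by apply: differentiable_continuous; apply/derivable1_diffP.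
rewrite (@continuous_FTC2 _ (derive1 f) f); last first.
- by [].
- split => [x _||]; first exact: df.
  + by apply: cvg_at_right_filter; exact: contf.
  + by apply: cvg_at_left_filter; exact: contf.
- by apply: continuous_subspaceT.
- by rewrite gtrN.
by rewrite !fN ?subee// ?normrN ger0_norm// ltW.
Qed.

Lemma continuous_cons_rV_l n (t : R) : continuous (fun x : 'rV[R]_n => cons_rV (x, t)).
Proof.
move=> x; have FF : Filter (nbhs x) by exact: nbhs_filter.
apply/(@cvg_ballP _ _ _ (nbhs x)) => e e0.
apply: (@filterS _ (nbhs x) FF _ _ _ (nbhsx_ballx x e e0)) => y xy; split => // i l.
rewrite (ord1 i) -[X in ball (X : R)]/(cons_rV (x, t) ord0 l) -[X in ball _ _ X]/(cons_rV (y, t) ord0 l).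
case: (unliftP ord0 l) => [j|] ->; rewrite ?cons_rV_lift ?cons_rV0; last exact: ballxx.
by have [_] := xy; apply.
Qed.

Lemma continuous_cons_rV_r n (x : 'rV[R]_n) : continuous (fun t : R => cons_rV (x, t)).
Proof.
move=> t; apply/cvg_ballP => e e0; apply: filterS (nbhsx_ballx t e e0) => y ty; split => // i l.
rewrite (ord1 i) -[X in ball (X : R)]/(cons_rV (x, t) ord0 l) -[X in ball _ _ X]/(cons_rV (x, y) ord0 l).
case: (unliftP ord0 l) => [j|] ->; rewrite ?cons_rV_lift ?cons_rV0; first exact: ballxx.
exact: ty.
Qed.

Lemma pd_cons0 n (f : 'rV[R]_n.+1 -> R) x t :
  derive1 (fun t => f (cons_rV (x, t))) t = pd ord0 f (cons_rV (x, t)).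
Proof.
rewrite derive1E /pd /derive.
suff -> : (fun h : R => h^-1 *: (((fun t : R => f (cons_rV (x, t))) \o shift t) (h *: (1:R)) - f (cons_rV (x, t)))) =
  (fun h => h^-1 *: ((f \o shift (cons_rV (x, t))) (h *: E ord0) - f (cons_rV (x, t)))) by [].
apply/funext => h /=; congr (_ *: (f _ - _)); apply/rowP => l; rewrite [in RHS]mxE [in RHS]mxE.
by case: (unliftP ord0 l) => [j|] ->; rewrite ?cons_rV_lift ?cons_rV0 mxE ?eqxx//= ?mulr0 ?add0r.
Qed.

Lemma derivable_cons0 n (f : 'rV[R]_n.+1 -> R) x t :
  derivable f (cons_rV (x, t)) (E ord0) -> derivable (fun t => f (cons_rV (x, t))) t (1:R).
Proof.
rewrite /derivable.
suff -> : (fun h : R => h^-1 *: (((fun t : R => f (cons_rV (x, t))) \o shift t) (h *: (1:R)) - f (cons_rV (x, t)))) =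
  (fun h => h^-1 *: ((f \o shift (cons_rV (x, t))) (h *: E ord0) - f (cons_rV (x, t)))) by [].
apply/funext => h /=; congr (_ *: (f _ - _)); apply/rowP => l; rewrite [in RHS]mxE [in RHS]mxE.
by case: (unliftP ord0 l) => [j|] ->; rewrite ?cons_rV_lift ?cons_rV0 mxE ?eqxx//= ?mulr0 ?add0r.
Qed.

Lemma shift_cons_rV n j (h t : R) (x : 'rV[R]_n) :
  cons_rV (h *: E j + x, t) = h *: E (lift ord0 j) + cons_rV (x, t).
Proof.
apply/rowP => l; rewrite [in RHS]mxE [in RHS]mxE.
case: (unliftP ord0 l) => [k|] ->; rewrite ?cons_rV_lift ?cons_rV0 !mxE ?eqxx//=.
by rewrite mulr0 add0r.
Qed.

Lemma pd_cons_lift n (f : 'rV[R]_n.+1 -> R) j x t :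
  pd j (fun x => f (cons_rV (x, t))) x = pd (lift ord0 j) f (cons_rV (x, t)).
Proof.
rewrite /pd /derive.
suff -> : (fun h : R => h^-1 *: (((fun x => f (cons_rV (x, t))) \o shift x) (h *: E j) - f (cons_rV (x, t)))) =
  (fun h => h^-1 *: ((f \o shift (cons_rV (x, t))) (h *: E (lift ord0 j)) - f (cons_rV (x, t)))) by [].
by apply/funext => h /=; rewrite shift_cons_rV.
Qed.

Lemma derivable_cons_lift n (f : 'rV[R]_n.+1 -> R) j x t :
  derivable f (cons_rV (x, t)) (E (lift ord0 j)) -> derivable (fun x => f (cons_rV (x, t))) x (E j).
Proof.
rewrite /derivable.
suff -> : (fun h : R => h^-1 *: (((fun x => f (cons_rV (x, t))) \o shift x) (h *: E j) - f (cons_rV (x, t)))) =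
  (fun h => h^-1 *: ((f \o shift (cons_rV (x, t))) (h *: E (lift ord0 j)) - f (cons_rV (x, t)))) by [].
by apply/funext => h /=; rewrite shift_cons_rV.
Qed.

Lemma pd_vanishes_off d (l : 'I_d) M (f : 'rV[R]_d -> R) : vanishes_off M f -> vanishes_off M (pd l f).
Proof.
move=> f0 x k Mx; rewrite /pd -[RHS](derive_cst 0 x (E l)); apply: near_eq_derive.
have : \forall y \near x, M < `|(y : 'rV[R]_d) ord0 k|.
  have : `|(y : 'rV[R]_d) ord0 k| @[y --> x] --> `|x ord0 k|.
    exact: (cvg_norm (@coord_continuous R 1 d ord0 k x)).
  by move=> /cvgr_gt; exact.
by apply: filterS => y; exact: f0.
Qed.

(** Induction on the dimension. A derivative in the first coordinate is integrated along that
    coordinate first; any other one is handled on the slices with the first coordinate fixed. *)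
Lemma integral_pd_eq0 d l (f : 'rV[R]_d -> R) M : (forall x, derivable f x (E l)) ->
  continuous (pd l f) -> vanishes_off M f -> (\int[mu d]_x (pd l f x)%:E = 0)%E.
Proof.
elim: d l f => [[]//|n IH] l f df cf f0.
have fi := integrable_bounded_support cf (pd_vanishes_off l f0).
case: (unliftP ord0 l) => [j|] lE; subst l.
- rewrite (fubini_rV_swap fi) integral0_eq// => t _.
  under eq_integral do rewrite /= -pd_cons_lift.
  apply: IH.
  + by move=> x; exact: derivable_cons_lift.
  + rewrite (_ : pd j _ = pd (lift ord0 j) f \o (fun x => cons_rV (x, t))).
      by move=> x; apply: continuous_comp; [exact: continuous_cons_rV_l|exact: cf].
    by apply/funext => x; exact: pd_cons_lift.
  + by move=> x k Mx; apply: (f0 _ (lift ord0 k)); rewrite cons_rV_lift.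
- rewrite (fubini_rV fi) integral0_eq// => x _.
  under eq_integral do rewrite /= -pd_cons0.
  apply: (@integral_derive1_eq0 _ M).
  + by move=> t; exact: derivable_cons0.
  + rewrite (_ : derive1 _ = pd ord0 f \o (fun t => cons_rV (x, t))).
      by move=> t; apply: continuous_comp; [exact: continuous_cons_rV_r|exact: cf].
    by apply/funext => t; exact: pd_cons0.
  + by move=> t Mt; apply: (f0 _ ord0); rewrite cons_rV0.
Qed.

End integration_by_parts.

(** * Weak derivatives *)

Section weak_derivatives.
Variables (R : realType) (d : nat).
Local Notation mu := (lebesgue_rV R d).
Implicit Types (f g : 'rV[R]_d -> R) (D K : set 'rV[R]_d).

Lemma hausdorff_rV : hausdorff_space 'rV[R]_d.
Proof. exact: norm_hausdorff. Qed.

Lemma compact_closed_rV K : compact K -> closed K.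
Proof. by apply: compact_closed; exact: hausdorff_rV. Qed.

Lemma closed_measurable_rV K : closed K -> measurable K.
Proof. by move=> cK; rewrite -[K]setCK; apply: measurableC; apply: open_measurable_rV; exact: closed_openC. Qed.

Lemma compact_measurable_rV K : compact K -> measurable K.
Proof. by move=> /compact_closed_rV; exact: closed_measurable_rV. Qed.

Lemma bounded_lebesgue_lty (A : set 'rV[R]_d) M : measurable A ->
  (forall x, A x -> forall l, `|x ord0 l| <= M) -> (mu A < +oo)%E.
Proof.
move=> mA AM; apply: le_lt_trans (lebesgue_cube_lty d M).
apply: le_measure; rewrite ?inE//; first exact: measurable_cube.
by move=> x Ax; apply/cubeE => l; exact: AM.
Qed.

Lemma compact_lebesgue_lty K : compact K -> (mu K < +oo)%E.
Proof.
move=> cK; have [M _ KM] := compact_bounded_rV cK.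
by apply: (@bounded_lebesgue_lty _ M) => //; exact: compact_measurable_rV.
Qed.

Lemma iter_partial0 s : iter_partial s (fun=> 0) = (fun=> 0) :> ('rV[R]_d -> R).
Proof. by elim: s => //= l s ->; exact: (pd_cst l 0). Qed.

Lemma iter_partial_off K s f : closed K -> (forall x, ~ K x -> f x = 0) ->
  forall x, ~ K x -> iter_partial s f x = 0.
Proof.
move=> cK f0 x Kx; rewrite -[RHS](congr1 (@^~ x) (iter_partial0 s)).
apply: near_iter_partial; have oK : open (~` K) by exact: closed_openC.
have : nbhs x (~` K) by apply: open_nbhs_nbhs; split.
by apply: filterS => y; exact: f0.
Qed.

Lemma compact_vanishes K f : compact K -> (forall x, ~ K x -> f x = 0) ->
  exists M, vanishes_off M f.
Proof.
move=> cK f0; have [M _ KM] := compact_bounded_rV cK; exists M => x l Mx.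
by apply: f0 => Kx; have := KM x Kx l; rewrite leNgt Mx.
Qed.

Lemma smooth_iter_partial s f : smooth f -> smooth (iter_partial s f).
Proof. by move=> sf t x; rewrite /iter_partial -foldr_cat; exact: sf. Qed.

Lemma smooth_continuous f : smooth f -> continuous f.
Proof. by move=> sf x; apply: differentiable_continuous; exact: (sf [::]). Qed.

Lemma smooth_derivable f x v : smooth f -> derivable f x v.
Proof. by move=> sf; apply: diff_derivable; exact: (sf [::]). Qed.

(** The factors are treated differently: [f] is a concrete function such as a trial function, while
    [g] is an arbitrary test function, of which only [smooth] is known. *)
Lemma ibp_pd f g l M : smd f -> smooth g -> vanishes_off M g ->
  \int[mu]_x (f x * pd l g x) = - \int[mu]_x (pd l f x * g x).
Proof.
move=> sf sg g0.
have cf := smd_continuous sf; have cg := smooth_continuous sg.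
have sdg : smooth (pd l g) by exact: (@smooth_iter_partial [:: l]).
have cdf := smd_continuous (smd_pd l sf); have cdg := smooth_continuous sdg.
have mulc (a b : 'rV[R]_d -> R) : continuous a -> continuous b -> continuous (fun x => a x * b x).
  by move=> ca cb x; apply: continuousM; [exact: ca|exact: cb].
have addc (a b : 'rV[R]_d -> R) : continuous a -> continuous b -> continuous (fun x => a x + b x).
  by move=> ca cb x; apply: continuousD; [exact: ca|exact: cb].
have i1 : mu.-integrable setT (EFin \o (fun x => f x * pd l g x)).
  apply: (@integrable_bounded_support _ _ M); first exact: mulc.
  by move=> x k Mx; rewrite (pd_vanishes_off l g0 Mx) mulr0.
have i2 : mu.-integrable setT (EFin \o (fun x => g x * pd l f x)).
  apply: (@integrable_bounded_support _ _ M); first exact: mulc.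
  by move=> x k Mx; rewrite (g0 x k Mx) mul0r.
have pE : pd l (fun x => f x * g x) = fun x => f x * pd l g x + g x * pd l f x.
  by apply: pd_mul => x; [exact: smd_derivable|exact: smooth_derivable].
have : (\int[mu]_x (pd l (fun x => f x * g x) x)%:E = 0)%E.
  apply: (@integral_pd_eq0 _ _ _ _ M).
  - by move=> x; apply: derivableM; [exact: smd_derivable|exact: smooth_derivable].
  - by rewrite pE => x; exact: (addc _ _ (mulc _ _ cf cdg) (mulc _ _ cg cdf)).
  - by move=> x k Mx; rewrite (g0 x k Mx) mulr0.
rewrite pE => /(congr1 fine) /=.
rewrite -[LHS]/(\int[mu]_x (f x * pd l g x + g x * pd l f x)) RintegralD//.
move=> /eqP; rewrite addr_eq0 => /eqP ->; congr (- _).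
by apply: eq_Rintegral => x _; rewrite mulrC.
Qed.

Lemma ibp_iter_partial s f g M : smd f -> smooth g -> vanishes_off M g ->
  \int[mu]_x (f x * iter_partial s g x) =
  (-1) ^+ size s * \int[mu]_x (iter_partial s f x * g x).
Proof.
elim: s f => [|l s IH] f sf sg g0; first by rewrite expr0 mul1r.
have g0s : vanishes_off M (iter_partial s g).
  elim: s {IH} => //= k s; exact: pd_vanishes_off.
rewrite [LHS](ibp_pd l sf (@smooth_iter_partial s _ sg) g0s) IH//; last exact: smd_pd.
rewrite exprS -mulrA mulN1r; congr (- (_ * _)); apply: eq_Rintegral => x _.
by rewrite iter_partial_comm.
Qed.

Lemma size_mindex_seq k (a : mindex d k) :
  size (flatten [seq nseq (a l) l | l <- enum 'I_d]) = mdeg a.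
Proof.
rewrite size_flatten /shape -map_comp sumnE big_map big_enum/=.
by apply: eq_bigr => l _; rewrite /= size_nseq.
Qed.

Lemma continuous_loc_integrable D f : continuous f -> loc_integrable D f.
Proof.
move=> cf; split; first exact: continuous_measurable_rV.
move=> K cK _; apply: measurable_bounded_integrable.
- exact: compact_measurable_rV.
- exact: compact_lebesgue_lty.
- exact: continuous_measurable_rV.
- have [B B0 HB] := continuous_bounded_compact cK cf.
  exists B; split; first exact: num_real.
  by move=> y By x Mx /=; rewrite (le_trans (HB _ Mx))// ltW.
Qed.

Lemma Rintegral_off D K f : K `<=` D -> (forall x, ~ K x -> f x = 0) ->
  \int[mu]_(x in D) f x = \int[mu]_(x in K) f x.
Proof.
move=> KD f0; rewrite Rintegral_mkcond [RHS]Rintegral_mkcond; apply: eq_Rintegral => x _.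
rewrite !patchE; case: ifPn => xD; case: ifPn => xK //.
  by rewrite f0// => /mem_set; apply/negP.
by move: xD; rewrite (mem_set (KD _ (set_mem xK))).
Qed.

(** The test function vanishes off a compact subset of [D], so both integrals may be taken over the
    whole space, where integration by parts has no boundary term. *)
Lemma weak_derivative_smd D k (a : mindex d k) f : smd f ->
  weak_derivative D a f (partial a f).
Proof.
move=> sf; split.
- by apply: continuous_loc_integrable; exact: smd_continuous.
- by apply: continuous_loc_integrable; apply: smd_continuous; exact: smd_iter_partial.
move=> g [sg [K [cK KD g0]]]; have [M gM] := compact_vanishes cK g0.
have clK := compact_closed_rV cK.
rewrite (Rintegral_off KD); last by move=> x Kx; rewrite [partial _ _ _](iter_partial_off _ clK g0 Kx) mulr0.
rewrite (@Rintegral_off D K (fun x => partial a f x * g x) KD); last first.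
  by move=> x Kx; rewrite g0 ?mulr0.
rewrite -(@Rintegral_off setT K (fun x => f x * partial a g x))//; last first.
  by move=> x Kx; rewrite [partial _ _ _](iter_partial_off _ clK g0 Kx) mulr0.
rewrite -(@Rintegral_off setT K (fun x => partial a f x * g x))//; last first.
  by move=> x Kx; rewrite g0 ?mulr0.
by rewrite (ibp_iter_partial _ sf sg gM) size_mindex_seq.
Qed.

Lemma loc_integrableD D f g c : loc_integrable D f -> loc_integrable D g ->
  loc_integrable D (fun x => f x + c * g x).
Proof.
move=> [mf fi] [mg gi]; split.
  apply: measurable_funD => //; apply: measurable_funM => //.
move=> K cK KD; rewrite (_ : _ \o _ = (fun x => (EFin \o f) x + c%:E * (EFin \o g) x)%E)//.
have mK := compact_measurable_rV cK.
by apply: integrableD => //; [exact: fi|apply: integrableZl => //; exact: gi].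
Qed.

Lemma loc_integrableS D K f : measurable K -> K `<=` D -> loc_integrable D f -> measurable D -> loc_integrable K f.
Proof.
move=> mK KD [mf fi] mD; split; first exact: measurable_funS mf.
by move=> L cL LK; apply: fi => //; exact: subset_trans KD.
Qed.

(** Smooth approximations from below of the indicator of ]a, b[: zero outside, and tending to 1 at
    every point inside as n grows. *)
Definition bump_seq (a b : R) (n : nat) (t : R) : R :=
  1 - expR (- n%:R * (flat 0 (t - a) * flat 0 (b - t))).

Lemma flat0_ge0 (t : R) : 0 <= flat 0 t.
Proof. by rewrite /flat; case: ifP => // _; rewrite expr0 invr1 mul1r expR_ge0. Qed.

Lemma sm_bump_seq a b n : sm (bump_seq a b n).
Proof.
apply: sm_sub; first exact: sm_cst.
apply: (sm_comp (@sm_exp R)); apply: sm_mul; first exact: sm_cst.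
apply: sm_mul; apply: (sm_comp (@sm_flat R 0)); apply: sm_sub;
  by [exact: sm_cst|exact: sm_id].
Qed.

Lemma bump_seq01 a b n t : 0 <= bump_seq a b n t <= 1.
Proof.
rewrite subr_ge0 expR_le1 mulNr oppr_le0 mulr_ge0 ?mulr_ge0 ?flat0_ge0//=.
by rewrite lerBlDr lerDl expR_ge0.
Qed.

Lemma bump_seq_off a b n t : ~ (a < t < b) -> bump_seq a b n t = 0.
Proof.
move=> abt; rewrite /bump_seq (_ : _ * flat 0 (b - t) = 0) ?mulr0 ?expR0 ?subrr//.
rewrite /flat; have [ta|at_] := leP t a; first by rewrite ifF ?mul0r//; apply/negbTE; rewrite -leNgt subr_le0.
rewrite [X in _ * X]ifF ?mulr0//; apply/negbTE; rewrite -leNgt subr_le0 leNgt.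
by apply/negP => tb; apply: abt; rewrite at_.
Qed.

Lemma cvg_bump_seq a b t : a < t < b -> bump_seq a b n t @[n --> \oo] --> (1 : R).
Proof.
move=> /andP[at_ tb]; rewrite -[X in _ --> X]subr0; apply: cvgB; first exact: cvg_cst.
set c := _ * _; have c0 : 0 < c.
  by rewrite /c /flat !subr_gt0 at_ tb !expr0 !invr1 !mul1r mulr_gt0 ?expR_gt0.
rewrite (_ : (fun n => _) = (fun n => (expR (- c)) ^+ n)).
  by apply: cvg_expr; rewrite ger0_norm ?expR_ge0// expR_lt1 oppr_lt0.
by apply/funext => n; rewrite -expRM_natl mulrN mulNr.
Qed.

Definition obox (a b : 'I_d -> R) : set 'rV[R]_d := prod_set (fun l => `]a l, b l[%classic).
Definition cbox (a b : 'I_d -> R) : set 'rV[R]_d := prod_set (fun l => `[a l, b l]%classic).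

Lemma obox_cbox a b : obox a b `<=` cbox a b.
Proof. by move=> x xab l; have := xab l; rewrite /= !in_itv/= => /andP[/ltW -> /ltW ->]. Qed.

Lemma measurable_obox a b : measurable (obox a b).
Proof. exact: measurable_prod_set. Qed.

Lemma compact_cbox a b : compact (cbox a b).
Proof. by apply: rV_compact => l; exact: segment_compact. Qed.

Lemma measurable_cbox a b : measurable (cbox a b).
Proof. exact: measurable_prod_set. Qed.

Definition bump_rV a b n (x : 'rV[R]_d) : R := \prod_l bump_seq (a l) (b l) n (x ord0 l).

Lemma bump_rV_off a b n x : ~ obox a b x -> bump_rV a b n x = 0.
Proof.
move=> /existsNP[l xl]; rewrite /bump_rV (bigD1 l)//= bump_seq_off ?mul0r//.
Qed.

Lemma smd_bump_rV a b n : smd (bump_rV a b n).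
Proof. by apply: smd_prod => l; apply: smd_coord; exact: sm_bump_seq. Qed.

Lemma bump_rV01 a b n x : 0 <= bump_rV a b n x <= 1.
Proof.
have H l := bump_seq01 (a l) (b l) n (x ord0 l).
apply/andP; split; first by apply: prodr_ge0 => l _; have /andP[] := H l.
by apply: prodr_ile1 => l _; exact: H.
Qed.

Lemma cvg_bump_rV a b x : obox a b x -> bump_rV a b n x @[n --> \oo] --> (1 : R).
Proof.
move=> xab; rewrite (_ : 1 = \prod_(l < d) (1 : R)); last by rewrite big1_eq.
rewrite /bump_rV; elim: (index_enum _) => [|l r IH].
  by under eq_fun do rewrite big_nil; rewrite big_nil; exact: cvg_cst.
under eq_fun do rewrite big_cons; rewrite big_cons; apply: cvgM => //.
by apply: cvg_bump_seq; have := xab l; rewrite /= in_itv.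
Qed.

(** The cutoffs [bump_rV a b n] are test functions of [D], being supported in the compact box
    [cbox a b]. They converge to the indicator of the open box, and |h| dominates the products. *)
Lemma integral_obox_eq0 D h a b : loc_integrable D h ->
  (forall psi, test_function D psi -> \int[mu]_(x in D) (h x * psi x) = 0) ->
  cbox a b `<=` D -> (\int[mu]_(x in obox a b) (h x)%:E = 0)%E.
Proof.
move=> [mh hi] h0 abD; have mB := measurable_cbox a b.
have ih : mu.-integrable (cbox a b) (EFin \o h) by apply: hi => //; exact: compact_cbox.
have mhB := measurable_int _ ih.
pose F n (x : 'rV[R]_d) := (h x * bump_rV a b n x)%:E.
have Fi n : mu.-integrable (cbox a b) (F n).
  apply: (le_integrable mB _ _ ih).
  - apply/measurable_EFinP; apply: measurable_funM; first exact/measurable_EFinP.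
    by apply: continuous_measurable_rV; apply: smd_continuous; exact: smd_bump_rV.
  - move=> x _; rewrite /= lee_fin normrM ler_piMr//; have /andP[p0 p1] := bump_rV01 a b n x.
    by rewrite ger0_norm.
have F0 n : (\int[mu]_(x in cbox a b) F n x = 0)%E.
  have : test_function D (bump_rV a b n).
    split; first exact/smd_smooth/smd_bump_rV.
    exists (cbox a b); split => //; first exact: compact_cbox.
    by move=> x xab; apply: bump_rV_off => /obox_cbox.
  move=> /h0; rewrite (Rintegral_off abD); last first.
    by move=> x xab; rewrite bump_rV_off ?mulr0// => /obox_cbox.
  rewrite /Rintegral => H; rewrite -[LHS]fineK ?H//.
  exact: integrable_fin_num.
have [|||||_ _] := @dominated_convergence _ _ _ mu _ mB F
    (fun x => (h x * \1_(obox a b) x)%:E) (fun x => `|(h x)%:E|%E).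
- by move=> n; exact: (measurable_int _ (Fi n)).
- apply/measurable_EFinP; apply: measurable_funM; first exact/measurable_EFinP.
  by apply: measurable_indic; exact: measurable_obox.
- apply: aeW => x _; apply: cvg_EFin; first exact: nearW.
  apply: cvgM; first exact: cvg_cst.
  have [xab|xab] := pselect (obox a b x); rewrite indicE.
    by rewrite mem_set//; exact: cvg_bump_rV.
  rewrite memNset//; apply: cvg_near_cst; apply: nearW => n /=.
  by rewrite bump_rV_off.
- exact: integrable_abse ih.
- apply: aeW => x n _; rewrite /F /= lee_fin normrM ler_piMr//.
  by have /andP[p0 p1] := bump_rV01 a b n x; rewrite ger0_norm.
rewrite (_ : [sequence _]_n = (fun=> 0%E)); last by apply/funext => n; exact: F0.
move=> /cvg_unique => /(_ _ _ (cvg_cst _)) H.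
transitivity (\int[mu]_(x in cbox a b) (h x * \1_(obox a b) x)%:E)%E; last by rewrite -H.
rewrite integral_mkcond [RHS]integral_mkcond; apply: eq_integral => x _.
rewrite !patchE indicE; case: (pselect (obox a b x)) => xab.
  by rewrite !mem_set ?mulr1//; exact: obox_cbox.
by rewrite !(memNset xab) mulr0; case: ifP.
Qed.

Definition obox_system : set_system 'rV[R]_d := [set A | exists a b, A = obox a b].

Lemma setI_obox a b a' b' : obox a b `&` obox a' b' =
  obox (fun l => Num.max (a l) (a' l)) (fun l => Num.min (b l) (b' l)).
Proof.
apply/seteqP; split => [x [xa xa'] l|x xab].
  by have := xa l; have := xa' l; rewrite /= !in_itv/= gt_max lt_min => /andP[-> ->] /andP[-> ->].
split => l; move: (xab l); rewrite /= !in_itv/= gt_max lt_min;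
  by move=> /andP[/andP[h1 h2] /andP[h3 h4]]; rewrite ?h1 ?h2 ?h3 ?h4.
Qed.

Lemma setI_closed_obox : setI_closed obox_system.
Proof. by move=> _ _ [a [b ->]] [a' [b' ->]]; rewrite setI_obox; do 2 eexists. Qed.

Lemma measurable_obox_system : @measurable _ 'rV[R]_d = <<s obox_system >>.
Proof.
apply/seteqP; split; last first.
  apply: smallest_sub; first exact: sigma_algebra_measurable.
  by move=> _ [a [b ->]]; exact: measurable_obox.
apply: smallest_sub; first exact: smallest_sigma_algebra.
move=> A; rewrite -bigcup_seq => -[l _] [C mC <-].
suff : measurable_fun (setT : set (g_sigma_algebraType obox_system))
    (fun x : 'rV[R]_d => x ord0 l) by move=> /(_ measurableT C mC).
apply: (measurability _ (RGenOpens.measurableE R)).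
move=> _ [_ [a [b ->] <-]]; rewrite setTI.
(* A strip in one coordinate is the union of boxes that are bounded by n in all other
   coordinates. *)
pose A' n := obox (fun k => if k == l then a else - n%:R) (fun k => if k == l then b else n%:R).
rewrite (_ : _ @^-1` _ = \bigcup_n A' n).
  apply: bigcupT_measurable => n; apply: sub_sigma_algebra.
  by eexists; eexists; reflexivity.
apply/seteqP; split => [x xab|x [n _] /(_ l)]; last by rewrite /= eqxx.
have [M _ xM] := @compact_bounded_rV _ _ [set x] (@compact_set1 _ x).
exists (Num.truncn M).+1 => // k; rewrite /= in_itv/=; case: eqVneq => [->|_].
  by move: xab; rewrite /= in_itv.
by rewrite -ltr_norml (le_lt_trans (xM x erefl k))// truncnS_gt.
Qed.

(** The sets [S] for which the integral of [h] over [S] within the box is zero form a Dynkin system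
    that contains the boxes, which are closed under intersection. So the integral is zero for every
    measurable [S], and [h] vanishes almost everywhere. *)
Lemma fundamental_obox D h a b : loc_integrable D h ->
  (forall psi, test_function D psi -> \int[mu]_(x in D) (h x * psi x) = 0) ->
  cbox a b `<=` D -> {ae mu, forall x, obox a b x -> h x = 0}.
Proof.
move=> lh h0 abD; have mU := measurable_obox a b.
have ih : mu.-integrable (obox a b) (EFin \o h).
  apply: (@integrableS _ _ _ mu (cbox a b)) => //; first exact: measurable_cbox.
    exact: obox_cbox.
  by apply: lh.2 => //; exact: compact_cbox.
have iS S : measurable S -> mu.-integrable (S `&` obox a b) (EFin \o h).
  by move=> mS; apply: integrableS ih => //; exact: measurableI.
pose P (S : set 'rV[R]_d) := (\int[mu]_(x in S `&` obox a b) (h x)%:E = 0)%E.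
have PS S : measurable S -> P S.
  rewrite measurable_obox_system; apply: (dynkin_induction measurable_obox_system setI_closed_obox).
  - by rewrite /P setTI; exact: integral_obox_eq0 abD.
  - move=> _ [a' [b' ->]]; rewrite /P.
    rewrite setI_obox; apply: integral_obox_eq0 lh h0 _.
    move=> x xc; apply: abD => l; have := xc l; rewrite /= !in_itv/= ge_max le_min;
      by move=> /andP[/andP[_ ->] /andP[_ ->]].
  - move=> S' mS PS; rewrite /P.
    have := @integral_obox_eq0 _ h a b lh h0 abD.
    rewrite -{1}(setTI (obox a b)) -(setvU S') setIUl integral_setU//.
    + by rewrite PS adde0.
    + by apply: measurableI => //; exact: measurableC.
    + exact: measurableI.
    + rewrite -setIUl setvU setTI; exact: (measurable_int _ ih).
    + by apply/disj_setPS => x [[Sx _] [Sx' _]].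
  - move=> F mF tF PF; rewrite /P setI_bigcupl integral_bigcup.
    + by rewrite eseries0// => i _ _; exact: PF.
    + by apply/trivIsetP => i j _ _ ij; move/trivIsetP : tF => /(_ i j I I ij) FF0;
        rewrite setIACA FF0 set0I.
    + by move=> k; exact: measurableI.
    + rewrite -setI_bigcupl; apply: iS; exact: bigcupT_measurable.
have := @integral_ae_eq _ _ _ mu _ mU (cst 0%E) (EFin \o h) ih (measurable_cst _).
case.
  move=> S SU mS; have := PS S mS; rewrite /P (_ : S `&` _ = S); last exact/setIidl.
  by move=> ->; rewrite integral0.
move=> N [mN N0 HN]; exists N; split => // x Nx; apply: HN => /= H; apply: Nx => Ux.
by have := H Ux => -[].
Qed.

(** Boxes with rational data: countably many of them exhaust an open set, so their exceptional null
    sets can be united. *)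
Definition rbox_lo (q : 'rV[rat]_d * nat) (l : 'I_d) : R := ratr (q.1 ord0 l) - q.2.+1%:R^-1.
Definition rbox_hi (q : 'rV[rat]_d * nat) (l : 'I_d) : R := ratr (q.1 ord0 l) + q.2.+1%:R^-1.

Lemma open_rbox D x : open D -> D x ->
  exists q, obox (rbox_lo q) (rbox_hi q) x /\ cbox (rbox_lo q) (rbox_hi q) `<=` D.
Proof.
move=> oD Dx.
have /nbhs_ballP[e /= e0 xeD] : nbhs x D by apply: open_nbhs_nbhs; split.
have [k ke] : exists k, k.+1%:R^-1 < e / 2.
  have /ltr_add_invr[k] : 0 < e / 2 by rewrite divr_gt0.
  by rewrite add0r => H; exists k.
have /choice[q qP] : forall l : 'I_d, exists q : rat, `|x ord0 l - ratr q| < k.+1%:R^-1.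
  move=> l; have /rat_in_itvoo[q] : x ord0 l - k.+1%:R^-1 < x ord0 l + k.+1%:R^-1.
    by rewrite ltrD2l; apply: (@lt_trans _ _ 0); rewrite ?oppr_lt0 invr_gt0.
  by rewrite in_itv/= => q1; exists q; rewrite ltr_distlC.
exists (\row_l q l, k); split.
  by move=> l; have := qP l; rewrite /rbox_lo /rbox_hi /= in_itv/= mxE ltr_distl.
move=> y yq; apply: xeD; split => // i l; have -> : i = ord0 by exact: ord1.
rewrite /ball/=; move: (yq l) (qP l) ke; rewrite /rbox_lo /rbox_hi /= in_itv/= mxE.
move: (k.+1%:R^-1) => r; rewrite !ltr_norml => /andP[? ?] /andP[? ?] ?.
by apply/andP; split; lra.
Qed.

Lemma fundamental_lemma D h : open D -> loc_integrable D h ->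
  (forall psi, test_function D psi -> \int[mu]_(x in D) (h x * psi x) = 0) ->
  {ae mu, forall x, D x -> h x = 0}.
Proof.
move=> oD lh h0.
(* The rational boxes are enumerated by [pickle], since only a sequence of null sets can be united;
   a number that codes no box gets a trivial condition. *)
have : {ae mu, forall x, forall n : nat, if unpickle n is Some q then
    cbox (rbox_lo q) (rbox_hi q) `<=` D -> obox (rbox_lo q) (rbox_hi q) x -> h x = 0 else True}.
  apply: ae_foralln => n; case: unpickle => [q|]; last exact: aeW.
  have [qD|qD] := pselect (cbox (rbox_lo q) (rbox_hi q) `<=` D); last by apply: aeW => x /qD.
  by apply: filterS (fundamental_obox lh h0 qD) => x H _.
apply: filterS => x H Dx; have [q [xq qD]] := open_rbox oD Dx.
by have := H (pickle q); rewrite pickleK; exact.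
Qed.

Lemma test_functionS D D' psi : D `<=` D' -> test_function D psi -> test_function D' psi.
Proof.
move=> DD' [sp [K [cK KD p0]]]; split => //; exists K; split => //.
exact: subset_trans DD'.
Qed.

Lemma integrable_mul_test D f psi : loc_integrable D f -> test_function D psi ->
  measurable D -> mu.-integrable D (EFin \o (fun x => f x * psi x)).
Proof.
move=> [mf fi] [sp [K [cK KD p0]]] mD; have mK := compact_measurable_rV cK.
have -> : EFin \o (fun x => f x * psi x) = (EFin \o (fun x => f x * psi x)) \_ K.
  apply/funext => x; rewrite patchE; case: ifPn => //; rewrite notin_setE => xK.
  by rewrite /= p0// mulr0.
apply/integrable_restrict => //; rewrite (setIidr KD).
have cp := smooth_continuous sp.
have [B B0 HB] := continuous_bounded_compact cK cp.
apply: (@le_integrable _ _ _ mu K mK _ (fun x => B%:E * (EFin \o f) x)%E).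
- apply/measurable_EFinP; apply: measurable_funM; last exact: continuous_measurable_rV.
  exact: measurable_funS mf.
- move=> x Kx; rewrite /= lee_fin !normrM mulrC ler_wpM2r// (le_trans (HB _ Kx))//.
  exact: ler_norm.
- by apply: integrableZl => //; exact: fi.
Qed.

(** As [weakD] is an arbitrary choice among weak derivatives, every computation with it rests on
    this uniqueness. *)
Lemma weak_derivative_unique D k (a : mindex d k) f g g' : open D ->
  weak_derivative D a f g -> weak_derivative D a f g' ->
  {ae mu, forall x, D x -> g x = g' x}.
Proof.
move=> oD [lf lg Hg] [_ lg' Hg']; have mD := open_measurable_rV oD.
have : {ae mu, forall x, D x -> g x + (-1) * g' x = 0}.
  apply: fundamental_lemma => //; first exact: loc_integrableD.
  move=> psi tpsi; have := Hg psi tpsi; rewrite Hg'// => /eqP.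
  rewrite -subr_eq0 -mulrBr mulf_eq0 signr_eq0/= subr_eq0 => /eqP H.
  under eq_Rintegral do rewrite mulrDl mulN1r mulNr.
  rewrite RintegralB//; [by rewrite H subrr|exact: integrable_mul_test..].
by apply: filterS => x H Dx; have := H Dx; rewrite mulN1r => /eqP; rewrite subr_eq0 => /eqP.
Qed.

Lemma weakDP D k (a : mindex d k) f g : weak_derivative D a f g ->
  weak_derivative D a f (weakD D a f).
Proof. by move=> H; rewrite /weakD; apply: getPex; exists g. Qed.

Lemma weakD_ae D k (a : mindex d k) f g : open D -> weak_derivative D a f g ->
  {ae mu, forall x, D x -> weakD D a f x = g x}.
Proof. by move=> oD H; apply: weak_derivative_unique (weakDP H) H. Qed.

Lemma weak_derivative_sub D D' k (a : mindex d k) f g : open D -> open D' -> D `<=` D' ->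
  weak_derivative D' a f g -> weak_derivative D a f g.
Proof.
move=> oD oD' DD' [lf lg H]; have mD := open_measurable_rV oD; have mD' := open_measurable_rV oD'.
split; [exact: loc_integrableS lf mD'|exact: loc_integrableS lg mD'|].
move=> psi tp; have [sp [K [cK KD p0]]] := tp; have clK := compact_closed_rV cK.
have := H psi (test_functionS DD' tp).
have off1 x : ~ K x -> f x * partial a psi x = 0.
  by move=> Kx; rewrite [partial _ _ _](iter_partial_off _ clK p0 Kx) mulr0.
have off2 x : ~ K x -> g x * psi x = 0 by move=> Kx; rewrite p0 ?mulr0.
have KD' := subset_trans KD DD'.
by rewrite (Rintegral_off KD off1) (Rintegral_off KD off2) (Rintegral_off KD' off1) (Rintegral_off KD' off2).
Qed.

Lemma weak_derivative0 D (a : mindex d 0) f : loc_integrable D f -> weak_derivative D a f f.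
Proof.
move=> lf; have a0 : mdeg a = 0%N.
  by rewrite /mdeg big1// => l _; case: (a l) => -[].
split => // psi _; rewrite a0 expr0 mul1r; apply: eq_Rintegral => x _.
by congr (_ * _); rewrite /partial (_ : flatten _ = [::])//; apply/nilP; rewrite /nilp size_mindex_seq a0.
Qed.

(** The bound on the entries is part of the type of a multi-index; this identifies equal
    multi-indices of different types, so that norms of different orders can be compared. *)
Lemma weak_derivative_eq D k k' (a : mindex d k) (a' : mindex d k') f g :
  (forall l, a l = a' l :> nat) -> weak_derivative D a f g = weak_derivative D a' f g.
Proof.
move=> aa'; have E : mdeg a = mdeg a' by rewrite /mdeg; apply: eq_bigr => l _.
have P psi : partial a psi = partial a' psi.
  by rewrite /partial; congr (iter_partial (flatten _) _); apply: eq_map => l; rewrite aa'.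
apply: propext; split => -[lf lg H]; split => // psi tp.
  by rewrite -P -E; exact: H.
by rewrite P E; exact: H.
Qed.

End weak_derivatives.

(** * Estimates on finite-dimensional spaces of functions *)

Section quadratic_forms.
Variables (R : realFieldType) (T : finType).
Implicit Types (b : T -> T -> R) (c l w : T -> R).

Definition qform b c := \sum_s \sum_t c s * c t * b s t.
Definition pairing l c := \sum_t c t * l t.

(** A kernel vector of the symmetric matrix is a null vector of the form, so [l] vanishes on the
    kernel; and the row space of a symmetric matrix is the annihilator of its kernel. *)
Lemma qform_solve b l : (forall s t, b s t = b t s) ->
  (forall c, qform b c = 0 -> pairing l c = 0) ->
  exists w, forall t, \sum_s w s * b s t = l t.
Proof.
move=> bC kl; pose N := #|T|.
pose B : 'M[R]_N := \matrix_(i, j) b (enum_val i) (enum_val j).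
pose L : 'rV[R]_N := \row_j l (enum_val j).
have BT : B^T = B by apply/matrixP => i j; rewrite !mxE bC.
have pairE (c : 'rV[R]_N) : (c *m L^T) 0 0 = pairing l (fun t => c 0 (enum_rank t)).
  rewrite /pairing (reindex (@enum_val T T)) /=; last first.
    by apply: onW_bij; exact: enum_val_bij.
  by rewrite mxE; apply: eq_bigr => i _; rewrite enum_valK !mxE.
have kL (c : 'rV[R]_N) : c *m B = 0 -> c *m L^T = 0.
  move=> cB; apply/matrixP => i j; rewrite !ord1 pairE mxE; apply: kl.
  rewrite /qform exchange_big big1// => t _.
  under eq_bigr => s _ do rewrite mulrAC.
  rewrite -mulr_suml; apply/eqP; rewrite mulf_eq0; apply/orP; left; apply/eqP.
  have /matrixP/(_ 0 (enum_rank t)) := cB; rewrite mxE [RHS]mxE => cBt; apply: (etrans _ cBt).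
  rewrite (reindex (@enum_val T T)) /=; last by apply: onW_bij; exact: enum_val_bij.
  by apply: eq_bigr => i0 _; rewrite enum_valK mxE enum_rankK.
(* Since [B] is symmetric, the rows of its transposed cokernel matrix lie in its kernel, where [l]
   is zero. *)
have LB : (L <= B)%MS.
  have : (cokermx B)^T *m L^T = 0.
    apply/row_matrixP => i; rewrite row_mul row0; apply: kL.
    have CB : (cokermx B)^T *m B = 0 by rewrite -[X in _ *m X]BT -trmx_mul mulmx_coker trmx0.
    by rewrite -row_mul CB row0.
  by rewrite submxE -trmx_mul => /(congr1 trmx); rewrite trmxK trmx0 => ->.
have /submxP[W LE] := LB.
exists (fun t => W 0 (enum_rank t)) => t.
have -> : l t = L 0 (enum_rank t) by rewrite mxE enum_rankK.
rewrite LE mxE (reindex (@enum_val T T)) /=; last by apply: onW_bij; exact: enum_val_bij.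
by apply: eq_bigr => i _; rewrite enum_valK mxE enum_rankK.
Qed.

Lemma qform_cauchy_schwarz b : (forall s t, b s t = b t s) ->
  (forall c, 0 <= qform b c) ->
  forall w c, (\sum_s \sum_t w s * c t * b s t) ^+ 2 <= qform b w * qform b c.
Proof.
move=> bC b0 w c; set X := \sum_s _.
have expand (x y : R) : qform b (fun t => x * w t + y * c t) =
    x ^+ 2 * qform b w + x * y * X *+ 2 + y ^+ 2 * qform b c.
  have XE : X = \sum_s \sum_t c s * w t * b s t.
    rewrite /X exchange_big/=; apply: eq_bigr => s _; apply: eq_bigr => t _.
    by rewrite bC [w t * _]mulrC.
  rewrite mulr2n {2}XE /X /qform !mulr_sumr -!big_split/=; apply: eq_bigr => s _.
  rewrite !mulr_sumr -!big_split/=; apply: eq_bigr => t _; ring.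
(* For a null vector [c] the expansion gives qform b w + 2 x X >= 0 for every x. If X is nonzero,
   the x chosen below makes the left side - qform b w - 2, a contradiction. *)
have [Q0|Q0] := eqVneq (qform b c) 0.
  have H (x : R) : 0 <= qform b w + x * X *+ 2.
    by have := b0 (fun t => 1 * w t + x * c t); rewrite expand Q0 mulr0 addr0 expr1n !mul1r.
  have [->|X0] := eqVneq X 0; first by rewrite Q0 mulr0 expr0n.
  have := H (- (qform b w + 1) / X); rewrite mulrVK ?unitfE//; have := b0 w; lra.
have Q1 : 0 < qform b c by rewrite lt_neqAle eq_sym Q0 b0.
(* Up to a factor, the combination of [w] and [c] at which the form is smallest along the direction
   of [c]. *)
have := b0 (fun t => qform b c * w t + (- X) * c t); rewrite expand.
rewrite -(pmulr_rge0 _ Q1) => H.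
rewrite -subr_ge0 -(pmulr_rge0 _ Q1) -(pmulr_rge0 _ Q1).
by apply: le_trans H _; rewrite le_eqVlt; apply/orP; left; apply/eqP; ring.
Qed.

(* The representation [l = w b] with [w] depending linearly on [l] makes the
   constant uniform in [l]. *)
Lemma qform_bound b (L : R) : (forall s t, b s t = b t s) ->
  (forall c, 0 <= qform b c) ->
  exists2 C, 0 <= C & forall l, (forall t, `|l t| <= L) ->
    (forall c, qform b c = 0 -> pairing l c = 0) ->
    forall c, pairing l c ^+ 2 <= C * qform b c.
Proof.
move=> bC b0; pose N := #|T|.
pose B : 'M[R]_N := \matrix_(i, j) b (enum_val i) (enum_val j).
pose X := pinvmx B.
pose K := \sum_i \sum_j `|X i j|.
have K0 : 0 <= K by apply: sumr_ge0 => i _; apply: sumr_ge0.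
(* Each coefficient of the representing [w] is at most |L| K, so [C] bounds qform b w. *)
pose C := \sum_s \sum_t (`|L| * K) * (`|L| * K) * `|b s t|.
have LK0 : 0 <= `|L| * K by exact: mulr_ge0.
exists C; first by apply: sumr_ge0 => s _; apply: sumr_ge0 => t _; rewrite !mulr_ge0.
move=> l lL kl c; have [w0 w0E] := qform_solve bC kl.
pose l' : 'rV[R]_N := \row_j l (enum_val j).
have lB : (l' <= B)%MS.
  apply/submxP; exists (\row_i w0 (enum_val i)); apply/rowP => j; rewrite !mxE -w0E.
  rewrite (reindex (@enum_val T T)) /=; last by apply: onW_bij; exact: enum_val_bij.
  by apply: eq_bigr => i _; rewrite !mxE.
pose w t := (l' *m X) 0 (enum_rank t).
have wE t : \sum_s w s * b s t = l t.
  have -> : l t = l' 0 (enum_rank t) by rewrite mxE enum_rankK.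
  rewrite -(mulmxKpV lB) [RHS]mxE (reindex (@enum_val T T)) /=; last by apply: onW_bij; exact: enum_val_bij.
  by apply: eq_bigr => i _; rewrite /w enum_valK [B _ _]mxE enum_rankK.
have wL t : `|w t| <= `|L| * K.
  rewrite /w mxE (le_trans (ler_norm_sum _ _ _))// /K mulr_sumr; apply: ler_sum => i _.
  rewrite normrM ler_pM//; first by rewrite mxE (le_trans (lL _))// ler_norm.
  by rewrite (bigD1 (enum_rank t))//= lerDl sumr_ge0.
have -> : pairing l c = \sum_s \sum_t w s * c t * b s t.
  rewrite exchange_big /pairing; apply: eq_bigr => t _; rewrite -wE mulr_sumr.
  by apply: eq_bigr => s _; ring.
apply: le_trans (qform_cauchy_schwarz bC b0 w c) _; apply: ler_wpM2r => //.
rewrite /qform /C; apply: ler_sum => s _; apply: ler_sum => t _.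
by rewrite (le_trans (ler_norm _))// !normrM !ler_pM ?mulr_ge0.
Qed.

End quadratic_forms.

(** * Open boxes and positivity of the measure of open sets *)

Section local_space.
Variables (R : realType) (d : nat).
Local Notation leb := (@lebesgue_measure R).
Local Notation mu := (lebesgue_rV R d).
Implicit Types (f g : 'rV[R]_d -> R) (D K : set 'rV[R]_d).
Local Notation E := (@delta_mx R 1 d ord0).

Lemma obox_open (a b : 'I_d -> R) : open (obox a b).
Proof.
rewrite openE => x xab.
apply: (@filter_forall _ _ (fun l => [set y : 'rV[R]_d | `]a l, b l[%classic (y ord0 l)]) (nbhs x)) => l.
have /open_nbhs_nbhs : open_nbhs (x ord0 l) `]a l, b l[%classic by split; [exact: interval_open|exact: xab].
exact: (@coord_continuous R 1 d ord0 l x).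
Qed.

Lemma lebesgue_obox_gt0 (a b : 'I_d -> R) : (forall l, a l < b l) -> (0 < mu (obox a b))%E.
Proof.
move=> ab; rewrite lebesgue_prod_set//.
have : exists2 r : R, 0 < r & (\prod_(l < d) leb `]a l, b l[ = r%:E)%E.
  elim/big_ind : _ => [|x y [r r0 ->] [q q0 ->]|l _]; first by exists 1.
    by exists (r * q); [exact: mulr_gt0|rewrite EFinM].
  by exists (b l - a l); [rewrite subr_gt0|rewrite lebesgue_measure_itv/= lte_fin ab -EFinB].
by move=> [r r0 ->]; rewrite lte_fin.
Qed.

Lemma open_lebesgue_gt0 D : open D -> D !=set0 -> (0 < mu D)%E.
Proof.
move=> oD [x Dx]; have [q [xq qD]] := open_rbox oD Dx.
apply: (@lt_le_trans _ _ (mu (obox (rbox_lo R q) (rbox_hi R q)))).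
  apply: lebesgue_obox_gt0 => l; have := xq l; rewrite /= in_itv/= => /andP[]; exact: lt_trans.
apply: le_measure; rewrite ?inE.
- exact: measurable_obox.
- exact: open_measurable_rV.
- by move=> y /obox_cbox /qD.
Qed.

(** The points of [D] with f x nonzero form an open set; a nonempty one would have positive measure,
    but it lies in a null set. *)
Lemma continuous_integral_eq0 D f : open D -> continuous f ->
  (\int[mu]_(x in D) (f x ^+ 2)%:E = 0)%E -> forall x, D x -> f x = 0.
Proof.
move=> oD cf; have mD := open_measurable_rV oD.
have mf : measurable_fun D (fun x => f x ^+ 2).
  by apply: measurable_funX; exact: continuous_measurable_rV.
under eq_integral => x _ do rewrite -[_%:E]gee0_abs ?lee_fin ?sqr_ge0//.
move=> /(ae_eq_integral_abs _ mD) -/(_ _)[]; first exact/measurable_EFinP.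
move=> N [mN N0 HN] x Dx.
apply/eqP/negPn/negP => fx.
pose U := D `&` f @^-1` [set~ 0].
have oU : open U.
  apply: openI => //; apply: open_comp; first by move=> y _; exact: cf.
  exact/closed_openC/closed_eq.
have : (0 < mu U)%E by apply: open_lebesgue_gt0 => //; exists x; split => //; exact/eqP.
rewrite ltNge => /negP; apply; rewrite -N0; apply: le_measure; rewrite ?inE//.
  exact: open_measurable_rV.
move=> y [Dy fy]; apply: HN => /(_ Dy) /= [] /eqP; rewrite sqrf_eq0 => /eqP; exact: fy.
Qed.

End local_space.

(** * Inverse and chain estimates for a finite family of functions on boxes *)

Section local_functions.
Variables (R : realType) (d P : nat).
Local Notation mu := (lebesgue_rV R d).
Implicit Types (f g : 'rV[R]_d -> R) (D K : set 'rV[R]_d).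

Lemma iter_partial_perm s t f : smd f -> perm_eq s t -> iter_partial s f = iter_partial t f.
Proof.
move=> sf; elim: s t => [|l s IH] t st; first by move: st; rewrite perm_sym => /perm_nilP ->.
have lt : l \in t by rewrite -(perm_mem st) mem_head.
have [t1 [t2 tE]] : exists t1 t2, t = t1 ++ l :: t2 by case/splitPr: lt => t1 t2; exists t1, t2.
have /IH E1 : perm_eq s (t1 ++ t2).
  by rewrite -(perm_cons l) (perm_trans st)// tE -cat1s perm_catCA.
rewrite /= E1 tE /iter_partial !foldr_cat/= -!/(iter_partial _ _) -/(pd l _).
by rewrite iter_partial_comm//; exact: smd_iter_partial.
Qed.

(** [partial] applies the derivatives sorted by coordinate. Since they commute, any list can be
    sorted, and the multiplicities are the entries of the multi-index. *)
Lemma iter_partial_partial s f : smd f ->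
  exists2 a : mindex d (size s), mdeg a = size s & iter_partial s f = partial a f.
Proof.
move=> sf; pose a : mindex d (size s) := [ffun l => inord (count_mem l s)].
have aE l : a l = count_mem l s :> nat by rewrite ffunE inordK// ltnS count_size.
have sa : perm_eq s (flatten [seq nseq (a l) l | l <- enum 'I_d]).
  apply/allP => k _ /=; rewrite count_flatten -map_comp; apply/eqP.
  rewrite sumnE big_map big_enum/= (bigD1 k)//= count_nseq /= eqxx mul1n aE big1 ?addn0//.
  by move=> l lk; rewrite count_nseq /= (negbTE lk) mul0n.
exists a; last by rewrite /partial; exact: iter_partial_perm.
by rewrite -size_mindex_seq -(perm_size sa).
Qed.

Lemma derive_sum_partial f x v : differentiable f x ->
  'D_v f x = \sum_l v ord0 l * pd l f x.
Proof.
move=> df; rewrite deriveE// {1}(row_sum_delta v) linear_sum; apply: eq_bigr => l _.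
by rewrite linearZ /pd deriveE.
Qed.

(** [z] may be a boundary point: the mean value theorem on the segment from [z] to [x] evaluates the
    gradient strictly between them, hence in the open box. *)
Lemma pd_eq0_cst f (a b : 'I_d -> R) x z : smd f -> (forall l y, obox a b y -> pd l f y = 0) ->
  obox a b x -> cbox a b z -> f x = f z.
Proof.
move=> sf f0 xab zab.
pose g (t : R) := f (t *: (x - z) + z).
have dg (t : R) : is_derive t (1:R) g ('D_(x - z) f (t *: (x - z) + z)).
  have D := @smd_derivable _ _ f (t *: (x - z) + z) (x - z) sf.
  have EE : (fun h : R => h^-1 *: ((g \o shift t) (h *: (1:R)) - g t)) =
    (fun h => h^-1 *: ((f \o shift (t *: (x - z) + z)) (h *: (x - z)) - f (t *: (x - z) + z))).
    by apply/funext => h /=; rewrite /g [h *: (1:R)]mulr1 scalerDl addrA.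
  by apply: DeriveDef; rewrite /derivable /derive EE.
have cg : {within `[0, 1], continuous g}.
  apply: continuous_subspaceT => t; apply: differentiable_continuous.
  by apply/derivable1_diffP; have [] := dg t.
have [c] := @MVT R g (fun t => 'D_(x - z) f (t *: (x - z) + z)) 0 1 ltr01 (fun t _ => dg t) cg.
rewrite in_itv/= => /andP[c0 c1] /eqP; rewrite /g scale1r subrK scale0r add0r subr0 mulr1.
rewrite derive_sum_partial; last exact: smd_differentiable.
rewrite big1 ?subr_eq0 => [/eqP//|l _]; rewrite f0 ?mulr0// => k.
move: (xab k) (zab k); rewrite /= !mxE !in_itv/= => /andP[h1 h2] /andP[h3 h4].
by apply/andP; split; nra.
Qed.

(** Descent in the order: if the derivatives of order n+1 vanish on the box, those of order n are
    constant there, with the value 0 that they take at [z]. *)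
Lemma iter_partial_eq0_down f (a b : 'I_d -> R) n z : smd f ->
  (forall s y, size s = n -> obox a b y -> iter_partial s f y = 0) ->
  cbox a b z -> (forall s, iter_partial s f z = 0) ->
  forall y, obox a b y -> f y = 0.
Proof.
move=> sf; elim: n => [|n IH] H zab fz y yab; first exact: (H [::]).
apply: IH => // s x sn xab.
rewrite (@pd_eq0_cst _ a b x z (smd_iter_partial s sf) _ xab zab) ?fz// => l w wab.
by apply: (H (l :: s)) => //=; rewrite sn.
Qed.

Lemma vanishes_on_closure D f z : continuous f -> (forall x, D x -> f x = 0) -> closure D z -> f z = 0.
Proof.
move=> cf f0; have /closure_id cl : closed (f @^-1` [set 0]).
  apply: closed_comp; first by move=> y _; exact: cf.
  exact: closed_eq.
by move=> Dz; have : closure (f @^-1` [set 0]) z; [apply: closure_subset Dz => x /f0|rewrite -cl].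
Qed.

Lemma closure_obox (a b : 'I_d -> R) : (forall l, a l < b l) -> closure (obox a b) = cbox a b.
Proof.
move=> ab; apply/seteqP; split.
  have /closure_id -> : closed (cbox a b) by apply: compact_closed_rV; exact: compact_cbox.
  by apply: closure_subset; exact: obox_cbox.
move=> z zab B /nbhs_ballP[e /= e0 zeB].
(* [z] is moved towards the centre of the box by the fraction [t], which changes no coordinate by
   [e] or more; the added 1 keeps the denominator positive. *)
pose t := Num.min 1 (e / (\sum_l (b l - a l) + 1)) / 2.
have S0 : 0 < \sum_l (b l - a l) + 1.
  by rewrite ltr_wpDl// sumr_ge0// => l _; rewrite subr_ge0 ltW.
have t0 : 0 < t by rewrite divr_gt0// lt_min ltr01 divr_gt0.
have t1 : t < 1 by rewrite ltr_pdivrMr// mul1r gt_min; apply/orP; left; lra.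
have te l : t * (b l - a l) < e.
  apply: (@le_lt_trans _ _ (t * (\sum_l (b l - a l) + 1))).
    rewrite ler_pM2l// (bigD1 l)//= -addrA lerDl addr_ge0// sumr_ge0// => k _.
    by rewrite subr_ge0 ltW.
  rewrite /t mulrAC ltr_pdivrMr// (@le_lt_trans _ _ e)//; last by lra.
  by rewrite -ler_pdivlMr// ge_min lexx orbT.
exists (\row_l (z ord0 l + t * ((a l + b l) / 2 - z ord0 l))); split.
  by move=> l; move: (zab l) (ab l); rewrite /= mxE !in_itv/= => /andP[? ?] ?; apply/andP; split; nra.
apply: zeB; split => // i l; have -> : i = ord0 by exact: ord1.
rewrite /ball/= mxE opprD addNKr normrN normrM (gtr0_norm t0).
apply: le_lt_trans (te l); rewrite ler_pM2l// ler_norml.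
by move: (zab l) (ab l); rewrite /= !in_itv/= => /andP[? ?] ?; apply/andP; split; lra.
Qed.

Section comb.
Variables (T : finType) (F : T -> 'rV[R]_d -> R).
Hypothesis sF : forall t, smd (F t).

Definition lcomb (c : T -> R) (y : 'rV[R]_d) : R := \sum_t c t * F t y.

Lemma smd_lcomb c : smd (lcomb c).
Proof. by apply: smd_sum => t _; apply: smd_mul => //; exact: smd_cst. Qed.

Lemma iter_partial_lcomb s c : iter_partial s (lcomb c) = fun y => \sum_t c t * iter_partial s (F t) y.
Proof.
rewrite iter_partial_sum; last by move=> t; apply: smd_mul => //; exact: smd_cst.
by apply/funext => y; apply: eq_bigr => t _; rewrite iter_partial_scale.
Qed.

Lemma continuous_integrable_obox f a b : continuous f -> mu.-integrable (obox a b) (EFin \o f).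
Proof.
move=> cf; apply: (@integrableS _ _ _ mu (cbox a b)).
- exact: measurable_cbox.
- exact: measurable_obox.
- exact: obox_cbox.
- by have [_] := continuous_loc_integrable setT cf; apply => //; exact: compact_cbox.
Qed.

Lemma continuous_bigsum I (r : seq I) (p : pred I) (G : I -> 'rV[R]_d -> R) :
  (forall i, continuous (G i)) -> continuous (fun x => \sum_(i <- r | p i) G i x).
Proof.
move=> cG; elim: r => [|i r IH] x.
  rewrite (_ : (fun _ => _) = cst 0); first exact: cst_continuous.
  by apply/funext => y; rewrite big_nil.
under eq_fun do rewrite big_cons; case: (p i); last exact: IH.
by apply: (@continuousD _ _ _ (G i)); [exact: cG|exact: IH].
Qed.

Lemma Rintegral_sum_obox I (r : seq I) (p : pred I) (G : I -> 'rV[R]_d -> R) a b :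
  (forall i, continuous (G i)) ->
  \int[mu]_(x in obox a b) (\sum_(i <- r | p i) G i x) =
  \sum_(i <- r | p i) \int[mu]_(x in obox a b) G i x.
Proof.
move=> cG; have mU := measurable_obox a b.
rewrite /Rintegral sum_fine; last first.
  by move=> i _; apply: integrable_fin_num => //; exact: continuous_integrable_obox.
rewrite -(integral_sum mU (fun i => continuous_integrable_obox a b (cG i))).
by congr fine; apply: eq_integral => x _; rewrite sumEFin.
Qed.

Lemma gram_lcomb (G : T -> 'rV[R]_d -> R) c a b : (forall t, continuous (G t)) ->
  \int[mu]_(x in obox a b) ((\sum_t c t * G t x) ^+ 2) =
  qform (fun s t => \int[mu]_(x in obox a b) (G s x * G t x)) c.
Proof.
move=> cG; have mU := measurable_obox a b.
have cGG s t : continuous (fun x => G s x * G t x).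
  by move=> x; apply: continuousM; exact: cG.
have ccGG s t : continuous (fun x => c s * c t * (G s x * G t x)).
  by move=> x; apply: (@cvgM _ _ (nbhs x) _ (fun=> c s * c t) (fun x => G s x * G t x)); [exact: cvg_cst|exact: cGG].
under eq_Rintegral => x _.
  rewrite expr2 mulr_suml; under eq_bigr => s _.
    rewrite mulr_sumr; under eq_bigr do rewrite mulrACA.
    over.
  over.
rewrite (@Rintegral_sum_obox _ _ _ (fun s x => \sum_t c s * c t * (G s x * G t x))); last first.
  by move=> s; apply: (continuous_bigsum (G := fun t x => c s * c t * (G s x * G t x))).
apply: eq_bigr => s _; rewrite Rintegral_sum_obox//; apply: eq_bigr => t _.
by rewrite RintegralZl//; exact: continuous_integrable_obox.
Qed.

Lemma Rintegral_sqr_ge0 D f : 0 <= \int[mu]_(x in D) (f x ^+ 2).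
Proof. by apply: Rintegral_ge0 => x _; exact: sqr_ge0. Qed.

Lemma continuous_sqr f : continuous f -> continuous (fun x => f x ^+ 2).
Proof. by move=> cf x; apply: continuousM; exact: cf. Qed.

Lemma Rintegral_sqr_eq0 f a b : continuous f ->
  \int[mu]_(x in obox a b) (f x ^+ 2) = 0 -> forall x, obox a b x -> f x = 0.
Proof.
move=> cf H; apply: continuous_integral_eq0 => //; first exact: obox_open.
have := @integrable_fin_num _ _ _ mu _ (measurable_obox a b) _ (continuous_integrable_obox a b (continuous_sqr cf)).
by move=> /fineK <-; rewrite -[fine _]/(\int[mu]_(x in obox a b) (f x ^+ 2)) H.
Qed.

(** For fixed [s] and [y] the derivative is a linear functional of the coefficients, with entries
    bounded uniformly on the closed box. It vanishes whenever the L2 norm does, because the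
    combination is then zero on the whole open box; so [qform_bound] gives one constant for all
    points and all lists of length n. *)
Lemma lcomb_inverse a b n : exists2 C, 0 <= C & forall s c y, size s = n -> obox a b y ->
  iter_partial s (lcomb c) y ^+ 2 <= C * \int[mu]_(x in obox a b) (lcomb c x ^+ 2).
Proof.
have cF t : continuous (F t) by exact: smd_continuous.
have /choice[B HB] : forall st : n.-tuple 'I_d * T, exists B : R,
    0 <= B /\ forall x, cbox a b x -> `|iter_partial st.1 (F st.2) x| <= B.
  move=> st; have [B B0 HB] := continuous_bounded_compact (@compact_cbox R d a b)
    (smd_continuous (smd_iter_partial st.1 (sF st.2))).
  by exists B; split => //; exact: ltW.
pose bb s t := \int[mu]_(x in obox a b) (F s x * F t x).
have qE c : qform bb c = \int[mu]_(x in obox a b) (lcomb c x ^+ 2) by rewrite gram_lcomb.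
have [||C C0 HC] := @qform_bound R T bb (\sum_st B st).
- by move=> s t; apply: eq_Rintegral => x _; rewrite mulrC.
- by move=> c; rewrite qE; exact: Rintegral_sqr_ge0.
exists C => // s c y sn yab; rewrite -qE iter_partial_lcomb.
have -> : \sum_t c t * iter_partial s (F t) y = pairing (fun t => iter_partial s (F t) y) c by [].
apply: HC => [t|c'].
  have sn' : size s == n by rewrite sn.
  rewrite (bigD1 (Tuple sn', t))//= (@le_trans _ _ (B (Tuple sn', t)))//.
    by have [_] := HB (Tuple sn', t); apply; exact: obox_cbox.
  by rewrite lerDl sumr_ge0// => i _; have [] := HB i.
rewrite qE => /(Rintegral_sqr_eq0 (smd_continuous (smd_lcomb c'))) c0.
apply: (etrans (esym (congr1 (fun h => h y) (iter_partial_lcomb s c')))).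
rewrite -[RHS](congr1 (@^~ y) (@iter_partial0 R d s)); apply: near_iter_partial.
have : nbhs y (obox a b) by apply: open_nbhs_nbhs; split => //; exact: obox_open.
by apply: filterS => x; exact: c0.
Qed.

(* If [lcomb c] vanishes on the box [a', b'] and its derivatives of order [P.+1]
   vanish on the box [a, b], then it is a polynomial on [a, b] all of whose
   derivatives vanish at the common point [z], so it vanishes on [a, b]. *)
Lemma lcomb_chain a b a' b' z : (forall l, a' l < b' l) -> cbox a b z -> cbox a' b' z ->
  exists2 C, 0 <= C & forall c y, obox a b y ->
  lcomb c y ^+ 2 <= C * (\int[mu]_(x in obox a' b') (lcomb c x ^+ 2) +
    \sum_(e : mindex d P.+1 | mdeg e == P.+1)
      \int[mu]_(x in obox a b) (partial e (lcomb c) x ^+ 2)).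
Proof.
move=> ab' zab zab'; have cF t : continuous (F t) by exact: smd_continuous.
have cpF (e : mindex d P.+1) t : continuous (partial e (F t)).
  by apply: smd_continuous; exact: smd_iter_partial.
have /choice[B HB] : forall t, exists B : R, 0 <= B /\ forall x, cbox a b x -> `|F t x| <= B.
  move=> t; have [B B0 HB] := continuous_bounded_compact (@compact_cbox R d a b) (cF t).
  by exists B; split => //; exact: ltW.
pose bb s t := \int[mu]_(x in obox a' b') (F s x * F t x) +
  \sum_(e : mindex d P.+1 | mdeg e == P.+1) \int[mu]_(x in obox a b) (partial e (F s) x * partial e (F t) x).
have qE c : qform bb c = \int[mu]_(x in obox a' b') (lcomb c x ^+ 2) +
    \sum_(e : mindex d P.+1 | mdeg e == P.+1)
      \int[mu]_(x in obox a b) (partial e (lcomb c) x ^+ 2).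
  rewrite gram_lcomb//; under [in RHS]eq_bigr => e _.
    under eq_Rintegral => x _ do rewrite [partial e _](iter_partial_lcomb _ c).
    rewrite (gram_lcomb _ _ _ (cpF e)).
    over.
  rewrite /qform [X in _ = _ + X]exchange_big/= -big_split/=; apply: eq_bigr => s _.
  rewrite [X in _ = _ + X]exchange_big/= -big_split/=; apply: eq_bigr => t _.
  by rewrite /bb mulrDr mulr_sumr.
have q0 c : 0 <= qform bb c.
  rewrite qE addr_ge0 ?Rintegral_sqr_ge0// sumr_ge0// => e _; exact: Rintegral_sqr_ge0.
have [||C C0 HC] := @qform_bound R T bb (\sum_t B t).
- move=> s t; congr (_ + _); last apply: eq_bigr => e _; by apply: eq_Rintegral => x _; rewrite mulrC.
- by [].
exists C => // c y yab; rewrite -qE.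
apply: (HC (fun t => F t y)) => [t|c'].
  rewrite (bigD1 t)//= (@le_trans _ _ (B t))//.
    by have [_] := HB t; apply; exact: obox_cbox.
  by rewrite lerDl sumr_ge0// => i _; have [] := HB i.
rewrite qE => /eqP; rewrite paddr_eq0 ?Rintegral_sqr_ge0//; last first.
  by rewrite sumr_ge0// => e _; exact: Rintegral_sqr_ge0.
move=> /andP[/eqP H1]; rewrite psumr_eq0; last by move=> e _; exact: Rintegral_sqr_ge0.
move=> /allP H2.
have sc := smd_lcomb c'.
have {}H1 := Rintegral_sqr_eq0 (smd_continuous sc) H1.
apply: (@iter_partial_eq0_down (lcomb c') a b P.+1 z) => //.
- move=> s x sP xab; have [e eP ->] := iter_partial_partial s sc.
  move: e eP; rewrite sP => e eP.
  apply: (Rintegral_sqr_eq0 (smd_continuous (smd_iter_partial _ sc))) xab.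
  by have := H2 e (mem_index_enum _); rewrite eP eqxx => /eqP.
- move=> s; apply: (@vanishes_on_closure (obox a' b')); last by rewrite closure_obox.
    by apply: smd_continuous; exact: smd_iter_partial.
  move=> x xab; rewrite -[RHS](congr1 (@^~ x) (@iter_partial0 R d s)); apply: near_iter_partial.
  have : nbhs x (obox a' b') by apply: open_nbhs_nbhs; split => //; exact: obox_open.
  by apply: filterS => w; exact: H1.
Qed.

End comb.

End local_functions.

(** * Trial functions on an element *)

Section scaling.
Variables (R : realType) (d : nat).
Local Notation mu := (lebesgue_rV R d).
Implicit Types (f g : 'rV[R]_d -> R) (D K : set 'rV[R]_d).

Lemma affine_coord (s : R) (y b : 'rV[R]_d) l : (s *: y + b) ord0 l = s * y ord0 l + b ord0 l.
Proof. by rewrite !mxE. Qed.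

Lemma smd_affine g (s : R) (b : 'rV[R]_d) : smd g -> smd (fun y => g (s *: y + b)).
Proof.
elim=> {g}[c|f l sf|f g _ df _ dg|f g _ df _ dg].
- exact: smd_cst.
- under eq_fun do rewrite affine_coord.
  exact: (smd_coord l (sm_affine s (b ord0 l) sf)).
- exact: smd_add df dg.
- exact: smd_mul df dg.
Qed.

Lemma pd_affine g (s : R) (b : 'rV[R]_d) l : smd g ->
  pd l (fun y => g (s *: y + b)) = fun y => s * pd l g (s *: y + b).
Proof.
elim=> {g}[c|f k sf|f g sf df sg dg|f g sf df sg dg].
- by rewrite pd_cst; apply/funext => y; rewrite mulr0.
- rewrite pd_coord//.
  have -> : (fun y : 'rV[R]_d => f ((s *: y + b) ord0 k)) = fun y => f (s * y ord0 k + b ord0 k).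
    by apply/funext => y; rewrite affine_coord.
  rewrite (pd_coord l k (sm_affine s (b ord0 k) sf)); apply/funext => y.
  rewrite mulrCA; congr (_ * _); rewrite affine_coord !derive1E.
  set t := y ord0 k.
  have H1 : is_derive t (1:R) (fun t => s * t + b ord0 k) s.
    have := is_deriveD (is_deriveM (is_derive_cst s t 1) (is_derive_id t 1)) (is_derive_cst (b ord0 k) t 1).
    by rewrite /GRing.scale/= mulr1 mulr0 !addr0.
  have H2 : is_derive (s * t + b ord0 k) (1:R) f ('D_1 f (s * t + b ord0 k)).
    by apply/derivableP; exact: sm_derivable.
  have [_ ->] := @is_derive1_comp _ f (fun t => s * t + b ord0 k) t _ _ H2 H1.
  by rewrite mulrC.
- have := pd_add l (smd_affine s b sf) (smd_affine s b sg).
  by rewrite /= => ->; rewrite (pd_add l sf sg) df dg; apply/funext => y; rewrite mulrDr.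
- have := smd_pd_mul l (smd_affine s b sf) (smd_affine s b sg).
  rewrite /= => ->; rewrite (smd_pd_mul l sf sg) df dg; apply/funext => y.
  by rewrite mulrDr; congr (_ + _); rewrite mulrCA.
Qed.

Lemma iter_partial_affine g (s : R) (b : 'rV[R]_d) t : smd g ->
  iter_partial t (fun y => g (s *: y + b)) = fun y => s ^+ size t * iter_partial t g (s *: y + b).
Proof.
move=> sg; elim: t => [|l t IH]; first by apply/funext => y; rewrite expr0 mul1r.
rewrite [LHS](congr1 (pd l) IH).
have sh := smd_affine s b (smd_iter_partial t sg).
rewrite (smd_pd_mul l (smd_cst _ _) sh) pd_cst (pd_affine s b l (smd_iter_partial t sg)).
by apply/funext => y; rewrite mulr0 addr0 exprSr mulrA.
Qed.

Definition ucube := @obox R d (fun=> 0) (fun=> 1).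

Lemma lebesgue_ucube : mu ucube = 1%E.
Proof.
rewrite lebesgue_prod_set// big1// => l _.
by rewrite lebesgue_measure_itv/= lte_fin ltr01 -EFinB subr0.
Qed.

Lemma elementE (sigma : R) (j : 'rV[int]_d) : element sigma j =
  obox (fun l => (j ord0 l)%:~R * sigma) (fun l => ((j ord0 l)%:~R + 1) * sigma).
Proof. by apply/seteqP; split => x xj l; have := xj l; rewrite /= in_itv. Qed.

Definition ibox (j : 'rV[int]_d) : set 'rV[R]_d :=
  obox (fun l => (j ord0 l)%:~R) (fun l => (j ord0 l)%:~R + 1).

Lemma ibox0 : ibox 0 = ucube.
Proof. by congr obox; apply/funext => l; rewrite mxE// add0r. Qed.

Definition toelement (sigma : R) (j : 'rV[int]_d) (y : 'rV[R]_d) := sigma *: y + node sigma j.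

Lemma toelement_coord sigma j y l :
  toelement sigma j y ord0 l = sigma * (y ord0 l + (j ord0 l)%:~R).
Proof. by rewrite !mxE; ring. Qed.

Lemma toelementP sigma i j y : 0 < sigma -> element sigma (i + j) (toelement sigma i y) <->
  ibox j y.
Proof.
move=> s0.
split=> H l; have := H l; rewrite /= ?in_itv/= toelement_coord mxE intrD [sigma * _]mulrC !ltr_pM2r//;
  by move=> /andP[? ?]; apply/andP; split; lra.
Qed.

Lemma toelementP0 sigma i y : 0 < sigma -> element sigma i (toelement sigma i y) <-> ucube y.
Proof.
by move=> s0; have := toelementP i 0 y s0; rewrite addr0 ibox0.
Qed.

Lemma measurable_element (sigma : R) j : measurable (element sigma j : set 'rV[R]_d).
Proof. by rewrite elementE; exact: measurable_obox. Qed.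

Lemma open_element (sigma : R) j : open (element sigma j : set 'rV[R]_d).
Proof. by rewrite elementE; exact: obox_open. Qed.

(** Elements are described relative to a base element [i], so that rescaling maps a pair of
    neighbours to one of finitely many fixed pairs of unit boxes. *)
Lemma integral_element sigma i j (f : 'rV[R]_d -> \bar R) : 0 < sigma ->
  measurable_fun setT f -> (forall x, 0 <= f x)%E ->
  (\int[mu]_(x in element sigma (i + j)) f x =
   (sigma ^+ d)%:E * \int[mu]_(y in ibox j) f (toelement sigma i y))%E.
Proof.
move=> s0 mf f0.
rewrite integral_mkcond [in RHS]integral_mkcond.
have mfE : measurable_fun setT (f \_ (element sigma (i + j))).
  by apply/(measurable_restrictT f (measurable_element sigma (i + j))); exact: measurable_funTS.
have fE0 x : (0 <= (f \_ (element sigma (i + j))) x)%E by rewrite patchE; case: ifP.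
have := integral_affine (node sigma i) s0 mfE fE0.
set J := (\int[mu]_x (f \_ _) x)%E => H.
have -> : (\int[mu]_x ((fun y => f (toelement sigma i y)) \_ (ibox j)) x = (sigma ^- d)%:E * J)%E.
  rewrite -H; apply: eq_integral => y _; rewrite !patchE.
  case: ifPn => [/set_mem/(toelementP i j y s0) h|/negP h]; first by rewrite mem_set.
  rewrite memNset// => /(toelementP i j y s0) h'; apply: h; exact: mem_set.
by rewrite muleA -EFinM mulfV ?mul1e// expf_neq0// gt_eqF.
Qed.

Lemma EFin_Rintegral_obox f (a b : 'I_d -> R) : continuous f ->
  (\int[mu]_(x in obox a b) (f x)%:E)%E = (\int[mu]_(x in obox a b) f x)%:E.
Proof.
move=> cf; rewrite /Rintegral fineK//.
apply: integrable_fin_num; [exact: measurable_obox|exact: continuous_integrable_obox].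
Qed.

End scaling.

Section trial.
Variables (R : realType) (d P : nat).
Local Notation mu := (lebesgue_rV R d).
Local Notation ucube := (@ucube R d).
Implicit Types (f g : 'rV[R]_d -> R) (s : seq 'rV[int]_d) (i j : 'rV[int]_d) (sigma : R).

Lemma smd_pu sigma i : 0 < sigma -> smd (pu sigma i : 'rV[R]_d -> R).
Proof.
move=> s0; rewrite puE//; apply: smd_prod => l.
apply: (@smd_coord R d (fun t => hat (t / sigma - (i ord0 l)%:~R)) l).
have := sm_affine sigma^-1 (- (i ord0 l)%:~R) (@sm_hat R).
by under eq_fun do rewrite mulrC.
Qed.

Lemma smd_monomial (a : mindex d P) : smd (@monomial R d P a).
Proof. by apply: smd_prod => l; apply: (@smd_coord R d (fun t => t ^+ a l) l); apply: sm_exprn; exact: sm_id. Qed.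

(** A trial function before the truncation to the fictitious domain, hence smooth everywhere. *)
Definition comb sigma s (c : 'rV[int]_d -> mindex d P -> R) (x : 'rV[R]_d) : R :=
  \sum_(i <- s) \sum_(a : mindex d P | (mdeg a <= P)%N) c i a * (pu sigma i x * monomial a x).

Lemma smd_comb sigma s c : 0 < sigma -> smd (comb sigma s c).
Proof.
move=> s0; apply: smd_sum => i _; apply: smd_sum => a _; apply: smd_mul; first exact: smd_cst.
by apply: smd_mul; [exact: smd_pu|exact: smd_monomial].
Qed.

(* On the cube [-1, 2]^d, only nodes with indices in {-1, ..., 2} contribute to a
   rescaled trial function; ['I_4] encodes them with an offset of 1. *)
Definition lidx := ({ffun 'I_d -> 'I_4} * mindex d P)%type.

Definition lfun (t : lidx) (y : 'rV[R]_d) : R :=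
  \prod_l (hat (y ord0 l - ((t.1 l)%:R - 1)) * y ord0 l ^+ t.2 l).

Lemma smd_lfun t : smd (lfun t).
Proof.
apply: smd_prod => l.
apply: (@smd_coord R d (fun r => hat (r - ((t.1 l)%:R - 1)) * r ^+ t.2 l) l).
apply: sm_mul; last by apply: sm_exprn; exact: sm_id.
have := sm_affine 1 (- ((t.1 l)%:R - 1)) (@sm_hat R).
by under eq_fun do rewrite mul1r.
Qed.

Definition lbox (y : 'rV[R]_d) := forall l, -1 <= y ord0 l <= 2.

(** Equality is asked for on [lbox] only: outside it, nodes that [lidx] leaves out contribute. *)
Definition isloc f := exists C, forall y, lbox y -> f y = lcomb lfun C y.

Lemma isloc_lfun t : isloc (lfun t).
Proof.
exists (fun t' => (t' == t)%:R) => y _; rewrite /lcomb (bigD1 t)//= eqxx mul1r big1 ?addr0//.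
by move=> t' /negbTE ->; rewrite mul0r.
Qed.

Lemma isloc0 f : (forall y, lbox y -> f y = 0) -> isloc f.
Proof.
move=> f0; exists (fun=> 0) => y yB; rewrite f0// /lcomb big1// => t _; exact: mul0r.
Qed.

Lemma isloc_scale k f : isloc f -> isloc (fun y => k * f y).
Proof.
move=> [C HC]; exists (fun t => k * C t) => y yB; rewrite HC// /lcomb mulr_sumr.
by apply: eq_bigr => t _; rewrite mulrA.
Qed.

Lemma isloc_add f g : isloc f -> isloc g -> isloc (fun y => f y + g y).
Proof.
move=> [C HC] [C' HC']; exists (fun t => C t + C' t) => y yB; rewrite HC// HC'// /lcomb -big_split/=.
by apply: eq_bigr => t _; rewrite mulrDl.
Qed.

Lemma isloc_sum I (r : seq I) (p : pred I) (F : I -> 'rV[R]_d -> R) :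
  (forall t, p t -> isloc (F t)) -> isloc (fun y => \sum_(t <- r | p t) F t y).
Proof.
move=> lF; elim: r => [|t r IH]; first by apply: isloc0 => y _; rewrite big_nil.
under eq_fun do rewrite big_cons.
by case pt: (p t) => //; apply: isloc_add => //; exact: lF.
Qed.

Lemma isloc_ext f g : (forall y, lbox y -> f y = g y) -> isloc g -> isloc f.
Proof. by move=> fg [C HC]; exists C => y yB; rewrite fg// HC. Qed.

Lemma pu_toelement sigma i j y : 0 < sigma ->
  pu sigma i (toelement sigma j y) = \prod_l hat (y ord0 l - (i ord0 l - j ord0 l)%:~R).
Proof.
move=> s0; rewrite puE//; apply: eq_bigr => l _; congr hat.
by rewrite toelement_coord intrB; field; rewrite gt_eqF.
Qed.

(** If some offset i_l - j_l lies outside {-1, ..., 2}, the hat function of that coordinate vanishes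
    on [lbox]. Otherwise the rescaled partition function has the form used in [lfun], and the
    rescaled monomial is expanded in each coordinate by the binomial theorem. *)
Lemma isloc_term sigma i j (a : mindex d P) : 0 < sigma ->
  isloc (fun y => pu sigma i (toelement sigma j y) * monomial a (toelement sigma j y)).
Proof.
move=> s0.
have [ij|/existsNP[l /negP ijl]] := pselect (forall l, (-1 <= i ord0 l - j ord0 l <= 2)%R); last first.
  apply: isloc0 => y /(_ l) yl; rewrite pu_toelement// (bigD1 l)//= hat_eq0 ?mul0r//.
  move: ijl; set n := i ord0 l - j ord0 l; rewrite negb_and -!ltNge => /orP[h|h].
    have : n%:~R <= (-2)%:~R :> R by rewrite ler_int; lia.
    by move=> h'; rewrite ger0_norm; lra.
  have : 3%:~R <= n%:~R :> R by rewrite ler_int; lia.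
  by move=> h'; rewrite ler0_norm; lra.
pose b : {ffun 'I_d -> 'I_4} := [ffun l => inord (absz (i ord0 l - j ord0 l + 1)%R)].
have bE l : (b l)%:R - 1 = (i ord0 l - j ord0 l)%:~R :> R.
  rewrite ffunE inordK; last by have := ij l; lia.
  rewrite -[X in X - 1]/((Posz (absz (i ord0 l - j ord0 l + 1)%R))%:~R : R) gez0_abs; last by have := ij l; lia.
  by rewrite intrD addrK.
(* The coefficients of (sigma j_l + sigma y_l)^(a l), padded with zeros up to the common bound
   [P]. *)
pose coef l (m : 'I_P.+1) : R := if (m <= a l)%N then
  (sigma * (j ord0 l)%:~R) ^+ (a l - m) * sigma ^+ m *+ 'C(a l, m) else 0.
apply: (@isloc_ext _ (fun y => \sum_(m : mindex d P) (\prod_l coef l (m l)) * lfun (b, m) y)); last first.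
  by apply: isloc_sum => m _; apply: isloc_scale; exact: isloc_lfun.
move=> y _; rewrite pu_toelement// /monomial.
have E l : toelement sigma j y ord0 l ^+ a l = \sum_(m < P.+1) coef l m * y ord0 l ^+ m.
  rewrite toelement_coord mulrDr addrC exprDn (big_ord_widen P.+1 (fun m => (sigma * (j ord0 l)%:~R) ^+ (a l - m) * (sigma * y ord0 l) ^+ m *+ 'C(a l, m)))//.
  rewrite big_mkcond/=; apply: eq_bigr => m _; rewrite /coef ltnS; case: ifP => _; last by rewrite mul0r.
  by rewrite [(sigma * y ord0 l) ^+ _]exprMn mulrA mulrnAl.
under [X in _ * X]eq_bigr do rewrite E.
rewrite bigA_distr_bigA mulr_sumr; apply: eq_bigr => m _.
rewrite big_split/= mulrCA; congr (_ * _); rewrite /lfun big_split/=; congr (_ * _).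
by apply: eq_bigr => l _; rewrite bE.
Qed.

Lemma comb_isloc sigma s c j : 0 < sigma -> isloc (fun y => comb sigma s c (toelement sigma j y)).
Proof.
move=> s0; apply: isloc_sum => i _; apply: isloc_sum => a _; apply: isloc_scale.
exact: isloc_term.
Qed.

Lemma elementK sigma j x : 0 < sigma ->
  toelement sigma j (sigma^-1 *: (x - node sigma j)) = x.
Proof.
by move=> s0; rewrite /toelement scalerA mulfV ?gt_eqF// scale1r subrK.
Qed.

Lemma continuous_toelement sigma j f : smd f -> continuous (fun y => f (toelement sigma j y)).
Proof. by move=> sf; apply: smd_continuous; exact: smd_affine. Qed.

Lemma integral_element_sqr sigma i j f : 0 < sigma -> smd f ->
  (\int[mu]_(x in element sigma (i + j)) (f x ^+ 2)%:E =
   (sigma ^+ d * \int[mu]_(y in ibox j) (f (toelement sigma i y) ^+ 2))%:E)%E.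
Proof.
move=> s0 sf; rewrite integral_element//.
- by rewrite EFin_Rintegral_obox ?EFinM//; apply: continuous_sqr; exact: continuous_toelement.
- apply/measurable_EFinP; apply: continuous_measurable_rV; apply: continuous_sqr.
  exact: smd_continuous.
- by move=> x; rewrite lee_fin sqr_ge0.
Qed.

Lemma ucube_lbox y : ucube y -> lbox y.
Proof. by move=> y01 l; have := y01 l; rewrite /= in_itv/= => /andP[? ?]; apply/andP; split; lra. Qed.

Lemma near_lcomb f C y (a b : 'I_d -> R) t : (forall y, lbox y -> f y = lcomb lfun C y) ->
  (forall y, obox a b y -> lbox y) -> obox a b y ->
  iter_partial t f y = iter_partial t (lcomb lfun C) y.
Proof.
move=> fC ab yab; apply: near_iter_partial.
have : nbhs y (obox a b) by apply: open_nbhs_nbhs; split => //; exact: obox_open.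
by apply: filterS => x /ab /fC.
Qed.

(** [lcomb_inverse] on the unit cube, transported to an element: n derivatives cost sigma^-n and the
    integral scales with sigma^d. One constant serves all trial functions because each rescaled one
    is a combination of the fixed family [lfun]. *)
Lemma comb_inverse n : exists2 C, 0 <= C & forall sigma s c j t x, 0 < sigma -> size t = n ->
  element sigma j x ->
  ((iter_partial t (comb sigma s c) x ^+ 2)%:E <= (C * sigma ^- (2 * n) * sigma ^- d)%:E *
    \int[mu]_(y in element sigma j) (comb sigma s c y ^+ 2)%:E)%E.
Proof.
have [C C0 HC] := lcomb_inverse smd_lfun (fun=> 0) (fun=> 1) n.
exists C => // sigma s c j t x s0 tn xj.
have [D HD] := comb_isloc s c j s0.
have sg := smd_comb s c s0.
have -> : element sigma j = element sigma (j + 0) by rewrite addr0.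
rewrite integral_element_sqr// ibox0 -EFinM lee_fin.
pose y := sigma^-1 *: (x - node sigma j).
have xE : toelement sigma j y = x by exact: elementK.
have yu : ucube y by apply/(@toelementP0 _ _ sigma j y s0); rewrite xE.
have := HC t D y tn yu.
rewrite -(near_lcomb t HD ucube_lbox yu) iter_partial_affine// tn -/(toelement sigma j y) xE.
have -> : \int[mu]_(x0 in ucube) lcomb lfun D x0 ^+ 2 =
    \int[mu]_(x0 in ucube) comb sigma s c (toelement sigma j x0) ^+ 2.
  by apply: eq_Rintegral => z /set_mem zu; rewrite HD//; exact: ucube_lbox.
set I := (\int[mu]_(_ in _) _)%R => H.
have -> : C * sigma ^- (2 * n) / sigma ^+ d * (sigma ^+ d * I) = C * I * sigma ^- (2 * n).
  by field; rewrite ?expf_neq0 ?gt_eqF.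
rewrite ler_pdivlMr ?exprn_gt0//; apply: le_trans H.
by rewrite exprMn -exprM mulnC mulrC.
Qed.

Lemma closure_elementP sigma i x : 0 < sigma -> closure (element sigma i) x <->
  forall l, (i ord0 l)%:~R * sigma <= x ord0 l <= ((i ord0 l)%:~R + 1) * sigma.
Proof.
move=> s0; rewrite elementE closure_obox; last by move=> l; rewrite ltr_pM2r// ltrDl.
by split=> H l; have := H l; rewrite /= in_itv.
Qed.

Lemma neighbors_dist sigma i j : 0 < sigma -> neighbors sigma i j ->
  forall l, (-1 <= j ord0 l - i ord0 l <= 1)%R.
Proof.
move=> s0 [n [/(closure_elementP _ _ s0) ni /(closure_elementP _ _ s0) nj]] l.
have := ni l; have := nj l; rewrite mxE !ler_pM2r// -!(intrD R _ 1) !ler_int; lia.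
Qed.

(** A neighbour has one of 3^d relative positions. [lcomb_chain] gives a constant for each of them,
    and their sum serves for all. *)
Lemma comb_chain : exists2 C, 0 <= C & forall sigma s c i j, 0 < sigma -> neighbors sigma i j ->
  (\int[mu]_(x in element sigma i) (comb sigma s c x ^+ 2)%:E <=
   C%:E * (\int[mu]_(x in element sigma j) (comb sigma s c x ^+ 2)%:E +
    (sigma ^+ (2 * P.+1))%:E * \sum_(e : mindex d P.+1 | mdeg e == P.+1)
      \int[mu]_(x in element sigma i) (partial e (comb sigma s c) x ^+ 2)%:E))%E.
Proof.
pose k (b : {ffun 'I_d -> 'I_3}) : 'rV[int]_d := \row_l ((b l)%:Z - 1).
have /choice[C HC] : forall b : {ffun 'I_d -> 'I_3}, exists C, 0 <= C /\ forall c y, ucube y ->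
    lcomb lfun c y ^+ 2 <= C * (\int[mu]_(x in ibox (k b)) (lcomb lfun c x ^+ 2) +
    \sum_(e : mindex d P.+1 | mdeg e == P.+1)
      \int[mu]_(x in ucube) (partial e (lcomb lfun c) x ^+ 2)).
  (* A node common to the unit cube and its neighbour: coordinate 1 where the offset is 1 (coded by
     2), and 0 where it is 0 or -1. *)
  move=> b; pose z : 'rV[R]_d := \row_l (b l == 2 :> nat)%:R.
  have [|||C C0 HC] := @lcomb_chain R d P _ lfun smd_lfun (fun=> 0) (fun=> 1)
    (fun l => (k b ord0 l)%:~R) (fun l => (k b ord0 l)%:~R + 1) z.
  - by move=> l; rewrite ltrDl.
  - by move=> l; rewrite /= mxE in_itv/=; case: eqP => _; rewrite ?lexx ?ler01.
  - move=> l; rewrite /= !mxE in_itv/= intrB.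
    by case: (b l) => [[|[|[|//]]] ?] /=; apply/andP; split; lra.
  by exists C; split.
exists (\sum_b C b); first by apply: sumr_ge0 => b _; have [] := HC b.
move=> sigma s c i j s0 ij; have kij := neighbors_dist s0 ij.
have [D HD] := comb_isloc s c i s0.
have sg := smd_comb s c s0; set g := comb sigma s c in HD sg *.
pose b : {ffun 'I_d -> 'I_3} := [ffun l => inord (absz (j ord0 l - i ord0 l + 1)%R)].
have bE l : ((b l)%:Z - 1)%R = (j ord0 l - i ord0 l)%R.
  by rewrite ffunE inordK; have := kij l; lia.
have jE : j = (i + k b)%R by apply/rowP => l; rewrite !mxE bE addrCA subrr addr0.
have kb_lbox y : ibox (k b) y -> lbox y.
  move=> yk l; have := yk l; rewrite /= in_itv/= mxE bE => /andP[h1 h2].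
  have [h3 h4] : (-1)%:~R <= (j ord0 l - i ord0 l)%:~R :> R /\ (j ord0 l - i ord0 l)%:~R <= 1%:~R :> R.
    by rewrite !ler_int; have := kij l; lia.
  by apply/andP; split; lra.
have E0 f : smd f -> (\int[mu]_(x in element sigma i) (f x ^+ 2)%:E =
    (sigma ^+ d * \int[mu]_(y in ucube) (f (toelement sigma i y) ^+ 2))%:E)%E.
  by move=> sf; have := @integral_element_sqr sigma i 0 f s0 sf; rewrite addr0 ibox0.
rewrite E0// [in element sigma j]jE integral_element_sqr//.
(* Rescaling the derivatives of order P+1 yields sigma^(-2(P+1)), which the weight of the
   stabilization form cancels; so no power of sigma remains. *)
have Ee (e : mindex d P.+1) : mdeg e == P.+1 ->
    ((\int[mu]_(x in element sigma i) (partial e g x ^+ 2)%:E) =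
    (sigma ^- (2 * P.+1) * sigma ^+ d * \int[mu]_(y in ucube) (partial e (lcomb lfun D) y ^+ 2))%:E)%E.
  move=> /eqP eP; rewrite E0; last exact: smd_iter_partial.
  rewrite -mulrA [sigma ^- _ * _]mulrCA; congr (_ * _)%:E.
  rewrite -RintegralZl; last 2 first.
  - exact: measurable_obox.
  - apply: continuous_integrable_obox; apply: continuous_sqr; apply: smd_continuous.
    by apply: smd_iter_partial; apply: smd_lcomb; exact: smd_lfun.
  apply: eq_Rintegral => y /set_mem yu.
  rewrite /partial -(near_lcomb _ HD ucube_lbox yu) iter_partial_affine// size_mindex_seq eP.
  by rewrite -/(toelement sigma i y) exprMn -exprM [(P.+1 * 2)%N]mulnC mulrA mulVf ?mul1r// expf_neq0// gt_eqF.
rewrite (eq_bigr _ Ee) sumEFin.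
rewrite -EFinM lee_fin.
rewrite -mulr_sumr mulrA [sigma ^+ (2 * _) * _]mulrA mulfV ?mul1r ?expf_neq0 ?gt_eqF//.
rewrite -mulrDr mulrCA ler_pM2l ?exprn_gt0//.
have -> : \int[mu]_(y in ibox (k b)) (g (toelement sigma i y) ^+ 2) =
    \int[mu]_(y in ibox (k b)) (lcomb lfun D y ^+ 2).
  by apply: eq_Rintegral => y /set_mem /kb_lbox yl; rewrite HD.
set X := (_ + _)%R.
have X0 : 0 <= X.
  by rewrite addr_ge0 ?Rintegral_sqr_ge0// sumr_ge0// => e _; exact: Rintegral_sqr_ge0.
(* The unit cube has measure 1, so the pointwise bound can be integrated over it without changing
   the constant. *)
have -> : (\sum_b C b) * X = \int[mu]_(y in ucube) ((\sum_b C b) * X).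
  rewrite Rintegral_cst; last exact: measurable_obox.
  by rewrite -/ucube lebesgue_ucube mulr1.
apply: le_Rintegral.
- exact: measurable_obox.
- apply: continuous_integrable_obox; apply: continuous_sqr; exact: continuous_toelement.
- by apply: (@continuous_integrable_obox _ _ (cst ((\sum_b C b) * X))); exact: cst_continuous.
- move=> y yu; rewrite HD; last exact: ucube_lbox.
  have [_ H] := HC b; apply: le_trans (H D y yu) _; apply: ler_wpM2r => //.
  by rewrite (bigD1 b)//= lerDl sumr_ge0// => b' _; have [] := HC b'.
Qed.

End trial.

(** * Grid geometry and stability *)

Section grid_geometry.
Variables (R : realType) (d : nat).
Local Notation mu := (lebesgue_rV R d).
Implicit Types (f g : 'rV[R]_d -> R) (D : set 'rV[R]_d) (i j : 'rV[int]_d) (sigma : R).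

Lemma element_closure sigma i j x : 0 < sigma -> element sigma i x ->
  closure (element sigma j) x -> i = j.
Proof.
move=> s0 xi /(closure_elementP _ _ s0) xj; apply/rowP => l; change (i ord0 l = j ord0 l).
have := xi l; have := xj l.
move=> /andP[h1 h2] /andP[h3 h4].
have : (j ord0 l)%:~R * sigma < ((i ord0 l)%:~R + 1) * sigma by exact: le_lt_trans h4.
have : (i ord0 l)%:~R * sigma < ((j ord0 l)%:~R + 1) * sigma by exact: lt_le_trans h2.
rewrite !ltr_pM2r// -!(intrD R _ 1) !ltr_int; lia.
Qed.

Lemma element_nonempty sigma i : 0 < sigma -> element sigma i !=set0.
Proof.
move=> s0; exists (\row_l (((i ord0 l)%:~R + 2^-1) * sigma)) => l; rewrite mxE !ltr_pM2r//.
by apply/andP; split; lra.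
Qed.

(** A point of an open element lies in the closure of no other element. This turns the geometric
    definition of the three domains into conditions on indices. *)
Lemma sub_merge_elements sigma (I : set 'rV[int]_d) i : 0 < sigma ->
  element sigma i `<=` merge_elements sigma I <-> I i.
Proof.
move=> s0; split.
  move=> /(_ _) H; have [x xi] := element_nonempty i s0.
  by have /interior_subset[j Ij /(element_closure s0 xi) ->] := H x xi.
move=> Ii x xi; rewrite /merge_elements /interior.
have : nbhs x (element sigma i) by apply: open_nbhs_nbhs; split => //; exact: open_element.
apply: filterS => y yi; exists i => //; exact: subset_closure.
Qed.

Lemma closure_element_cover sigma (x : 'rV[R]_d) : 0 < sigma ->
  exists i, closure (element sigma i) x.
Proof.
move=> s0; exists (\row_l Num.floor (x ord0 l / sigma)); apply/(closure_elementP _ _ s0) => l.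
rewrite mxE -ler_pdivlMr// floor_le /= -ler_pdivrMr//.
by rewrite -(intrD R _ 1) ltW// floorD1_gt.
Qed.

(** The null set off which the disjoint open elements cover the space. *)
Definition grid_lines sigma : set 'rV[R]_d :=
  \bigcup_(p : 'I_d * int) [set x | x ord0 p.1 = p.2%:~R * sigma].

Lemma negligible_grid_lines sigma : mu.-negligible (grid_lines sigma).
Proof.
have H (l : 'I_d) (c : R) : mu.-negligible [set x : 'rV[R]_d | x ord0 l = c].
  pose A k : set R := if k == l then [set c] else setT.
  have mA k : measurable (A k) by rewrite /A; case: eqP.
  exists (prod_set A); split; first exact: measurable_prod_set.
    by rewrite lebesgue_prod_set// (bigD1 l)//= /A eqxx lebesgue_measure_set1 mul0e.
  by move=> x /= xl k; rewrite /A; case: eqP => [->|].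
have : {ae mu, forall x : 'rV[R]_d, forall n : nat, if unpickle n is Some p then x ord0 (p : 'I_d * int).1 <> p.2%:~R * sigma else True}.
  apply: ae_foralln => n; case: unpickle => [p|]; last exact: aeW.
  apply: negligibleS (H p.1 (p.2%:~R * sigma)) => x /= /contrapT; exact.
apply: negligibleS => x [p _ /= xp] /= /(_ (pickle p)); rewrite pickleK; exact.
Qed.

Lemma closure_element_off sigma i x : 0 < sigma -> closure (element sigma i) x ->
  ~ grid_lines sigma x -> element sigma i x.
Proof.
move=> s0 /(closure_elementP _ _ s0) xi nx l; have /andP[h1 h2] := xi l.
rewrite !lt_neqAle h1 h2 !andbT; apply/andP; split; apply/eqP => E; apply: nx.
  by exists (l, i ord0 l).
by exists (l, i ord0 l + 1) => //=; rewrite intrD.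
Qed.

(** The elements may stick out of [A]. Passing to whole elements is what makes the later bounds
    independent of the way in which [A] cuts them. *)
Lemma integral_le_cover sigma (A : set 'rV[R]_d) (S : seq 'rV[int]_d) (f : 'rV[R]_d -> \bar R) :
  measurable A -> measurable_fun setT f -> (forall x, 0 <= f x)%E ->
  (forall x, A x -> ~ grid_lines sigma x -> exists2 i, i \in S & element sigma i x) ->
  (\int[mu]_(x in A) f x <= \sum_(i <- S) \int[mu]_(x in element sigma i) f x)%E.
Proof.
move=> mA mf f0 cover.
rewrite (eq_bigr (fun i => \int[mu]_x (f \_ (element sigma i)) x)%E); last first.
  by move=> i _; rewrite integral_mkcond.
rewrite -ge0_integral_sum//; last 2 first.
- by move=> i; apply/(measurable_restrictT f (measurable_element sigma i)); exact: measurable_funTS.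
- by move=> i x _; rewrite patchE; case: ifP.
rewrite [leLHS]integral_mkcond; apply: (@ae_ge0_le_integral _ _ _ mu setT measurableT).
- by move=> x _; rewrite patchE; case: ifP.
- by apply/(measurable_restrictT f mA); exact: measurable_funTS.
- by move=> x _; apply: sume_ge0 => i _; rewrite patchE; case: ifP.
- apply: emeasurable_sum => i.
  by apply/(measurable_restrictT f (measurable_element sigma i)); exact: measurable_funTS.
have : {ae mu, forall x, ~ grid_lines sigma x}.
  by apply: negligibleS (negligible_grid_lines sigma) => x /= /contrapT; exact.
apply: filterS => x nx _; rewrite patchE; case: ifPn => [/set_mem Ax|_]; last first.
  by apply: sume_ge0 => i _; rewrite patchE; case: ifP.
have [i iS xi] := cover x Ax nx.
rewrite (big_rem i)//= patchE mem_set// leeDl// sume_ge0// => k _.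
by rewrite patchE; case: ifP.
Qed.

Lemma element_disjoint sigma i j x : 0 < sigma -> element sigma i x -> element sigma j x -> i = j.
Proof. by move=> s0 xi xj; apply: (element_closure s0 xi); exact: subset_closure. Qed.

Lemma sum_integral_element_le sigma D (S : seq 'rV[int]_d) (f : 'rV[R]_d -> \bar R) : 0 < sigma ->
  measurable D -> measurable_fun setT f -> (forall x, 0 <= f x)%E -> uniq S ->
  (forall i, i \in S -> element sigma i `<=` D) ->
  (\sum_(i <- S) \int[mu]_(x in element sigma i) f x <= \int[mu]_(x in D) f x)%E.
Proof.
move=> s0 mD mf f0 uS SD.
rewrite -ge0_integral_bigsetU//.
- apply: ge0_subset_integral => //.
  + by apply: bigsetU_measurable => i _; exact: measurable_element.
  + exact: measurable_funTS.
  + by rewrite -bigcup_seq => x [i /= iS xi]; exact: SD xi.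
- by move=> i; exact: measurable_element.
- by apply/trivIsetP => i j _ _ ij; rewrite -subset0 => x [xi xj]; move: ij; rewrite (element_disjoint s0 xi xj) eqxx.
- exact: measurable_funTS.
Qed.

Lemma finite_index_box (N : nat) : exists2 S : seq 'rV[int]_d, uniq S &
  forall i, (forall l, (- N%:Z <= i ord0 l <= N%:Z)%R) -> i \in S.
Proof.
pose k (b : {ffun 'I_d -> 'I_(2 * N).+1}) : 'rV[int]_d := \row_l ((b l)%:Z - N%:Z).
exists (undup [seq k b | b <- enum {: {ffun 'I_d -> 'I_(2 * N).+1}}]); first exact: undup_uniq.
move=> i iN; rewrite mem_undup; apply/mapP.
exists [ffun l => inord (absz (i ord0 l + N%:Z)%R)]; first by rewrite mem_enum.
apply/rowP => l; change (i ord0 l = k [ffun l => inord (absz (i ord0 l + N%:Z)%R)] ord0 l).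
by rewrite mxE ffunE inordK; have := iN l; lia.
Qed.

Definition coord_bounded D := exists B : R, forall x, D x -> forall l, `|x ord0 l| <= B.

Lemma bounded_coord D : bounded_set D -> coord_bounded D.
Proof.
move=> [B [_ HB]]; exists (`|B| + 1) => x Dx l; have /= := HB (`|B| + 1) _ x Dx.
rewrite ltr_pwDr// ?ler_norm// => /(_ isT); apply: le_trans.
rewrite /Num.norm/= mx_normE.
exact: (le_bigmax _ (fun i : 'I_1 * 'I_d => `|x i.1 i.2|%:nng) (ord0, l)).
Qed.

Section domain.
Variables (sigma : R) (Omega : set 'rV[R]_d) (M : set 'rV[int]_d).
Hypothesis s0 : 0 < sigma.
Hypothesis oO : open Omega.
Hypothesis bO : coord_bounded Omega.

Definition active i := (0 < mu (element sigma i `&` Omega))%E.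
Definition cut_index i := element sigma i `<=` cut_part sigma Omega M.
Definition uncut_index i := element sigma i `<=` uncut_part sigma Omega M.

Lemma activeP i : element sigma i `<=` fictitious sigma Omega <-> active i.
Proof. exact: sub_merge_elements. Qed.

Lemma cutP i : cut_index i <-> active i /\ (~ element sigma i `<=` Omega \/ M i).
Proof.
by rewrite /cut_index /cut_part; split => [/(sub_merge_elements _ _ s0)[/activeP]//|[/activeP h1 h2]];
  apply/(sub_merge_elements _ _ s0).
Qed.

Lemma uncutP i : uncut_index i <-> [/\ active i, element sigma i `<=` Omega & ~ M i].
Proof.
by rewrite /uncut_index /uncut_part; split => [/(sub_merge_elements _ _ s0)[/activeP]//|[/activeP h1 h2 h3]];
  apply/(sub_merge_elements _ _ s0).
Qed.

Lemma active_cut_uncut i : active i -> cut_index i \/ uncut_index i.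
Proof.
move=> ai; have [iO|iO] := pselect (element sigma i `<=` Omega).
  have [Mi|Mi] := pselect (M i); first by left; apply/cutP; split => //; right.
  by right; apply/uncutP.
by left; apply/cutP; split => //; left.
Qed.

(** The open set Omega contains a neighbourhood of [x], so it meets the element in a nonempty open
    set, which has positive measure. *)
Lemma closure_active x i : Omega x -> closure (element sigma i) x -> active i.
Proof.
move=> Ox xi; apply: open_lebesgue_gt0; first by apply: openI => //; exact: open_element.
have : nbhs x Omega by apply: open_nbhs_nbhs; split.
by move=> /xi[y [yi Oy]]; exists y.
Qed.

Lemma open_fictitious : open (fictitious sigma Omega).
Proof. exact: open_interior. Qed.

Lemma sub_fictitious : Omega `<=` fictitious sigma Omega.
Proof.
move=> x Ox; rewrite /fictitious /merge_elements /interior.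
have : nbhs x Omega by apply: open_nbhs_nbhs; split.
apply: filterS => y Oy; have [i yi] := closure_element_cover y s0.
by exists i => //; exact: closure_active yi.
Qed.

Lemma fictitious_off x : fictitious sigma Omega x -> ~ grid_lines sigma x ->
  exists2 i, active i & element sigma i x.
Proof. by move=> /interior_subset[i ai xi] nx; exists i => //; exact: closure_element_off. Qed.

Lemma active_meets i : active i -> exists x, element sigma i x /\ Omega x.
Proof.
move=> ai; apply: contrapT => /forallNP H.
have E : element sigma i `&` Omega = set0 by rewrite -subset0 => x [xi Ox]; apply: (H x).
by move: ai; rewrite /active E measure0 ltxx.
Qed.

Lemma finite_active : exists2 N : nat, True & forall i, active i ->
  forall l, (- N%:Z <= i ord0 l <= N%:Z)%R.
Proof.
have [B HB] := bO.
exists (Num.truncn (B / sigma)).+2 => // i /active_meets[x [xi Ox]] l.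
have := truncnS_gt (B / sigma); set n := Num.truncn _; rewrite ltr_pdivrMr// => nB.
have := HB x Ox l; rewrite ler_norml => /andP[b1 b2]; have /andP[x1 x2] := xi l.
have h1 : (i ord0 l)%:~R * sigma < n.+1%:R * sigma by apply: lt_le_trans (ltW nB); exact: lt_le_trans b2.
have h2 : - n.+1%:R * sigma < ((i ord0 l)%:~R + 1) * sigma.
  by rewrite mulNr; apply: le_lt_trans x2; apply: le_trans b1; rewrite lerN2 ltW.
move: h1 h2; rewrite !ltr_pM2r// -!(intrD R _ 1) -[n.+1%:R]/((Posz n.+1)%:~R : R) -rmorphN/= !ltr_int.
lia.
Qed.

Lemma active_seq : exists2 S : seq 'rV[int]_d, uniq S & forall i, (i \in S) <-> active i.
Proof.
have [N _ HN] := finite_active; have [S uS HS] := finite_index_box N.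
exists [seq i <- S | `[< active i >]]; first exact: filter_uniq.
move=> i; rewrite mem_filter; split => [/andP[/asboolP]//|ai].
by apply/andP; split; [exact/asboolP|apply: HS; exact: HN].
Qed.

End domain.

End grid_geometry.

(** * Control of all elements by the domain and the stabilization form *)

Section stability.
Variables (R : realType) (d P K : nat).
Local Notation mu := (lebesgue_rV R d).
Implicit Types (i j : 'rV[int]_d) (sigma : R).

Lemma sum_seq_le (I : eqType) (Y : I -> \bar R) (S T : seq I) : uniq S -> uniq T ->
  (forall t, 0 <= Y t)%E -> (forall t, t \notin T -> Y t = 0%E) ->
  (\sum_(t <- S) Y t <= \sum_(t <- T) Y t)%E.
Proof.
move=> uS uT Y0 YT.
rewrite (bigID (fun t => t \in T))/= [X in (_ + X)%E]big1 ?adde0 => [|t /YT//].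
rewrite -big_filter (perm_big [seq t <- T | t \in S]); last first.
  apply: uniq_perm; rewrite ?filter_uniq// => t; by rewrite !mem_filter andbC.
by rewrite big_filter [leRHS](bigID (fun t => t \in S))/= leeDl// sume_ge0.
Qed.

Definition shift_index (b : {ffun 'I_d -> 'I_(2 * K).+1}) : 'rV[int]_d :=
  \row_l ((b l)%:Z - K%:Z).

Lemma shift_indexP i (q : 'rV[int]_d) : (forall l, (- K%:Z <= q ord0 l - i ord0 l <= K%:Z)%R) ->
  exists b, q = i + shift_index b.
Proof.
move=> iq; exists [ffun l => inord (absz (q ord0 l - i ord0 l + K%:Z)%R)].
apply/rowP => l; rewrite !mxE ffunE inordK; last by have := iq l; lia.
change (q ord0 l = i ord0 l + ((Posz (absz (q ord0 l - i ord0 l + K%:Z)%R)) - K%:Z)).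
by have := iq l; lia.
Qed.

(* The chain inequality is applied along a chain from each cut element to an uncut
   one; an uncut element is used by at most [(2 * K).+1 ^ d] chains. *)
Lemma stability : exists2 C : R, 0 <= C & forall sigma (Omega : set 'rV[R]_d) M (S : seq 'rV[int]_d) s c,
  0 < sigma -> open Omega -> cut_chains sigma Omega M K ->
  uniq S -> (forall i, (i \in S) <-> active sigma Omega i) ->
  (\sum_(i <- S) \int[mu]_(x in element sigma i) (@comb R d P sigma s c x ^+ 2)%:E <=
   C%:E * (\int[mu]_(x in Omega) (@comb R d P sigma s c x ^+ 2)%:E +
     \sum_(i <- [seq i <- S | `[< cut_index sigma Omega M i >]])
     (sigma ^+ (2 * P.+1))%:E * \sum_(e : mindex d P.+1 | mdeg e == P.+1)
      \int[mu]_(x in element sigma i) (partial e (@comb R d P sigma s c) x ^+ 2)%:E))%E.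
Proof.
have [C0 C00 HC0] := @comb_chain R d P.
(* With C >= 1 the powers of 3 C increase, so the K-th power covers chains of every length up to
   [K]. *)
pose C := Num.max C0 1.
have C1 : 1 <= C by rewrite le_max lexx orbT.
have C_0 : 0 <= C by exact: le_trans C1.
pose N := #|{: {ffun 'I_d -> 'I_(2 * K).+1}}|.
exists (1 + (3 * C) ^+ K * N%:R).
  by rewrite addr_ge0// mulr_ge0// exprn_ge0// mulr_ge0.
move=> sigma Omega M S s c s0 oO chains uS SP.
set g := comb sigma s c.
pose a i : \bar R := (\int[mu]_(x in element sigma i) (g x ^+ 2)%:E)%E.
pose J i : \bar R := ((sigma ^+ (2 * P.+1))%:E * \sum_(e : mindex d P.+1 | mdeg e == P.+1)
      \int[mu]_(x in element sigma i) (partial e g x ^+ 2)%:E)%E.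
(* The part of the right-hand side that belongs to element i: the L2 part if it is uncut, the
   stabilization part if it is cut. *)
pose Y i : \bar R := ((if `[< uncut_index sigma Omega M i >] then a i else 0) +
             (if `[< cut_index sigma Omega M i >] then J i else 0))%E.
have a0 i : (0 <= a i)%E by apply: integral_ge0 => x _; rewrite lee_fin sqr_ge0.
have J0 i : (0 <= J i)%E.
  rewrite mule_ge0// ?lee_fin ?exprn_ge0 ?(ltW s0)// sume_ge0// => e _.
  by apply: integral_ge0 => x _; rewrite lee_fin sqr_ge0.
have Y0 i : (0 <= Y i)%E by rewrite adde_ge0//; case: ifP.
(* A chain moves each index by at most 1 per step, so everything it meets, including the final uncut
   neighbour, lies within index distance [K] of i and is counted in T i. *)
pose T i : \bar R := (\sum_b Y (i + shift_index b)%R)%E.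
have T0 i : (0 <= T i)%E by apply: sume_ge0.
have YT i (q : 'rV[int]_d) : (forall l, (- K%:Z <= q ord0 l - i ord0 l <= K%:Z)%R) -> (Y q <= T i)%E.
  move=> /shift_indexP[b ->]; rewrite /T (bigD1 b)//= leeDl// sume_ge0//.
have step i j : neighbors sigma i j -> (a i <= C%:E * (a j + J i))%E.
  move=> ij; apply: le_trans (HC0 sigma s c i j s0 ij) _.
  apply: (@lee_wpmul2r _ (a j + J i)%E); first by apply: adde_ge0; [exact: a0|exact: J0].
  by rewrite lee_fin le_max lexx.
have main i : cut_index sigma Omega M i -> (a i <= ((3 * C) ^+ K)%:E * T i)%E.
  move=> /chains[n [q [nK q0 qcut qn [j [uj qj]]]]].
  have dist l : (l <= n)%N -> forall m, (- l%:Z <= q l ord0 m - i ord0 m <= l%:Z)%R.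
    elim: l => [|l IH] ln m; first by rewrite q0; lia.
    have := neighbors_dist s0 (qn l ln) m; have := IH (ltnW ln) m; lia.
  have Jq l : (l <= n)%N -> (J (q l) <= T i)%E.
    move=> ln; apply: le_trans (YT i (q l) _); last by move=> m; have := dist l ln m; lia.
    by rewrite /Y [`[< cut_index _ _ _ _ >]]asboolT ?leeDr//; [case: ifP|exact: qcut].
  have aj : (a j <= T i)%E.
    apply: le_trans (YT i j _); last first.
      by move=> m; have := dist n (leqnn n) m; have := neighbors_dist s0 qj m; lia.
    by rewrite /Y asboolT// leeDl//; case: ifP.
  (* Induction from the end of the chain back to its start. With p = (3 C)^(m+1) >= 1 a step gives C
     (p + 1) <= 3 C p, which is the reason for the factor 3. *)
  have H m : (m <= n)%N -> (a (q (n - m)%N) <= ((3 * C) ^+ m.+1)%:E * T i)%E.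
    elim: m => [_|m IH mn].
      rewrite subn0 expr1; apply: le_trans (step _ _ qj) _.
      rewrite (mulrC 3 C) EFinM -muleA; apply: lee_wpmul2l; first by rewrite lee_fin.
      apply: (@le_trans _ _ (T i + T i)%E); first by apply: leeD => //; exact: Jq.
      rewrite -{1 2}(mul1e (T i)) -ge0_muleDl ?lee_fin// -EFinD.
      by apply: lee_wpmul2r => //; rewrite lee_fin; lra.
    have qm : neighbors sigma (q (n - m.+1)%N) (q (n - m)%N).
      by rewrite (_ : (n - m = (n - m.+1).+1)%N); [apply: qn|]; lia.
    apply: le_trans (step _ _ qm) _.
    apply: (@le_trans _ _ (C%:E * (((3 * C) ^+ m.+1)%:E * T i + 1%:E * T i))%E).
      apply: lee_wpmul2l; first by rewrite lee_fin.
      apply: leeD; first by apply: IH; exact: ltnW.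
      by rewrite mul1e; apply: Jq; exact: leq_subr.
    have p1 : 1 <= (3 * C) ^+ m.+1 by rewrite exprn_ege1//; lra.
    rewrite -ge0_muleDl ?lee_fin ?(le_trans _ p1)// muleA -EFinD -EFinM lee_wpmul2r//.
    rewrite lee_fin (exprS _ m.+1); move: ((3 * C) ^+ m.+1) p1 => p p1.
    have h : 0 <= C * (2 * p - 1) by apply: mulr_ge0 => //; lra.
    rewrite -subr_ge0; apply: le_trans h _; rewrite le_eqVlt; apply/orP; left; apply/eqP; ring.
  have := H n (leqnn n); rewrite subnn q0 => /le_trans; apply.
  rewrite lee_wpmul2r// lee_fin; apply: ler_weXn2l => //; lra.
(* A fixed shift of the indices is injective and Y vanishes at inactive indices, so the shifted sum
   does not exceed the total. *)
have Ysum b : (\sum_(i <- [seq i <- S | `[< cut_index sigma Omega M i >]]) Y (i + shift_index b)%R <= \sum_(i <- S) Y i)%E.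
  rewrite -(big_map (fun i => i + shift_index b) xpredT Y); apply: sum_seq_le => //.
    by rewrite map_inj_uniq ?filter_uniq//; exact: addIr.
  move=> i iS; rewrite /Y !asboolF ?adde0//.
    by move=> /(cutP _ _ s0)[ai _]; move/negP: iS; apply; exact/SP.
  by move=> /(uncutP _ _ s0)[ai _ _]; move/negP: iS; apply; exact/SP.
have Ytot : (\sum_(i <- S) Y i <= \int[mu]_(x in Omega) (g x ^+ 2)%:E +
     \sum_(i <- [seq i <- S | `[< cut_index sigma Omega M i >]]) J i)%E.
  rewrite big_split/=; apply: leeD; last by rewrite big_filter -big_mkcond.
  rewrite -big_mkcond -big_filter; apply: sum_integral_element_le => //.
  - exact: open_measurable_rV.
  - apply/measurable_EFinP; apply: continuous_measurable_rV; apply: continuous_sqr.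
    by apply: smd_continuous; exact: smd_comb.
  - by move=> x; rewrite lee_fin sqr_ge0.
  - exact: filter_uniq.
  - by move=> i; rewrite mem_filter => /andP[/asboolP/(uncutP _ _ s0)[]].
apply: le_trans (lee_wpmul2l _ Ytot); last by rewrite lee_fin addr_ge0// mulr_ge0// exprn_ge0// mulr_ge0.
have Yt0 : (0 <= \sum_(i <- S) Y i)%E by apply: sume_ge0.
rewrite EFinD ge0_muleDl ?lee_fin ?ler01 ?mulr_ge0 ?exprn_ge0 ?mulr_ge0// mul1e.
rewrite (bigID (fun i => `[< cut_index sigma Omega M i >]))/= addeC; apply: leeD.
  rewrite big_seq_cond [leRHS](bigID (fun i => `[< cut_index sigma Omega M i >]))/= addeC.
  apply: (@le_trans _ _ (\sum_(i <- S | ~~ `[< cut_index sigma Omega M i >]) Y i)%E); last first.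
    by rewrite leeDl// sume_ge0.
  rewrite [leRHS]big_seq_cond; apply: lee_sum => i /andP[/SP ai /asboolPn nci].
  rewrite /Y asboolT ?leeDl//; first by case: ifP.
  by have [] := @active_cut_uncut _ _ _ Omega M s0 _ ai.
rewrite -big_filter.
apply: (@le_trans _ _ (\sum_(i <- [seq i <- S | `[< cut_index sigma Omega M i >]]) ((3 * C) ^+ K)%:E * T i)%E).
  rewrite big_seq_cond [leRHS]big_seq_cond; apply: lee_sum => i; rewrite andbT mem_filter => /andP[/asboolP ci _].
  exact: main.
rewrite -ge0_sume_distrr// EFinM -muleA; apply: lee_wpmul2l; first by rewrite lee_fin exprn_ge0// mulr_ge0.
rewrite exchange_big/=; apply: (@le_trans _ _ (\sum_(b : {ffun 'I_d -> 'I_(2 * K).+1}) \sum_(i <- S) Y i)%E).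
  by apply: lee_sum => b _; exact: Ysum.
rewrite big_const /N.
elim: #|_| => [|n IH]; first by rewrite mul0e.
by rewrite iterS (natrD R 1 n) EFinD ge0_muleDl ?lee_fin// mul1e leeD2l.
Qed.

End stability.

(** * Sobolev norms *)

Section sobolev_norms.
Variables (R : realType) (d : nat).
Local Notation mu := (lebesgue_rV R d).
Implicit Types (f g : 'rV[R]_d -> R) (D : set 'rV[R]_d).

Definition sqint D f : \bar R := (\int[mu]_(x in D) (f x ^+ 2)%:E)%E.

Lemma sqint_ge0 D f : (0 <= sqint D f)%E.
Proof. by apply: integral_ge0 => x _; rewrite lee_fin sqr_ge0. Qed.

Lemma Lp_norm_ge0 D p f : (0 <= Lp_norm D p f)%E.
Proof. exact: Lnorm_ge0. Qed.

Lemma Lp_norm2 D f : (Lp_norm D 2 f `^ 2 = sqint D f)%E.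
Proof.
rewrite /Lp_norm powR_Lnorm ?pnatr_eq0//.
rewrite /sqint [RHS]integral_mkcond; apply: eq_integral => x _ /=.
rewrite !patchE; case: ifP => _ /=.
  by rewrite powR_mulrn// real_normK// num_real.
by rewrite normr0 powR0// pnatr_eq0.
Qed.

Lemma Lp_norm1 D f : (Lp_norm D 1 f `^ 1 = \int[mu]_(x in D) `|f x|%:E)%E.
Proof.
rewrite poweRe1 ?Lp_norm_ge0// /Lp_norm Lnorm1 [RHS]integral_mkcond; apply: eq_integral => x _ /=.
by rewrite !patchE; case: ifP => _ //=; rewrite normr0.
Qed.

Lemma poweR2K (x : \bar R) : (0 <= x)%E -> ((x `^ 2^-1) `^ 2 = x)%E.
Proof. by move=> x0; rewrite -poweRrM mulVf ?pnatr_eq0// poweRe1. Qed.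

Lemma poweR2_le (x y : \bar R) : (0 <= x)%E -> (0 <= y)%E -> (x `^ 2 <= y `^ 2)%E -> (x <= y)%E.
Proof.
move=> x0 y0 xy.
have K (z : \bar R) : (0 <= z)%E -> z = ((z `^ 2) `^ 2^-1)%E.
  by move=> z0; rewrite -poweRrM mulfV ?pnatr_eq0// poweRe1.
rewrite (K x)// (K y)//; apply: gt0_ler_poweR; rewrite ?invr_ge0 ?ler0n//.
- by rewrite in_itv/= poweR_ge0 leey.
- by rewrite in_itv/= poweR_ge0 leey.
Qed.

Lemma sobolev_norm2 D k f :
  (sobolev_norm D k 2 f `^ 2 = \sum_(a : mindex d k | (mdeg a <= k)%N) sqint D (weakD D a f))%E.
Proof.
rewrite /sobolev_norm poweR2K; first by apply: eq_bigr => a _; exact: Lp_norm2.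
by apply: sume_ge0 => a _; exact: poweR_ge0.
Qed.

Lemma sobolev_seminorm2 D k f :
  (sobolev_seminorm D k 2 f `^ 2 = \sum_(a : mindex d k | mdeg a == k) sqint D (weakD D a f))%E.
Proof.
rewrite /sobolev_seminorm poweR2K; first by apply: eq_bigr => a _; exact: Lp_norm2.
by apply: sume_ge0 => a _; exact: poweR_ge0.
Qed.

Lemma sobolev_seminorm1 D k f :
  (sobolev_seminorm D k 1 f = \sum_(a : mindex d k | mdeg a == k) \int[mu]_(x in D) `|weakD D a f x|%:E)%E.
Proof.
rewrite /sobolev_seminorm invr1 poweRe1; first by apply: eq_bigr => a _; exact: Lp_norm1.
by apply: sume_ge0 => a _; exact: poweR_ge0.
Qed.

Lemma sobolev_norm_ge0 D k p f : (0 <= sobolev_norm D k p f)%E.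
Proof. exact: poweR_ge0. Qed.

Lemma eq_sqint D f g : open D -> measurable_fun D f -> measurable_fun D g ->
  {ae mu, forall x, D x -> f x = g x} -> sqint D f = sqint D g.
Proof.
move=> oD mf mg fg; apply: ae_eq_integral.
- exact: open_measurable_rV.
- by apply/measurable_EFinP; apply: measurable_funX.
- by apply/measurable_EFinP; apply: measurable_funX.
- by apply: filterS fg => x fg Dx; rewrite fg.
Qed.

Lemma sqint_weakD D k (a : mindex d k) f g : open D -> weak_derivative D a f g ->
  sqint D (weakD D a f) = sqint D g.
Proof.
move=> oD H; have [_ [mw _] _] := weakDP H; have [_ [mg _] _] := H.
by apply: eq_sqint => //; exact: weakD_ae.
Qed.

Lemma Lp_norm2_lty D f : (Lp_norm D 2 f < +oo)%E <-> (sqint D f < +oo)%E.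
Proof.
rewrite -Lp_norm2; split => [|H]; first exact: poweR_lty.
by apply: (lty_poweRy _ H); rewrite pnatr_eq0.
Qed.

Lemma sobolev_sqint_lty D k f (a : mindex d k) : open D -> sobolev D k 2 f -> (mdeg a <= k)%N ->
  (sqint D (weakD D a f) < +oo)%E.
Proof.
move=> oD sf ak; have [g fg /Lp_norm2_lty] := sf a ak.
by rewrite (sqint_weakD oD fg).
Qed.

Lemma sobolev_norm_fin D k f : open D -> sobolev D k 2 f -> sobolev_norm D k 2 f \is a fin_num.
Proof.
move=> oD sf; rewrite ge0_fin_numE ?sobolev_norm_ge0//.
apply: (@lty_poweRy _ _ 2); first by rewrite pnatr_eq0.
rewrite sobolev_norm2; apply: lte_sum_pinfty => a ak; exact: sobolev_sqint_lty.
Qed.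

Definition mindex0 k : mindex d k := [ffun=> ord0].

Lemma mdeg_mindex0 k : mdeg (mindex0 k) = 0%N.
Proof. by rewrite /mdeg big1// => l _; rewrite ffunE. Qed.

Lemma sobolev_loc_integrable D k f : sobolev D k 2 f -> loc_integrable D f.
Proof. by move=> /(_ (mindex0 k)); rewrite mdeg_mindex0 => /(_ isT)[g [lf _ _] _]. Qed.

Lemma weak_derivative_mindex0 D k f : loc_integrable D f -> weak_derivative D (mindex0 k) f f.
Proof.
move=> lf; rewrite (@weak_derivative_eq _ _ _ _ 0 _ (mindex0 0)); first exact: weak_derivative0.
by move=> l; rewrite !ffunE.
Qed.

Lemma sqint_sobolev_norm D k f : open D -> sobolev D k 2 f ->
  (sqint D f <= sobolev_norm D k 2 f `^ 2)%E.
Proof.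
move=> oD sf; have lf := sobolev_loc_integrable sf.
rewrite -(sqint_weakD oD (weak_derivative_mindex0 k lf)) sobolev_norm2.
rewrite (bigD1 (mindex0 k)) ?mdeg_mindex0//= leeDl// sume_ge0// => a _; exact: sqint_ge0.
Qed.

(** Norms of different orders sum over multi-indices of different types; this embedding compares the
    sums. *)
Definition mwiden k k' (kk' : (k <= k')%N) (a : mindex d k) : mindex d k' :=
  [ffun l => widen_ord (kk' : (k < k'.+1)%N) (a l)].

Lemma mdeg_mwiden k k' (kk' : (k <= k')%N) a : mdeg (mwiden kk' a) = mdeg a.
Proof. by apply: eq_bigr => l _; rewrite ffunE. Qed.

Lemma mwiden_inj k k' (kk' : (k <= k')%N) : injective (mwiden kk').
Proof. by move=> a b /ffunP ab; apply/ffunP => l; apply/val_inj; have := congr1 val (ab l); rewrite !ffunE. Qed.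

Lemma weakD_mwiden D k k' (kk' : (k <= k')%N) (a : mindex d k) f :
  weakD D (mwiden kk' a) f = weakD D a f.
Proof.
rewrite /weakD; congr get; apply/funext => g; apply: weak_derivative_eq => l.
by rewrite ffunE.
Qed.

Lemma sobolevW D k k' p f : (k <= k')%N -> sobolev D k' p f -> sobolev D k p f.
Proof.
move=> kk' sf a ak; have [|g fg fin] := sf (mwiden kk' a); first by rewrite mdeg_mwiden (leq_trans ak).
exists g => //; rewrite -(@weak_derivative_eq _ _ D k' k (mwiden kk' a))// => l.
by rewrite ffunE.
Qed.

Lemma sume_le_inj (S T : finType) (h : S -> T) (Q : pred S) (Q' : pred T) (F : T -> \bar R) :
  injective h -> (forall t, Q t -> Q' (h t)) -> (forall t, 0 <= F t)%E ->
  (\sum_(t | Q t) F (h t) <= \sum_(t | Q' t) F t)%E.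
Proof.
move=> hI QQ' F0.
rewrite -big_filter -[leRHS]big_filter -(big_map h xpredT F).
pose G t := if Q' t then F t else 0%E.
have GE (s : seq T) : (forall t, t \in s -> Q' t) -> (\sum_(t <- s) F t = \sum_(t <- s) G t)%E.
  by move=> sQ; rewrite big_seq [RHS]big_seq; apply: eq_bigr => t ts; rewrite /G sQ.
rewrite GE; last first.
  by move=> t /mapP[t' + ->]; rewrite mem_filter => /andP[/QQ'].
rewrite [leRHS]GE; last by move=> t; rewrite mem_filter => /andP[].
apply: sum_seq_le.
- by rewrite map_inj_uniq// filter_uniq// index_enum_uniq.
- by rewrite filter_uniq// index_enum_uniq.
- by move=> t; rewrite /G; case: ifP.
- by move=> t; rewrite mem_filter mem_index_enum andbT /G => /negbTE ->.
Qed.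

Lemma sobolev_norm_le D k k' f : (k <= k')%N -> (sobolev_norm D k 2 f <= sobolev_norm D k' 2 f)%E.
Proof.
move=> kk'; apply: poweR2_le; rewrite ?sobolev_norm_ge0// !sobolev_norm2.
under eq_bigr do rewrite -(weakD_mwiden D kk').
apply: (@sume_le_inj _ _ (mwiden kk') _ _ (fun a => sqint D (weakD D a f))).
- exact: mwiden_inj.
- by move=> a ak; rewrite mdeg_mwiden (leq_trans ak).
- by move=> a; exact: sqint_ge0.
Qed.

Lemma sobolev_seminorm_le D k f : (sobolev_seminorm D k 2 f <= sobolev_norm D k 2 f)%E.
Proof.
apply: poweR2_le; rewrite ?sobolev_norm_ge0//; first exact: poweR_ge0.
rewrite sobolev_norm2 sobolev_seminorm2.
apply: (@sume_le_inj _ _ id _ _ (fun a => sqint D (weakD D a f))) => // [a /eqP->//|a].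
exact: sqint_ge0.
Qed.

Lemma loc_integrable_congr D f f' : measurable D -> (forall x, D x -> f x = f' x) ->
  loc_integrable D f -> loc_integrable D f'.
Proof.
move=> mD ff' [mf fi]; split.
  by apply: eq_measurable_fun mf => x; rewrite inE => /ff'.
move=> C cC CD; have mC := compact_measurable_rV cC.
apply: eq_integrable (fi C cC CD) => // x; rewrite inE => /CD Dx /=.
by rewrite ff'.
Qed.

Lemma weak_derivative_congr D k (a : mindex d k) f f' g g' : open D ->
  (forall x, D x -> f x = f' x) -> (forall x, D x -> g x = g' x) ->
  weak_derivative D a f g -> weak_derivative D a f' g'.
Proof.
move=> oD ff' gg' [lf lg H]; have mD := open_measurable_rV oD.
split; [exact: loc_integrable_congr lf|exact: loc_integrable_congr lg|move=> psi tp].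
have := H psi tp.
rewrite (@eq_Rintegral _ _ _ mu D (fun x => f' x * partial a psi x)); last first.
  by move=> x; rewrite inE => Dx; rewrite ff'.
rewrite [in X in _ = X -> _](@eq_Rintegral _ _ _ mu D (fun x => g' x * psi x)); first exact.
by move=> x; rewrite inE => Dx; rewrite gg'.
Qed.

End sobolev_norms.

Lemma lebesgue_element (R : realType) d (sigma : R) i : 0 < sigma ->
  lebesgue_rV R d (element sigma i) = (sigma ^+ d)%:E.
Proof.
move=> s0; rewrite elementE lebesgue_prod_set//.
rewrite (eq_bigr (fun=> sigma%:E)) => [|l _].
  by rewrite prodEFin big_const cardT size_enum_ord iter_mulr mulr1.
rewrite lebesgue_measure_itv/= lte_fin ltr_pM2r// ltrDl ltr01 -EFinB; congr EFin; ring.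
Qed.

(** Young's inequality for X Y with the weight t sigma^(n1 - n2), which balances the two powers of
    sigma and leaves [t] free. *)
Lemma inverse_young (R : realType) (sigma t C A B X Y w : R) n1 n2 : 0 < sigma -> 0 < t -> 0 <= C ->
  0 <= A -> 0 <= B -> 0 <= w ->
  X ^+ 2 <= C * sigma ^- (2 * n1) * w * A -> Y ^+ 2 <= C * sigma ^- (2 * n2) * w * B ->
  `|X * Y| <= C * sigma ^- (n1 + n2) * w * (t * A + t^-1 * B).
Proof.
move=> s0 t0 C0 A0 B0 w0 hX hY.
have u0 : 0 < sigma ^- n1 by rewrite invr_gt0 exprn_gt0.
have v0 : 0 < sigma ^- n2 by rewrite invr_gt0 exprn_gt0.
move: hX hY; rewrite !(mulnC 2) !exprM -!exprVn !(exprVn sigma) exprD invfM.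
move: (sigma ^- n1) (sigma ^- n2) u0 v0 => u v u0 v0 hX hY.
pose r := t * v / u.
have r0 : 0 < r by rewrite !mulr_gt0// invr_gt0.
have : 2 * `|X * Y| <= r * X ^+ 2 + r^-1 * Y ^+ 2.
  have := sqr_ge0 (r * `|X| - `|Y|); rewrite normrM -(real_normK (num_real X)) -(real_normK (num_real Y)).
  move: `|X| `|Y| => a b h.
  have e : r * a ^+ 2 + r^-1 * b ^+ 2 - 2 * (a * b) = r^-1 * (r * a - b) ^+ 2.
    field; exact: lt0r_neq0.
  by rewrite -subr_ge0 e mulr_ge0// invr_ge0 ltW.
have h1 : r * X ^+ 2 <= C * (u * v) * w * (t * A).
  apply: le_trans (ler_wpM2l (ltW r0) hX) _; rewrite le_eqVlt; apply/orP; left; apply/eqP.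
  by rewrite /r; field; exact: lt0r_neq0.
have h2 : r^-1 * Y ^+ 2 <= C * (u * v) * w * (t^-1 * B).
  apply: le_trans (ler_wpM2l _ hY) _; first by rewrite invr_ge0 ltW.
  rewrite le_eqVlt; apply/orP; left; apply/eqP.
  by rewrite /r; field; rewrite !lt0r_neq0.
rewrite mulrDr; have := normr_ge0 (X * Y); lra.
Qed.

Lemma sume_cst (R : realType) (I : finType) (p : pred I) (x : \bar R) : (0 <= x)%E ->
  (\sum_(i | p i) x = (\sum_(i | p i) (1 : R))%:E * x)%E.
Proof.
move=> x0; rewrite -sumEFin ge0_sume_distrl; last by move=> i _; rewrite lee_fin.
by apply: eq_bigr => i _; rewrite mul1e.
Qed.

Lemma continuous_normr (R : realType) (T : topologicalType) (f : T -> R) :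
  continuous f -> continuous (fun x => `|f x|).
Proof. by move=> cf x; apply: (continuous_comp (cf x)); exact: norm_continuous. Qed.

(** * Sobolev norms of truncated trial functions *)

Section trial_functions.
Variables (R : realType) (d : nat).
Local Notation mu := (lebesgue_rV R d).
Implicit Types (f g : 'rV[R]_d -> R) (D F : set 'rV[R]_d).

Lemma integrable_coord_bounded D f : measurable D -> coord_bounded D -> continuous f ->
  mu.-integrable D (EFin \o f).
Proof.
move=> mD [B HB] cf; have mC := @measurable_cube R d B; have cC := @compact_cube R d B.
have [_ fi] := @continuous_loc_integrable R d setT _ cf.
apply: (integrableS mC mD); last by apply: fi => //; exact: cC.
by move=> x Dx; apply/cubeE; exact: HB.
Qed.

Lemma EFin_Rintegral D f : measurable D -> coord_bounded D -> continuous f ->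
  (\int[mu]_(x in D) (f x)%:E)%E = (\int[mu]_(x in D) f x)%:E.
Proof.
move=> mD bD cf; rewrite /Rintegral fineK//; apply: integrable_fin_num => //.
exact: integrable_coord_bounded.
Qed.

Lemma sqint_fin_num D f : measurable D -> coord_bounded D -> continuous f ->
  sqint D f \is a fin_num.
Proof.
move=> mD bD cf; rewrite /sqint EFin_Rintegral//; exact: continuous_sqr.
Qed.

Lemma coord_bounded_element sigma i : coord_bounded (element sigma i : set 'rV[R]_d).
Proof.
pose B l := `|(i ord0 l)%:~R * sigma| + `|((i ord0 l)%:~R + 1) * sigma|.
exists (\sum_l B l) => x xi l; apply: (@le_trans _ _ (B l)); last first.
  by rewrite (bigD1 l)//= lerDl sumr_ge0// => k _; rewrite addr_ge0.
have /andP[h1 h2] := xi l; rewrite /B ler_norml; apply/andP; split.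
  rewrite opprD; apply: le_trans (ltW h1).
  by rewrite -[leRHS]addr0 lerD ?oppr_le0// lerNl ler_normr lexx orbT.
by apply: le_trans (ltW h2) _; rewrite -[leLHS]add0r lerD// ler_norm.
Qed.

(** On an open subset [D] of [F] the truncation to [F] is not seen, so the weak derivative there is
    the classical one. *)
Lemma weak_derivative_patch D F k (a : mindex d k) g : open D -> D `<=` F -> smd g ->
  weak_derivative D a (g \_ F) (partial a g).
Proof.
move=> oD DF sg; apply: weak_derivative_congr (weak_derivative_smd D a sg) => // x Dx.
by rewrite patchE mem_set//; exact: DF.
Qed.

Lemma sobolev_patch2 D F k g : open D -> coord_bounded D -> D `<=` F -> smd g ->
  sobolev D k 2 (g \_ F).
Proof.
move=> oD bD DF sg a ak; exists (partial a g); first exact: weak_derivative_patch.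
apply/Lp_norm2_lty; have : sqint D (partial a g) \is a fin_num.
  apply: sqint_fin_num => //; first exact: open_measurable_rV.
  by apply: smd_continuous; exact: smd_iter_partial.
by rewrite ge0_fin_numE// sqint_ge0.
Qed.

Lemma sobolev_patch1 D F k g : open D -> coord_bounded D -> D `<=` F -> smd g ->
  sobolev D k 1 (g \_ F).
Proof.
move=> oD bD DF sg a ak; exists (partial a g); first exact: weak_derivative_patch.
have cg : continuous (fun x => `|partial a g x|).
  by apply: continuous_normr; apply: smd_continuous; exact: smd_iter_partial.
rewrite -[Lp_norm _ _ _](@poweRe1 R) ?Lp_norm_ge0// Lp_norm1 EFin_Rintegral ?ltry//.
exact: open_measurable_rV.
Qed.

Lemma sobolev_norm2_patch D F k g : open D -> D `<=` F -> smd g ->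
  (sobolev_norm D k 2 (g \_ F) `^ 2 = \sum_(a : mindex d k | (mdeg a <= k)%N) sqint D (partial a g))%E.
Proof.
move=> oD DF sg; rewrite sobolev_norm2; apply: eq_bigr => a _.
by apply: sqint_weakD => //; exact: weak_derivative_patch.
Qed.

Lemma sobolev_seminorm1_patch D F k g : open D -> D `<=` F -> smd g ->
  (sobolev_seminorm D k 1 (g \_ F) =
   \sum_(a : mindex d k | mdeg a == k) \int[mu]_(x in D) `|partial a g x|%:E)%E.
Proof.
move=> oD DF sg; rewrite sobolev_seminorm1; apply: eq_bigr => a _.
have H := weak_derivative_patch a oD DF sg.
have [_ [mw _] _] := weakDP H; have [_ [mg _] _] := H.
apply: ae_eq_integral.
- exact: open_measurable_rV.
- by apply/measurable_EFinP; exact: measurableT_comp mw.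
- by apply/measurable_EFinP; exact: measurableT_comp mg.
- by apply: filterS (weakD_ae oD H) => x /= fg Dx; rewrite fg.
Qed.

(** N(g)^2 of the overview as an extended real, usable also for functions whose integrals are not
    yet known to be finite; [nsq] is its real version. *)
Definition esqint sigma (S : seq 'rV[int]_d) f := (\sum_(i <- S) sqint (element sigma i) f)%E.

Lemma esqint_ge0 sigma S f : (0 <= esqint sigma S f)%E.
Proof. by apply: sume_ge0 => i _; exact: sqint_ge0. Qed.

Section inverse.
Variable (P : nat).
Local Notation comb := (@comb R d P).

Lemma comb_inverse_le k : exists2 C, 0 <= C & forall sigma s c j t x, 0 < sigma -> (size t <= k)%N ->
  element sigma j x ->
  ((iter_partial t (comb sigma s c) x ^+ 2)%:E <= (C * sigma ^- (2 * size t) * sigma ^- d)%:E *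
    sqint (element sigma j) (comb sigma s c))%E.
Proof.
have /choice[C HC] : forall n, exists C, 0 <= C /\ forall sigma s c j t x, 0 < sigma -> size t = n ->
  element sigma j x ->
  ((iter_partial t (comb sigma s c) x ^+ 2)%:E <= (C * sigma ^- (2 * n) * sigma ^- d)%:E *
    sqint (element sigma j) (comb sigma s c))%E.
  by move=> n; have [C C0 HC] := @comb_inverse R d P n; exists C.
exists (\sum_(n < k.+1) C n); first by apply: sumr_ge0 => n _; have [] := HC n.
move=> sigma s c j t x s0 tk xj; have [_ H] := HC (size t).
apply: le_trans (H sigma s c j t x s0 erefl xj) _.
apply: lee_wpmul2r; first exact: sqint_ge0.
have tk' : (size t < k.+1)%N by [].
rewrite lee_fin !ler_wpM2r// ?invr_ge0 ?exprn_ge0 ?(ltW s0)//.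
rewrite (bigD1 (Ordinal tk'))//= lerDl sumr_ge0// => n _; have [] := HC n => //.
Qed.

(** Inverse estimates on each element of a cover of [D]. The assumption sigma <= 1 lets sigma^(-2k)
    stand for the smaller powers that belong to lower derivatives. *)
Lemma comb_norm_bound k : exists2 C, 0 <= C & forall sigma s c (D F : set 'rV[R]_d) S,
  0 < sigma <= 1 -> open D -> D `<=` F ->
  (forall x, D x -> ~ grid_lines sigma x -> exists2 i, i \in S & element sigma i x) ->
  (sobolev_norm D k 2 (comb sigma s c \_ F) `^ 2 <=
   (C * sigma ^- (2 * k))%:E * esqint sigma S (comb sigma s c))%E.
Proof.
have [C C0 HC] := comb_inverse_le k.
pose N := (\sum_(a : mindex d k | (mdeg a <= k)%N) (1 : R)).
exists (N * C); first by apply: mulr_ge0 => //; exact: sumr_ge0.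
move=> sigma s c D F S /andP[s0 s1] oD DF cov; set g := comb sigma s c.
have sg : smd g by exact: smd_comb.
rewrite sobolev_norm2_patch//.
have s2 n : 0 <= sigma ^- n by rewrite invr_ge0 exprn_ge0// ltW.
apply: (@le_trans _ _ (\sum_(a : mindex d k | (mdeg a <= k)%N)
    ((C * sigma ^- (2 * k))%:E * esqint sigma S g))%E); last first.
  rewrite sume_cst ?mule_ge0 ?esqint_ge0 ?lee_fin ?mulr_ge0//.
  by rewrite muleA -EFinM !mulrA.
apply: lee_sum => a ak.
have ct : continuous (partial a g) by apply: smd_continuous; exact: smd_iter_partial.
apply: (@le_trans _ _ (\sum_(i <- S) sqint (element sigma i) (partial a g))%E).
  apply: integral_le_cover => //; first exact: open_measurable_rV.
    by apply/measurable_EFinP; apply: continuous_measurable_rV; exact: continuous_sqr.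
  by move=> x; rewrite lee_fin sqr_ge0.
rewrite /esqint ge0_sume_distrr; last by move=> i _; exact: sqint_ge0.
apply: lee_sum => i _.
apply: (@le_trans _ _ (\int[mu]_(x in element sigma i)
  ((C * sigma ^- (2 * k) * sigma ^- d)%:E * sqint (element sigma i) g))%E).
  apply: ge0_le_integral.
  - exact: measurable_element.
  - by move=> x _; rewrite lee_fin sqr_ge0.
  - by apply/measurable_EFinP; apply: continuous_measurable_rV; exact: continuous_sqr.
  - exact: measurable_cst.
  - move=> x xi.
    have := HC sigma s c i (flatten [seq nseq (a l) l | l <- enum 'I_d]) x s0.
    rewrite size_mindex_seq => /(_ ak xi) /le_trans; apply.
    apply: lee_wpmul2r; first exact: sqint_ge0.
    rewrite lee_fin ler_wpM2r// ler_wpM2l// lef_pV2 ?posrE ?exprn_gt0//.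
    by rewrite ler_wiXn2l ?leq_mul// ltW.
rewrite integral_cst; last exact: measurable_element.
rewrite lebesgue_element// muleAC -EFinM.
by rewrite divfK// expf_neq0// gt_eqF.
Qed.

(** Leibniz' rule gives 2^k products whose orders add up to k, so each of them costs exactly
    sigma^-k after the two inverse estimates. *)
Lemma comb_product_bound k : exists2 C, 0 <= C & forall sigma s c s' c' (D F : set 'rV[R]_d) S t,
  0 < sigma -> 0 < t -> open D -> D `<=` F ->
  (forall x, D x -> ~ grid_lines sigma x -> exists2 i, i \in S & element sigma i x) ->
  (sobolev_seminorm D k 1 ((fun x => comb sigma s c x * comb sigma s' c' x)%R \_ F) <=
   (C * sigma ^- k)%:E * (t%:E * esqint sigma S (comb sigma s c) +
      t^-1%:E * esqint sigma S (comb sigma s' c')))%E.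
Proof.
have [C C0 HC] := comb_inverse_le k.
pose N := (\sum_(a : mindex d k | (mdeg a == k)%N) (1 : R)).
exists (N * ((2 ^ k)%:R * C)); first by rewrite !mulr_ge0//; exact: sumr_ge0.
move=> sigma s c s' c' D F S t s0 t0 oD DF cov.
set g := comb sigma s c; set g' := comb sigma s' c'.
have sg : smd g by exact: smd_comb.
have sg' : smd g' by exact: smd_comb.
have s2 n : 0 <= sigma ^- n by rewrite invr_ge0 exprn_ge0// ltW.
set B := (t%:E * esqint sigma S g + t^-1%:E * esqint sigma S g')%E.
have B0 : (0 <= B)%E by rewrite adde_ge0// mule_ge0 ?esqint_ge0 ?lee_fin ?invr_ge0 ?(ltW t0).
have sgg : smd (fun x => g x * g' x) by exact: smd_mul.
rewrite sobolev_seminorm1_patch//.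
apply: (@le_trans _ _ (\sum_(a : mindex d k | (mdeg a == k)%N)
    (((2 ^ k)%:R * C * sigma ^- k)%:E * B))%E); last first.
  rewrite sume_cst ?mule_ge0 ?esqint_ge0 ?lee_fin ?mulr_ge0//.
  by rewrite muleA -EFinM !mulrA.
apply: lee_sum => a /eqP ak.
have cp p f : smd f -> continuous (iter_partial p f).
  by move=> sf; apply: smd_continuous; exact: smd_iter_partial.
apply: (@le_trans _ _ (\sum_(i <- S) \int[mu]_(x in element sigma i) `|partial a (fun x => (g x * g' x)%R) x|%:E)%E).
  apply: integral_le_cover => //; first exact: open_measurable_rV.
  apply/measurable_EFinP; apply: continuous_measurable_rV.
  by apply: continuous_normr; exact: cp.
pose A i f : R := \int[mu]_(x in element sigma i) (f x ^+ 2).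
have AE i f : smd f -> sqint (element sigma i) f = (A i f)%:E.
  move=> sf; apply: EFin_Rintegral; [exact: measurable_element|exact: coord_bounded_element|].
  by apply: continuous_sqr; exact: smd_continuous.
have A0 i f : 0 <= A i f by apply: Rintegral_ge0 => x _; rewrite sqr_ge0.
have -> : B = (\sum_(i <- S) (t * A i g + t^-1 * A i g')%:E)%E.
  rewrite /B /esqint !ge0_sume_distrr; try by move=> i _; exact: sqint_ge0.
  by rewrite -big_split/=; apply: eq_bigr => i _; rewrite !AE// EFinD !EFinM.
rewrite ge0_sume_distrr; last first.
  by move=> i _; rewrite lee_fin addr_ge0// mulr_ge0// ?invr_ge0 ltW.
apply: lee_sum => i _.
apply: (@le_trans _ _ (\int[mu]_(x in element sigma i)
  ((2 ^ k)%:R * C * sigma ^- k * sigma ^- d * (t * A i g + t^-1 * A i g'))%:E)%E).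
  apply: ge0_le_integral.
  - exact: measurable_element.
  - by move=> x _; rewrite lee_fin.
  - apply/measurable_EFinP; apply: continuous_measurable_rV.
    by apply: continuous_normr; exact: cp.
  - exact: measurable_cst.
  - move=> x xi; rewrite lee_fin /partial; set q := flatten _.
    have qk : size q = k by rewrite size_mindex_seq.
    rewrite iter_partial_mul//; apply: le_trans (ler_norm_sum _ _ _) _.
    have -> : (2 ^ k)%:R * C * sigma ^- k * sigma ^- d * (t * A i g + t^-1 * A i g') =
      \sum_(p <- splits q) C * sigma ^- k * sigma ^- d * (t * A i g + t^-1 * A i g').
      rewrite big_const_seq count_predT size_splits qk iter_addr_0 -mulr_natl; ring.
    rewrite big_seq [leRHS]big_seq; apply: ler_sum => p pq.
    have := splits_size pq; rewrite qk => pk.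
    have := HC sigma s c i p.1 x s0 _ xi; rewrite -/g AE// -EFinM lee_fin.
    move=> /(_ (leq_trans (leq_addr _ _) (eq_leq pk))) h1.
    have := HC sigma s' c' i p.2 x s0 _ xi; rewrite -/g' AE// -EFinM lee_fin.
    move=> /(_ (leq_trans (leq_addl _ _) (eq_leq pk))) h2.
    by rewrite -pk; apply: inverse_young.
rewrite integral_cst; last exact: measurable_element.
rewrite lebesgue_element// -!EFinM lee_fin.
rewrite le_eqVlt; apply/orP; left; apply/eqP.
have : sigma ^- d * sigma ^+ d = 1 by rewrite mulVf// expf_neq0// gt_eqF.
move: (sigma ^- d) (sigma ^+ d) (sigma ^- k) => u v w uv.
rewrite -[RHS]mulr1 -uv; ring.
Qed.

End inverse.
End trial_functions.

(** * Square-integrable functions and the dual norm *)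

Section L2_tools.
Variables (R : realType) (d : nat).
Local Notation mu := (lebesgue_rV R d).
Implicit Types (f g : 'rV[R]_d -> R) (D F : set 'rV[R]_d).

Definition L2fun D f := measurable_fun D f /\ (sqint D f < +oo)%E.

Lemma L2fun_sobolev D k f : open D -> sobolev D k 2 f -> L2fun D f.
Proof.
move=> oD sf; split; first by have [] := sobolev_loc_integrable sf.
apply: le_lt_trans (sqint_sobolev_norm oD sf) _; apply: poweR_lty.
by rewrite -ge0_fin_numE ?sobolev_norm_ge0// sobolev_norm_fin.
Qed.

Lemma integrable_sqr D f : L2fun D f -> mu.-integrable D (EFin \o (fun x => f x ^+ 2)).
Proof.
move=> [mf ff]; apply/integrableP; split; first by apply/measurable_EFinP; exact: measurable_funX.
apply: le_lt_trans ff; rewrite le_eqVlt; apply/orP; left; apply/eqP.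
by apply: eq_integral => x _ /=; rewrite ger0_norm// sqr_ge0.
Qed.

Lemma sqintE D f : L2fun D f -> sqint D f = (\int[mu]_(x in D) (f x ^+ 2))%:E.
Proof. by move=> [_ ff]; rewrite /Rintegral fineK// ge0_fin_numE// sqint_ge0. Qed.

Lemma L2fun_continuous D f : measurable D -> coord_bounded D -> continuous f -> L2fun D f.
Proof.
move=> mD bD cf; split; first exact: continuous_measurable_rV.
have := sqint_fin_num mD bD cf; by rewrite ge0_fin_numE// sqint_ge0.
Qed.

Lemma sqint_le D D' f : measurable D -> measurable D' -> D `<=` D' -> measurable_fun D' f ->
  (sqint D f <= sqint D' f)%E.
Proof.
move=> mD mD' DD' mf; apply: ge0_subset_integral => //.
- by apply/measurable_EFinP; exact: measurable_funX.
- by move=> x _; rewrite lee_fin sqr_ge0.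
Qed.

Lemma sqint_lin_le D f g c : measurable D -> measurable_fun D f -> measurable_fun D g ->
  (sqint D (fun x => f x + c * g x)%R <= 2%:E * (sqint D f + (c ^+ 2)%:E * sqint D g))%E.
Proof.
move=> mD mf mg.
have mf2 : measurable_fun D (fun x => (f x ^+ 2)%:E).
  by apply/measurable_EFinP; exact: measurable_funX.
have mg2 : measurable_fun D (fun x => (g x ^+ 2)%:E).
  by apply/measurable_EFinP; exact: measurable_funX.
have sq0 h x : (0 <= ((h x : R) ^+ 2)%:E)%E by rewrite lee_fin sqr_ge0.
rewrite /sqint.
have -> : ((c ^+ 2)%:E * \int[mu]_(x in D) (g x ^+ 2)%:E = \int[mu]_(x in D) ((c ^+ 2)%:E * (g x ^+ 2)%:E))%E.
  by rewrite ge0_integralZl// lee_fin sqr_ge0.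
rewrite -ge0_integralD//; last 2 first.
- by move=> x _; rewrite mule_ge0// ?sq0// lee_fin sqr_ge0.
- by apply: measurable_funeM.
rewrite -ge0_integralZl//; last 2 first.
- apply: emeasurable_funD => //; exact: measurable_funeM.
- by move=> x _; rewrite adde_ge0 ?sq0// mule_ge0// ?sq0// lee_fin sqr_ge0.
apply: ge0_le_integral => //.
- by apply/measurable_EFinP; apply: measurable_funX; apply: measurable_funD => //; exact: measurable_funM.
- apply: measurable_funeM; apply: emeasurable_funD => //; exact: measurable_funeM.
- move=> x _; change (((f x + c * g x) ^+ 2)%:E <= (2 * (f x ^+ 2 + c ^+ 2 * g x ^+ 2))%:E)%E; rewrite lee_fin.
  have := sqr_ge0 (f x - c * g x); nra.
Qed.

Lemma L2fun_lin D f g c : measurable D -> L2fun D f -> L2fun D g -> L2fun D (fun x => f x + c * g x).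
Proof.
move=> mD [mf ff] [mg fg]; split; first by apply: measurable_funD => //; exact: measurable_funM.
apply: le_lt_trans (sqint_lin_le c mD mf mg) _.
rewrite -ge0_fin_numE; last by rewrite mule_ge0// adde_ge0// ?sqint_ge0// mule_ge0// ?sqint_ge0// lee_fin sqr_ge0.
by rewrite fin_numM// fin_numD fin_numM// ge0_fin_numE ?sqint_ge0// ff.
Qed.

Lemma integrable_L2 D f g : measurable D -> L2fun D f -> L2fun D g ->
  mu.-integrable D (EFin \o (fun x => f x * g x)).
Proof.
move=> mD Lf Lg; have [mf _] := Lf; have [mg _] := Lg.
apply: (le_integrable mD _ _ (integrableD mD (integrable_sqr Lf) (integrable_sqr Lg))).
  by apply/measurable_EFinP; exact: measurable_funM.
move=> x _ /=; rewrite lee_fin [leRHS]ger0_norm ?addr_ge0 ?sqr_ge0//.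
have := sqr_ge0 (f x - g x); have := sqr_ge0 (f x + g x).
have := sqr_ge0 (f x); have := sqr_ge0 (g x); rewrite ler_norml; nra.
Qed.

Definition sq D f : R := \int[mu]_(x in D) (f x ^+ 2).

Lemma sq_ge0 D f : 0 <= sq D f.
Proof. by apply: Rintegral_ge0 => x _; rewrite sqr_ge0. Qed.

Lemma young_L2 D f g t : measurable D -> 0 < t -> L2fun D f -> L2fun D g ->
  `|\int[mu]_(x in D) (f x * g x)| <= t * sq D f + t^-1 * sq D g.
Proof.
move=> mD t0 Lf Lg; have fi := integrable_L2 mD Lf Lg.
apply: le_trans (le_normr_Rintegral mD fi) _.
have i1 : mu.-integrable D (EFin \o (fun x => t * f x ^+ 2)).
  have := integrableZl mD t (integrable_sqr Lf); by apply: eq_integrable.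
have i2 : mu.-integrable D (EFin \o (fun x => t^-1 * g x ^+ 2)).
  have := integrableZl mD t^-1 (integrable_sqr Lg); by apply: eq_integrable.
rewrite /sq -RintegralZl//; last exact: integrable_sqr.
have -> : t^-1 * \int[mu]_(x in D) (g x ^+ 2) = \int[mu]_(x in D) (t^-1 * g x ^+ 2).
  by rewrite RintegralZl//; exact: integrable_sqr.
rewrite -RintegralD//; apply: le_Rintegral => //.
- have := integrable_abse fi; apply: eq_integrable => // x _.
- have := integrableD mD i1 i2; apply: eq_integrable => // x _.
move=> x _; rewrite normrM -(real_normK (num_real (f x))) -(real_normK (num_real (g x))).
move: `|f x| `|g x| (normr_ge0 (f x)) (normr_ge0 (g x)) => a b a0 b0.
have e : t * a ^+ 2 + t^-1 * b ^+ 2 - 2 * (a * b) = t^-1 * (t * a - b) ^+ 2.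
  field; exact: lt0r_neq0.
have : 0 <= t^-1 * (t * a - b) ^+ 2 by rewrite mulr_ge0 ?sqr_ge0// invr_ge0 ltW.
have : 0 <= a * b by rewrite mulr_ge0.
rewrite -e; lra.
Qed.

Lemma sobolev_norm2_patchZ D F k g c : open D -> D `<=` F -> smd g ->
  (sobolev_norm D k 2 ((fun x => c * g x) \_ F)%R `^ 2 = (c ^+ 2)%:E * sobolev_norm D k 2 (g \_ F) `^ 2)%E.
Proof.
move=> oD DF sg; have sc : smd (fun x => c * g x) by apply: smd_mul => //; exact: smd_cst.
rewrite !sobolev_norm2_patch// ge0_sume_distrr; last by move=> a _; exact: sqint_ge0.
apply: eq_bigr => a _; rewrite /sqint -ge0_integralZl ?lee_fin ?sqr_ge0//; last 3 first.
- exact: open_measurable_rV.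
- apply/measurable_EFinP; apply: measurable_funX; apply: continuous_measurable_rV.
  by apply: smd_continuous; exact: smd_iter_partial.
- by move=> x _; rewrite lee_fin sqr_ge0.
by apply: eq_integral => x _; rewrite /partial iter_partial_scale// exprMn EFinM.
Qed.

(** The dual norm is a supremum over the unit ball, so the bound is applied to g divided by [b]. *)
Lemma dual_bound D F k (T : ('rV[R]_d -> R) -> R) u (B b : R) g :
  open D -> coord_bounded D -> D `<=` F -> sobolev_dual D k T -> L2fun D u ->
  (sobolev_dual_norm D k (fun v => T v - L2_functional D u v)%R <= B%:E)%E ->
  smd g -> 0 < b -> (sobolev_norm D k 2 (g \_ F) <= b%:E)%E ->
  `|T (g \_ F) - \int[mu]_(x in D) (u x * g x)| <= B * b.
Proof.
move=> oD bD DF [Tlin _] Lu HT sg b0 gb.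
have mD := open_measurable_rV oD.
have sb : smd (fun x => b^-1 * g x) by apply: smd_mul => //; exact: smd_cst.
have TZ : T ((fun x => b^-1 * g x) \_ F) = b^-1 * T (g \_ F).
  have s0 : sobolev D k 2 ((fun=> 0 : R) \_ F) by apply: sobolev_patch2 => //; exact: smd_cst.
  have z : sobolev D k 2 (fun=> 0 : R).
    by move: s0; congr sobolev; apply/funext => x; rewrite patchE; case: ifP.
  (* Linearity is given for c f + g, so homogeneity needs T 0 = 0, which is the case c = 1, f = g =
     0. *)
  have := Tlin 1 _ _ z z; rewrite (_ : (fun x : 'rV[R]_d => 1 * 0 + 0) = (fun=> 0 : R)).
    rewrite mul1r => /eqP; rewrite -subr_eq0 opprD addrA subrr sub0r oppr_eq0 => /eqP T0.
    have := Tlin b^-1 _ _ (sobolev_patch2 (k := k) oD bD DF sg) z.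
    rewrite T0 addr0 => <-; congr T; apply/funext => x.
    by rewrite addr0 !patchE; case: ifP => //; rewrite mulr0.
  by apply/funext => x; rewrite mulr0 addr0.
have H := le_trans (ereal_sup_ubound _) HT.
have : (`|T ((fun x => b^-1 * g x) \_ F) - L2_functional D u ((fun x => b^-1 * g x) \_ F)|%:E <= B%:E)%E.
  apply: H; exists ((fun x => b^-1 * g x) \_ F) => //; split; first exact: sobolev_patch2.
  apply: poweR2_le; rewrite ?sobolev_norm_ge0// sobolev_norm2_patchZ//.
  have : (sobolev_norm D k 2 (g \_ F) `^ 2 <= b%:E `^ 2)%E.
    by apply: gt0_ler_poweR => //; rewrite in_itv/= leey ?sobolev_norm_ge0// lee_fin ltW.
  rewrite poweR_EFin powR_mulrn ?(ltW b0)// => h.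
  apply: le_trans (lee_wpmul2l _ h) _; first by rewrite lee_fin sqr_ge0.
  rewrite -EFinM -exprMn mulVf ?gt_eqF// expr1n poweR1r//.
rewrite TZ /L2_functional.
have Lg : L2fun D g by apply: L2fun_continuous => //; exact: smd_continuous.
rewrite (_ : \int[mu]_(x in D) _ = b^-1 * \int[mu]_(x in D) (u x * g x)); last first.
  rewrite -RintegralZl//; last exact: integrable_L2.
  by apply: eq_Rintegral => x Dx; rewrite patchE mem_set; [ring|apply: DF; exact: set_mem].
rewrite lee_fin -mulrBr normrM (ger0_norm (_ : 0 <= b^-1)) ?invr_ge0 ?(ltW b0)//.
by rewrite ler_pdivrMl// mulrC.
Qed.

End L2_tools.

(** * Translation invariance of integrals *)

Section translation.
Variables (R : realType) (d : nat) (tau : 'rV[R]_d).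
Local Notation mu := (lebesgue_rV R d).
Implicit Types (f g : 'rV[R]_d -> R) (D F : set 'rV[R]_d).

Definition shiftf (tau : 'rV[R]_d) (T : Type) (f : 'rV[R]_d -> T) := fun x => f (x + tau).
(** The translate D - tau, on which [shiftf tau f] lives when [f] lives on [D]. *)
Definition shiftd D : set 'rV[R]_d := [set x | D (x + tau)].

Lemma continuous_shift : continuous (fun x : 'rV[R]_d => x + tau).
Proof. by move=> x; apply: differentiable_continuous; exact: ex_diff. Qed.

Lemma measurable_shift : measurable_fun setT (fun x : 'rV[R]_d => x + tau).
Proof.
have := measurable_affine_rV 1 tau; congr measurable_fun.
by apply/funext => x; rewrite scale1r.
Qed.

Lemma integral_shift (f : 'rV[R]_d -> \bar R) : measurable_fun setT f ->
  (\int[mu]_x f (x + tau)%R = \int[mu]_x f x)%E.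
Proof.
move=> mf.
have H (g : 'rV[R]_d -> \bar R) : measurable_fun setT g -> (forall x, 0 <= g x)%E ->
    (\int[mu]_x g (x + tau)%R = \int[mu]_x g x)%E.
  move=> mg g0; have := @integral_affine R d 1 tau g ltr01 mg g0.
  rewrite expr1n invr1 mul1e => <-.
  by apply: eq_integral => x _; rewrite scale1r.
rewrite integralE [RHS]integralE.
congr (_ - _)%E.
  transitivity (\int[mu]_x (f^\+ (x + tau)%R))%E; first by apply: eq_integral => x _; rewrite !funeposE.
  by apply: (H (f^\+)%E) => //; exact: measurable_funepos.
transitivity (\int[mu]_x (f^\- (x + tau)%R))%E; first by apply: eq_integral => x _; rewrite !funenegE.
by apply: (H (f^\-)%E) => //; exact: measurable_funeneg.
Qed.

Lemma integral_shift_in D (f : 'rV[R]_d -> \bar R) : measurable D -> measurable_fun D f ->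
  (\int[mu]_(x in shiftd D) f (x + tau)%R = \int[mu]_(x in D) f x)%E.
Proof.
move=> mD mf; rewrite integral_mkcond [RHS]integral_mkcond -[RHS]integral_shift; last first.
  by apply/(measurable_restrictT f mD).
apply: eq_integral => x _; rewrite !patchE.
by have [/set_mem Dx|/negP Dx] := boolP (x \in shiftd D);
  [rewrite mem_set|rewrite memNset// => /(mem_set (A := shiftd D))].
Qed.

Lemma measurable_shiftd D : measurable D -> measurable (shiftd D).
Proof. by move=> mD; rewrite -[X in measurable X]setTI; exact: measurable_shift. Qed.

Lemma open_shiftd D : open D -> open (shiftd D).
Proof. by move=> oD; apply: open_comp => // x _; exact: continuous_shift. Qed.

Lemma measurable_fun_shift D (f : 'rV[R]_d -> R) : measurable D -> measurable_fun D f ->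
  measurable_fun (shiftd D) (shiftf tau f).
Proof.
move=> mD mf; apply: (@measurable_comp _ _ _ _ _ _ D) => //.
- by move=> _ [x Dx <-].
- exact: measurable_funTS measurable_shift.
Qed.

Lemma sqint_shift D f : measurable D -> measurable_fun D f ->
  sqint (shiftd D) (shiftf tau f) = sqint D f.
Proof.
move=> mD mf; apply: (@integral_shift_in D (fun x => (f x ^+ 2)%:E)) => //.
by apply/measurable_EFinP; exact: measurable_funX.
Qed.

End translation.

(** * Translation of Sobolev spaces and of the extension operator *)

Section translation_weak.
Variables (R : realType) (d : nat).
Local Notation mu := (lebesgue_rV R d).
Implicit Types (f g : 'rV[R]_d -> R) (D F : set 'rV[R]_d) (tau : 'rV[R]_d).

Lemma derive_shift tau f x v : 'D_v (shiftf tau f) x = 'D_v f (x + tau).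
Proof.
rewrite /derive (_ : (fun h => _) = fun h => h^-1 *: ((f \o shift (x + tau)) (h *: v) - f (x + tau)))//.
by apply/funext => h /=; rewrite /shiftf /= addrA.
Qed.

Lemma iter_partial_shift tau s f : iter_partial s (shiftf tau f) = shiftf tau (iter_partial s f).
Proof.
elim: s => //= l s ->; apply/funext => x; exact: derive_shift.
Qed.

Lemma smooth_shift tau f : smooth f -> smooth (shiftf tau f).
Proof.
move=> sf s x; rewrite iter_partial_shift.
apply: (@differentiable_comp _ _ _ _ (fun x : 'rV[R]_d => x + tau)); last exact: sf.
exact: ex_diff.
Qed.

Lemma shiftd_opp tau D : shiftd (- tau) (shiftd tau D) = D.
Proof. by apply/seteqP; split => x; rewrite /shiftd/= subrK. Qed.

Lemma compact_shiftd tau K : compact K -> compact (shiftd tau K).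
Proof.
move=> cK; rewrite (_ : shiftd tau K = (fun x => x + - tau) @` K).
  by apply: continuous_compact => //; apply: continuous_subspaceT; exact: continuous_shift.
apply/seteqP; split => [x Kx|_ [y Ky <-]]; last by rewrite /shiftd/= subrK.
by exists (x + tau) => //; rewrite addrK.
Qed.

Lemma test_function_shift tau D psi : test_function D psi ->
  test_function (shiftd tau D) (shiftf tau psi).
Proof.
move=> [sp [K [cK KD p0]]]; split; first exact: smooth_shift.
exists (shiftd tau K); split; first exact: compact_shiftd.
- by move=> x; exact: KD.
- by move=> x; exact: p0.
Qed.

Lemma loc_integrable_shift tau D f : open D -> loc_integrable D f ->
  loc_integrable (shiftd tau D) (shiftf tau f).
Proof.
move=> oD [mf fi]; have mD := open_measurable_rV oD.
split; first exact: measurable_fun_shift.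
move=> C cC CD; have mC := compact_measurable_rV cC.
have cC' := compact_shiftd (tau := - tau) cC; have mC' := compact_measurable_rV cC'.
have CD' : shiftd (- tau) C `<=` D by move=> x /CD; rewrite /shiftd/= subrK.
have /integrableP[mf' If'] := fi _ cC' CD'.
have E : shiftd tau (shiftd (- tau) C) = C by have := shiftd_opp (- tau) C; rewrite opprK.
apply/integrableP; split.
  apply: (measurable_funS _ CD); first exact: measurable_shiftd.
  by apply/measurable_EFinP; exact: measurable_fun_shift.
rewrite -E (@integral_shift_in _ _ tau _ (fun x => `|(f x)%:E|%E))//.
by apply: measurableT_comp mf'.
Qed.

Lemma weak_derivative_shift tau D k (a : mindex d k) f g : open D ->
  weak_derivative D a f g -> weak_derivative (shiftd tau D) a (shiftf tau f) (shiftf tau g).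
Proof.
move=> oD [lf lg H]; have mD := open_measurable_rV oD.
split; [exact: loc_integrable_shift|exact: loc_integrable_shift|move=> psi tp].
have tp' := test_function_shift (- tau) tp; rewrite shiftd_opp in tp'.
have /= := H _ tp'; rewrite /partial iter_partial_shift.
have I u q : loc_integrable D u -> test_function D (shiftf (- tau) q) ->
   \int[mu]_(x in shiftd tau D) (shiftf tau u x * q x) = \int[mu]_(x in D) (u x * shiftf (- tau) q x).
  move=> lu tq; rewrite /Rintegral; congr fine.
  rewrite -(@integral_shift_in _ _ tau D (fun x => (u x * shiftf (- tau) q x)%:E))//.
    by apply: eq_integral => x _; rewrite /shiftf addrK.
  by have /integrableP[] := integrable_mul_test lu tq mD.
rewrite I//; last first.
  rewrite -iter_partial_shift.
  have [sp [K [cK KD p0]]] := tp'; split; first exact: smooth_iter_partial.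
  exists K; split => //; apply: iter_partial_off => //; exact: compact_closed_rV.
by move=> ->; rewrite I.
Qed.

Lemma sobolev_shift tau D k f : open D -> sobolev D k 2 f ->
  sobolev (shiftd tau D) k 2 (shiftf tau f) /\
  sobolev_norm (shiftd tau D) k 2 (shiftf tau f) = sobolev_norm D k 2 f.
Proof.
move=> oD sf; have mD := open_measurable_rV oD.
have W (a : mindex d k) : (mdeg a <= k)%N ->
   weak_derivative (shiftd tau D) a (shiftf tau f) (shiftf tau (weakD D a f)).
  by move=> ak; have [g fg _] := sf a ak; apply: weak_derivative_shift => //; exact: weakDP fg.
have mw (a : mindex d k) : (mdeg a <= k)%N -> measurable_fun D (weakD D a f).
  by move=> ak; have [g fg _] := sf a ak; have [_ [? _] _] := weakDP fg.
split.
  move=> a ak; exists (shiftf tau (weakD D a f)); first exact: W.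
  apply/Lp_norm2_lty; rewrite sqint_shift//; first exact: sobolev_sqint_lty.
  exact: mw.
rewrite /sobolev_norm; congr (_ `^ _)%E; apply: eq_bigr => a ak; rewrite !Lp_norm2.
rewrite (sqint_weakD _ (W a ak)); last exact: open_shiftd.
by rewrite sqint_shift//; exact: mw.
Qed.

(** A function on the translate is moved back to [D], extended there and moved forward again.
    Translation preserves the norms, so [M] does not depend on [tau]. *)
Lemma extension_shift D k : open D -> stein_extension D ->
  exists M : R, forall tau f, sobolev (shiftd tau D) k 2 f ->
  exists w, [/\ sobolev setT k 2 w, {ae mu, forall x, shiftd tau D x -> w x = f x} &
    (sobolev_norm setT k 2 w <= M%:E * sobolev_norm (shiftd tau D) k 2 f)%E].
Proof.
move=> oD /(_ k)[E [HE _ [M HM]]]; exists M => tau f sf.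
have [] := sobolev_shift (- tau) (@open_shiftd _ _ tau _ oD) sf; rewrite shiftd_opp => sf' nf'.
have [sE EF] := HE _ sf'.
have [sw nw] := sobolev_shift tau openT sE.
exists (shiftf tau (E (shiftf (- tau) f))); split.
- exact: sw.
- have [N [mN N0 HN]] := EF; exists (shiftd tau N); split.
  + exact: measurable_shiftd.
  + have := @integral_shift_in _ _ tau N (fun=> 1%E) mN.
    rewrite !integral_cst ?mul1e//; last exact: measurable_shiftd.
    by rewrite N0 => ->//; exact: measurable_cst.
  + move=> x /= nx; apply: HN => /= h; apply: nx => Dx.
    by rewrite /shiftf h// /shiftf addrK.
- by have := nw; rewrite (_ : shiftd tau setT = setT)// => ->; rewrite -nf'; exact: HM.
Qed.

Lemma image_shiftd tau D : [set x + tau | x in D] = shiftd (- tau) D.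
Proof.
apply/seteqP; split => [_ [y Dy <-]|x Dx]; first by rewrite /shiftd/= addrK.
by exists (x - tau) => //; rewrite subrK.
Qed.

End translation_weak.

(** * Interpolation *)

Section interpolation.
Variables (R : realType) (d : nat).
Implicit Types (f g : 'rV[R]_d -> R) (D F : set 'rV[R]_d) (i j : 'rV[int]_d) (sigma : R) (x : 'rV[R]_d).

Lemma sqr_sum_le (I : finType) (a : I -> R) : (\sum_t a t) ^+ 2 <= #|I|%:R * \sum_t a t ^+ 2.
Proof.
have H (r : seq I) : (\sum_(t <- r) a t) ^+ 2 <= (size r)%:R * \sum_(t <- r) a t ^+ 2.
  elim: r => [|x r IH]; first by rewrite !big_nil expr0n mul0r.
  rewrite !big_cons /= -natr1 mulrDl mul1r.
  have [->|r0] := eqVneq r [::].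
    by rewrite !big_nil !addr0/= mul0r add0r.
  have n0 : 0 < (size r)%:R :> R by rewrite ltr0n lt0n size_eq0.
  move: IH; move: (size r)%:R n0 (\sum_(t <- r) a t) (\sum_(t <- r) a t ^+ 2) => n n0 u v uv.
  have : 2 * (a x * u) <= n * a x ^+ 2 + n^-1 * u ^+ 2.
    have e : n * a x ^+ 2 + n^-1 * u ^+ 2 - 2 * (a x * u) = n^-1 * (n * a x - u) ^+ 2.
      by field; exact: lt0r_neq0.
    by rewrite -subr_ge0 e mulr_ge0 ?sqr_ge0// invr_ge0 ltW.
  have : n^-1 * u ^+ 2 <= v by rewrite ler_pdivrMl.
  rewrite sqrrD; nra.
by have := H (enum I); rewrite !big_enum/= -cardE.
Qed.

Lemma big_seq_support (I : eqType) (V : nmodType) (r r' : seq I) (Y : I -> V) : uniq r -> uniq r' ->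
  (forall t, Y t != 0 -> (t \in r) = (t \in r')) -> \sum_(t <- r) Y t = \sum_(t <- r') Y t.
Proof.
move=> ur ur' H.
have E (s : seq I) : \sum_(t <- s) Y t = \sum_(t <- [seq t <- s | Y t != 0]) Y t.
  rewrite big_filter [RHS]big_mkcond; apply: eq_bigr => t _.
  by case: ifPn => // /negPn/eqP.
rewrite E [RHS]E; apply: perm_big; apply: uniq_perm; rewrite ?filter_uniq// => t.
by rewrite !mem_filter; case: (boolP (Y t != 0)) => //= /H.
Qed.

Definition corner (b : {ffun 'I_d -> bool}) : 'rV[int]_d := \row_l (b l)%:Z.

Lemma corner_inj : injective corner.
Proof.
move=> b c /rowP bc; apply/ffunP => l; have := bc l; rewrite !mxE => -[].
by case: (b l); case: (c l).
Qed.

Lemma pu_off sigma i j x : 0 < sigma -> closure (element sigma j) x -> pu sigma i x != 0 ->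
  exists b, i = j + corner b.
Proof.
move=> s0 /(closure_elementP _ _ s0) xj; rewrite puE// => /prodf_neq0 H.
exists [ffun l => i ord0 l != j ord0 l]; apply/rowP => l.
change (i ord0 l = (j + corner [ffun l => i ord0 l != j ord0 l]) ord0 l).
rewrite !mxE ffunE; have := H l isT; apply: contraNeq => il.
apply/eqP; apply: hat_eq0; have /andP[x1 x2] := xj l.
have y1 : (j ord0 l)%:~R <= x ord0 l / sigma by rewrite ler_pdivlMr.
have y2 : x ord0 l / sigma <= (j ord0 l + 1)%:~R by rewrite ler_pdivrMr// intrD.
rewrite ler_normr; apply/orP.
have [ij|ij] : (i ord0 l <= j ord0 l - 1)%R \/ (j ord0 l + 2 <= i ord0 l)%R.
- by move: il; case: eqVneq => [->|] /=; lia.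
- left; have : (i ord0 l)%:~R <= (j ord0 l - 1)%:~R :> R by rewrite ler_int.
  rewrite intrB; lra.
- right; have : (j ord0 l + 2)%:~R <= (i ord0 l)%:~R :> R by rewrite ler_int.
  by move: y2; rewrite !intrD; lra.
Qed.

Lemma pu_ge0 sigma i (x : 'rV[R]_d) : 0 < sigma -> 0 <= pu sigma i x.
Proof. by move=> s0; rewrite puE//; apply: prodr_ge0 => l _; exact: hat_ge0. Qed.

(** In each coordinate the two hat functions of the adjacent nodes add up to 1; multiplying out the
    product over the coordinates gives the sum over the corners. *)
Lemma pu_partition sigma j x : 0 < sigma -> element sigma j x ->
  \sum_b pu sigma (j + corner b) x = 1.
Proof.
move=> s0 xj.
transitivity (\prod_(l < d) \sum_(c : bool) hat (x ord0 l / sigma - (j ord0 l + c%:Z)%:~R)).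
  rewrite bigA_distr_bigA/=; apply: eq_bigr => b _; rewrite puE//.
  by apply: eq_bigr => l _; rewrite !mxE.
apply: big1 => l _; rewrite big_bool/= addrC; have /andP[x1 x2] := xj l.
rewrite (intrD R _ 0) (intrD R _ 1) addr0.
rewrite (_ : _ - (_ + _) = x ord0 l / sigma - (j ord0 l)%:~R - 1); last by rewrite opprD addrA.
apply: hat_partition.
have y1 : (j ord0 l)%:~R < x ord0 l / sigma by rewrite ltr_pdivlMr.
have y2 : x ord0 l / sigma < (j ord0 l)%:~R + 1 by rewrite ltr_pdivrMr.
by apply/andP; split; lra.
Qed.

Lemma pu_le1 sigma j x b : 0 < sigma -> element sigma j x -> pu sigma (j + corner b) x <= 1.
Proof.
move=> s0 xj; rewrite -(pu_partition s0 xj) (bigD1 b)//= lerDl sumr_ge0// => c _.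
exact: pu_ge0.
Qed.

Lemma comb_element P sigma (T : seq 'rV[int]_d) (c : 'rV[int]_d -> mindex d P -> R) j x :
  0 < sigma -> uniq T -> (forall b, j + corner b \in T) -> element sigma j x ->
  comb sigma T c x = \sum_b pu sigma (j + corner b) x * multipoly (c (j + corner b)) x.
Proof.
move=> s0 uT jT xj.
pose Y i := pu sigma i x * multipoly (c i) x.
have -> : comb sigma T c x = \sum_(i <- T) Y i.
  apply: eq_bigr => i _; rewrite /Y /multipoly mulr_sumr; apply: eq_bigr => a _; ring.
rewrite -(big_map (fun b => j + corner b) xpredT Y); apply: big_seq_support => //.
  by rewrite map_inj_uniq ?index_enum_uniq// => b b' /addrI/corner_inj.
move=> i Yi; have [b ->] : exists b, i = j + corner b.
  by apply: (pu_off s0 (subset_closure xj)); apply: contraNneq Yi; rewrite /Y => ->; rewrite mul0r.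
by rewrite jT; apply/esym/mapP; exists b => //; rewrite mem_index_enum.
Qed.

(* Polynomials of degree at most [n] satisfy [annih n]. *)
Definition annih (n : nat) f := smd f /\ forall t, (n < size t)%N -> iter_partial t f = fun=> 0.

Lemma annih_leq n n' f : (n <= n')%N -> annih n f -> annih n' f.
Proof. by move=> nn' [sf H]; split => // t nt; apply: H; exact: leq_ltn_trans nt. Qed.

Lemma annih_cst (c : R) : annih 0 (fun=> c).
Proof.
split; first exact: smd_cst.
case/lastP => // t l _; rewrite iter_partial_rcons pd_cst; exact: iter_partial0.
Qed.

Lemma annih_coord l : annih 1 (fun x => x ord0 l).
Proof.
split; first by apply: (@smd_coord R d id l); exact: sm_id.
case/lastP => // t k; case/lastP: t => // t k' _.
rewrite !iter_partial_rcons (@pd_coord R d k l id (@sm_id R)).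
have -> : derive1 id = fun=> (1 : R) by apply/funext => u; rewrite derive1E derive_id.
by rewrite (pd_cst k' ((l == k)%:R * 1)) iter_partial0.
Qed.

Lemma annih_mul n n' f g : annih n f -> annih n' g -> annih (n + n')%N (fun x => f x * g x).
Proof.
move=> [sf Hf] [sg Hg]; split; first exact: smd_mul.
move=> t nt; rewrite iter_partial_mul//; apply/funext => x; rewrite big_seq big1// => p pt.
have := splits_size pt => pp.
have [np|np] := ltnP n (size p.1); first by rewrite Hf// mul0r.
by rewrite (Hg p.2) ?mulr0//; move: nt np; rewrite -pp; move: (size p.1) (size p.2) => u v; lia.
Qed.

Lemma annih_sum (I : Type) (r : seq I) (p : pred I) (Y : I -> 'rV[R]_d -> R) n :
  (forall t, p t -> annih n (Y t)) -> annih n (fun x => \sum_(t <- r | p t) Y t x).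
Proof.
move=> H; elim: r => [|t r IH].
  under eq_fun do rewrite big_nil; apply: annih_leq (annih_cst 0); exact: leq0n.
have [pt|/negbTE pt] := boolP (p t); under eq_fun do rewrite big_cons pt; last exact: IH.
have [s1 H1] := IH; have [s2 H2] := H t pt; split; first exact: smd_add.
by move=> q nq; rewrite iter_partial_add// H1// H2//; apply/funext => x; rewrite addr0.
Qed.

Lemma annih_monomial P (a : mindex d P) : annih (mdeg a) (@monomial R d P a).
Proof.
rewrite /monomial /mdeg; elim: (index_enum _) => [|l r IH].
  rewrite big_nil; under eq_fun do rewrite big_nil; exact: annih_cst.
rewrite (_ : (\sum_(k <- l :: r) a k)%N = (a l + \sum_(k <- r) a k)%N); last by rewrite big_cons.
rewrite (_ : (fun x : 'rV[R]_d => \prod_(k <- l :: r) x ord0 k ^+ a k) =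
  fun x => x ord0 l ^+ a l * \prod_(k <- r) x ord0 k ^+ a k); last by apply/funext => x; rewrite big_cons.
apply: annih_mul => //.
elim: (nat_of_ord (a l)) => [|n IHn]; first exact: annih_cst.
under eq_fun do rewrite exprS; apply: (@annih_mul 1 n) => //; exact: annih_coord.
Qed.

Lemma annih_multipoly P (c : mindex d P -> R) : annih P (multipoly c).
Proof.
apply: annih_sum => a aP; apply: (@annih_mul 0 P); first exact: annih_cst.
exact: annih_leq aP (annih_monomial a).
Qed.

Lemma patch_ofE sigma i : patch_of sigma i =
  obox (fun l => ((i ord0 l)%:~R - 1) * sigma) (fun l => ((i ord0 l)%:~R + 1) * sigma) :> set 'rV[R]_d.
Proof. by apply/seteqP; split => x xj l; have := xj l; rewrite /= in_itv. Qed.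

Lemma element_sub_patch sigma j b : 0 < sigma ->
  element sigma j `<=` (patch_of sigma (j + corner b) : set 'rV[R]_d).
Proof.
move=> s0 x xj l; have /andP[x1 x2] := xj l; rewrite !mxE intrD.
apply/andP; split; [apply: le_lt_trans x1|apply: lt_le_trans x2 _]; rewrite ler_pM2r//.
  by case: (b l); rewrite ?mulr0z ?mulr1z; lra.
by case: (b l); rewrite ?mulr0z ?mulr1z; lra.
Qed.

Lemma patch_cover sigma i x : 0 < sigma -> patch_of sigma i x -> ~ grid_lines sigma x ->
  exists2 k, k \in [seq i - corner b | b <- enum {: {ffun 'I_d -> bool}}] & element sigma k x.
Proof.
move=> s0 xi nx; have [k xk] := closure_element_cover x s0.
have {}xk := closure_element_off s0 xk nx.
exists k => //; apply/mapP; exists [ffun l => k ord0 l != i ord0 l]; first by rewrite mem_enum.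
apply/rowP => l; change (k ord0 l = (i - corner [ffun l => k ord0 l != i ord0 l]) ord0 l).
rewrite !mxE ffunE; have /andP[h1 h2] := xi l; have /andP[h3 h4] := xk l.
have : ((i ord0 l)%:~R - 1) * sigma < ((k ord0 l)%:~R + 1) * sigma by exact: lt_trans h4.
have : (k ord0 l)%:~R * sigma < ((i ord0 l)%:~R + 1) * sigma by exact: lt_trans h2.
rewrite !ltr_pM2r// -(intrB R _ 1) -!(intrD R _ 1) !ltr_int => h5 h6.
by case: (eqVneq (k ord0 l) (i ord0 l)) => [->|] /=; lia.
Qed.

Notation nb := #|{: {ffun 'I_d -> bool}}|.

(** A patch is covered by 2^d elements. For fixed corners [b] and [b'] different [j] lead to
    different elements, so each [b'] contributes the whole integral at most once. *)
Lemma sum_patch_le sigma (S : seq 'rV[int]_d) b h : 0 < sigma -> uniq S -> measurable_fun setT h ->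
  (\sum_(j <- S) sqint (patch_of sigma (j + corner b)%R) h <= nb%:R%:E * sqint setT h)%E.
Proof.
move=> s0 uS mh.
have mh2 : measurable_fun setT (fun x => (h x ^+ 2)%:E) by apply/measurable_EFinP; exact: measurable_funX.
have h20 x : (0 <= (h x ^+ 2)%:E)%E by rewrite lee_fin sqr_ge0.
apply: (@le_trans _ _ (\sum_(j <- S) \sum_(b' : {ffun 'I_d -> bool})
    sqint (element sigma (j + corner b - corner b')%R) h)%E).
  apply: lee_sum => j _; rewrite -[leRHS]big_enum/=.
  rewrite -(big_map (fun b' => (j + corner b - corner b')%R) xpredT (fun k => sqint (element sigma k) h)).
  apply: integral_le_cover => //; first by rewrite patch_ofE; exact: measurable_obox.
  by move=> x xj nx; exact: patch_cover.
rewrite exchange_big/=.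
rewrite (_ : nb%:R = \sum_(b' : {ffun 'I_d -> bool}) (1 : R)); last by rewrite sumr_const.
rewrite -sume_cst ?sqint_ge0//; apply: lee_sum => b' _.
rewrite -(big_map (fun j => (j + corner b - corner b')%R) xpredT (fun k => sqint (element sigma k) h)).
apply: sum_integral_element_le => //.
by rewrite map_inj_uniq// => j j'; rewrite -!addrA => /addIr.
Qed.

Lemma local_approximation P C_BH sigma (Omega : set 'rV[R]_d) w i : 0 < sigma ->
  bramble_hilbert sigma Omega P C_BH -> sobolev setT P.+1 2 w ->
  patch_of sigma i `&` fictitious sigma Omega !=set0 ->
  exists c : mindex d P -> R,
  (sqint (fictitious sigma Omega `&` patch_of sigma i) (fun x => w x - multipoly c x)%R <=
   ((C_BH * sigma ^+ P.+1) ^+ 2)%:E * \sum_(a : mindex d P.+1 | mdeg a == P.+1)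
     sqint (patch_of sigma i) (weakD setT a w))%E.
Proof.
move=> s0 BH sw ne.
have oP : open (patch_of sigma i : set 'rV[R]_d) by rewrite patch_ofE; exact: obox_open.
have oF : open (fictitious sigma Omega) := @open_fictitious R d sigma Omega.
have oD := openI oF oP; set D := _ `&` _ in oD *.
have mD := open_measurable_rV oD.
have mw (a : mindex d P.+1) : (mdeg a <= P.+1)%N -> weak_derivative setT a w (weakD setT a w).
  by move=> aP; have [g wg _] := sw a aP; exact: weakDP wg.
have mw' (a : mindex d P.+1) : (mdeg a <= P.+1)%N -> weak_derivative D a w (weakD setT a w).
  by move=> /mw; apply: weak_derivative_sub => //; exact: openT.
have msw (a : mindex d P.+1) : (mdeg a <= P.+1)%N -> measurable_fun setT (weakD setT a w).
  by move=> /mw[_ []].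
have sD : sobolev D P.+1 2 w.
  move=> a aP; exists (weakD setT a w); first exact: mw'.
  apply/Lp_norm2_lty; apply: le_lt_trans (sobolev_sqint_lty openT sw aP).
  by apply: sqint_le => //; exact: msw.
(* The L2 bound (k = 0) fixes the polynomial; derivatives of the assembled approximation are
   recovered from inverse estimates. *)
have [c /(_ 0%N isT)] := BH i ne w sD; rewrite subn0 => H; exists c.
have lw := sobolev_loc_integrable sD.
have lwc : loc_integrable D (fun x => w x - multipoly c x).
  have [sc _] := annih_multipoly c.
  have := loc_integrableD (-1) lw (continuous_loc_integrable D (smd_continuous sc)).
  by congr loc_integrable; apply/funext => x; rewrite mulN1r.
apply: (@le_trans _ _ (sobolev_seminorm D 0 2 (fun x => w x - multipoly c x)%R `^ 2)%E).
  rewrite sobolev_seminorm2 (bigD1 (mindex0 d 0)) ?mdeg_mindex0//=.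
  rewrite (sqint_weakD oD (weak_derivative_mindex0 _ lwc)) leeDl// sume_ge0// => a _.
  exact: sqint_ge0.
set K := C_BH * _ in H *.
(* Nothing is known about the sign of [C_BH]; the absolute value makes the bound fit for
   squaring. *)
have H' : (sobolev_seminorm D 0 2 (fun x => w x - multipoly c x)%R <=
    `|K|%:E * sobolev_seminorm D P.+1 2 w)%E.
  by apply: le_trans H _; apply: lee_wpmul2r; [exact: poweR_ge0|rewrite lee_fin ler_norm].
apply: (@le_trans _ _ ((`|K|%:E * sobolev_seminorm D P.+1 2 w) `^ 2)%E).
  apply: gt0_ler_poweR => //; rewrite in_itv/= leey andbT ?poweR_ge0//.
  by rewrite mule_ge0 ?lee_fin// poweR_ge0.
rewrite poweRM ?lee_fin ?poweR_ge0// poweR_EFin powR_mulrn// real_normK ?num_real//.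
apply: lee_wpmul2l; first by rewrite lee_fin sqr_ge0.
rewrite sobolev_seminorm2; apply: lee_sum => a /eqP aP.
rewrite (sqint_weakD oD (mw' a _)) ?aP//; apply: sqint_le => //.
- exact: open_measurable_rV.
- by move=> x [].
- by apply: measurable_funTS; apply: msw; exact: eq_leq.
Qed.

End interpolation.

(** * Interpolation error on one element *)

Section interpolation_error.
Variables (R : realType) (d P : nat).
Local Notation mu := (lebesgue_rV R d).
Local Notation nb := #|{: {ffun 'I_d -> bool}}|.
Implicit Types (f g w : 'rV[R]_d -> R) (i j : 'rV[int]_d) (sigma : R) (x : 'rV[R]_d).

(** The partition of unity writes w - v as a combination of the errors of the corner polynomials,
    with weights between 0 and 1. *)
Lemma interpolation_element sigma (T : seq 'rV[int]_d) (c : 'rV[int]_d -> mindex d P -> R) j w :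
  0 < sigma -> uniq T -> (forall b, j + corner b \in T) -> measurable_fun setT w ->
  (sqint (element sigma j) (fun x => w x - comb sigma T c x)%R <=
   nb%:R%:E * \sum_b sqint (element sigma j) (fun x => w x - multipoly (c (j + corner b)%R) x)%R)%E.
Proof.
move=> s0 uT jT mw; have mE := @measurable_element R d sigma j.
have cp b : continuous (multipoly (c (j + corner b))).
  by have [sc _] := annih_multipoly (c (j + corner b)); exact: smd_continuous.
have mf b : measurable_fun setT (fun x => (w x - multipoly (c (j + corner b)) x) ^+ 2).
  by apply: measurable_funX; apply: measurable_funB => //; exact: continuous_measurable_rV.
rewrite /sqint -ge0_integral_sum//; last 2 first.
- by move=> b; apply/measurable_EFinP; exact: measurable_funTS.
- by move=> b x _; rewrite lee_fin sqr_ge0.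
rewrite -ge0_integralZl//; last 2 first.
- by apply: emeasurable_sum => b; apply/measurable_EFinP; exact: measurable_funTS.
- by move=> x _; apply: sume_ge0 => b _; rewrite lee_fin sqr_ge0.
apply: ge0_le_integral => //.
- by move=> x _; rewrite lee_fin sqr_ge0.
- apply/measurable_EFinP; apply: measurable_funTS; apply: measurable_funX; apply: measurable_funB => //.
  by apply: continuous_measurable_rV; apply: smd_continuous; exact: smd_comb.
- apply: measurable_funeM; apply: emeasurable_sum => b; apply/measurable_EFinP; exact: measurable_funTS.
move=> x xj; rewrite sumEFin -EFinM lee_fin (comb_element c s0 uT jT xj).
rewrite [X in (X - _) ^+ 2](_ : w x = \sum_b pu sigma (j + corner b) x * w x); last first.
  by rewrite -mulr_suml pu_partition// mul1r.
rewrite -sumrB; apply: le_trans (sqr_sum_le _) _; rewrite ler_wpM2l//; apply: ler_sum => b _.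
rewrite -mulrBr exprMn ler_piMl ?sqr_ge0// exprn_ile1 ?pu_ge0//; exact: pu_le1.
Qed.

Lemma comb_partial_inverse : exists2 C, 0 <= C &
  forall sigma (T : seq 'rV[int]_d) (c : 'rV[int]_d -> mindex d P -> R) j, 0 < sigma ->
  ((sigma ^+ (2 * P.+1))%:E * \sum_(e : mindex d P.+1 | mdeg e == P.+1)
     sqint (element sigma j) (partial e (comb sigma T c)) <=
   C%:E * sqint (element sigma j) (comb sigma T c))%E.
Proof.
have [C C0 HC] := @comb_inverse R d P P.+1.
pose N := \sum_(e : mindex d P.+1 | mdeg e == P.+1) (1 : R).
have N0 : 0 <= N by exact: sumr_ge0.
exists (N * C); first exact: mulr_ge0.
move=> sigma T c j s0; set z := comb sigma T c.
have sz : smd z by exact: smd_comb.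
have mE := @measurable_element R d sigma j.
rewrite EFinM -muleA -sume_cst ?mule_ge0 ?sqint_ge0//.
rewrite ge0_sume_distrr; last by move=> e _; exact: sqint_ge0.
apply: lee_sum => e /eqP eP.
have cz : continuous (partial e z) by apply: smd_continuous; exact: smd_iter_partial.
apply: (@le_trans _ _ ((sigma ^+ (2 * P.+1))%:E * \int[mu]_(x in element sigma j)
  ((C * sigma ^- (2 * P.+1) * sigma ^- d)%:E * sqint (element sigma j) z))%E).
  apply: lee_wpmul2l; first by rewrite lee_fin exprn_ge0// ltW.
  apply: ge0_le_integral => //.
  - by move=> x _; rewrite lee_fin sqr_ge0.
  - by apply/measurable_EFinP; apply: continuous_measurable_rV; exact: continuous_sqr.
  - move=> x xj; apply: HC => //; by rewrite size_mindex_seq.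
have zE : sqint (element sigma j) z = (sq (element sigma j) z)%:E.
  rewrite sqintE//; apply: L2fun_continuous => //; first exact: coord_bounded_element.
  exact: smd_continuous.
rewrite integral_cst// lebesgue_element//.
rewrite (_ : ((sigma ^+ (2 * P.+1))%:E * ((C * sigma ^- (2 * P.+1) * sigma ^- d)%:E * sqint (element sigma j) z * (sigma ^+ d)%:E) =
    C%:E * sqint (element sigma j) z)%E)//.
  rewrite zE -!EFinM; congr EFin; field.
  by rewrite !expf_neq0// gt_eqF.
Qed.

(** The polynomial [p] of node j has no derivatives of order P+1, so [v] may be replaced by z = v -
    p, which on the element is the trial function with coefficients c i - c j. Its L2 norm is of the
    size of the local errors, and the inverse estimate does the rest. The factor 2 (1 + 2^d) comes
    from z = (w - p) - (w - v). *)
Lemma comb_partial_element : exists2 C, 0 <= C &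
  forall sigma (T : seq 'rV[int]_d) (c : 'rV[int]_d -> mindex d P -> R) j w,
  0 < sigma -> uniq T -> (forall b, j + corner b \in T) -> measurable_fun setT w ->
  ((sigma ^+ (2 * P.+1))%:E * \sum_(e : mindex d P.+1 | mdeg e == P.+1)
     sqint (element sigma j) (partial e (comb sigma T c)) <=
   C%:E * \sum_b sqint (element sigma j) (fun x => w x - multipoly (c (j + corner b)%R) x)%R)%E.
Proof.
have [C C0 HC] := comb_partial_inverse.
exists (C * (2 * (1 + nb%:R))); first by rewrite !mulr_ge0// addr_ge0.
move=> sigma T c j w s0 uT jT mw.
set G := (\sum_b _)%E.
have G0 : (0 <= G)%E by apply: sume_ge0 => b _; exact: sqint_ge0.
pose b0 : {ffun 'I_d -> bool} := [ffun=> false].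
have jb0 : j + corner b0 = j.
  apply/rowP => l; change ((j + corner b0) ord0 l = j ord0 l); rewrite !mxE ffunE/=; lia.
pose p := multipoly (c j).
pose z := comb sigma T (fun i a => c i a - c j a).
have [sp Hp] := annih_multipoly (c j).
have sz : smd z by exact: smd_comb.
have mE := @measurable_element R d sigma j.
have vz x : element sigma j x -> comb sigma T c x = z x + p x.
  move=> xj; rewrite (comb_element c s0 uT jT xj) /z (comb_element _ s0 uT jT xj).
  rewrite -{1}[p x]mul1r -(pu_partition s0 xj) mulr_suml -big_split/=.
  apply: eq_bigr => b _; rewrite -mulrDr; congr (_ * _).
  rewrite /p /multipoly -big_split/=; apply: eq_bigr => a _; ring.
have zG : (sqint (element sigma j) z <= (2 * (1 + nb%:R))%:E * G)%E.
  have -> : sqint (element sigma j) z = sqint (element sigma j)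
      (fun x => (w x - p x) + (-1) * (w x - comb sigma T c x)).
    apply: eq_integral => x /set_mem xj; rewrite vz//; congr (_ ^+ 2)%:E; ring.
  apply: le_trans (sqint_lin_le _ _ _ _) _ => //.
  - by apply: measurable_funTS; apply: measurable_funB => //; apply: continuous_measurable_rV; exact: smd_continuous.
  - apply: measurable_funTS; apply: measurable_funB => //.
    by apply: continuous_measurable_rV; apply: smd_continuous; exact: smd_comb.
  rewrite sqrrN expr1n mul1e EFinM -muleA; apply: lee_wpmul2l => //.
  rewrite EFinD ge0_muleDl// mul1e; apply: leeD.
    rewrite /G (bigD1 b0)//= jb0 leeDl// sume_ge0// => b _; exact: sqint_ge0.
  exact: interpolation_element.
rewrite (eq_bigr (fun e => sqint (element sigma j) (partial e z))); last first.
  move=> e /eqP eP;  apply: eq_integral => x /set_mem xj; congr (_ ^+ 2)%:E.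
  transitivity (partial e (fun x => z x + p x) x).
    apply: near_iter_partial; have oE := @open_element R d sigma j.
     near=> y; apply: vz; near: y; exact: open_nbhs_nbhs.
  rewrite /partial iter_partial_add// Hp ?addr0//.
  by rewrite size_mindex_seq eP.
apply: le_trans (HC _ _ _ _ s0) _.
by rewrite EFinM -muleA; apply: lee_wpmul2l; rewrite ?lee_fin.
Unshelve. all: by end_near.
Qed.

End interpolation_error.

(** * Global interpolation error *)

Section interpolation_theorem.
Variables (R : realType) (d P : nat).
Local Notation nb := #|{: {ffun 'I_d -> bool}}|.
Implicit Types (f g w : 'rV[R]_d -> R) (i j : 'rV[int]_d) (sigma : R) (x : 'rV[R]_d).

Lemma interpolation (C_BH : R) : exists2 C, 0 <= C & forall sigma (Omega : set 'rV[R]_d) S w,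
  0 < sigma -> uniq S -> (forall i, (i \in S) <-> active sigma Omega i) ->
  bramble_hilbert sigma Omega P C_BH -> sobolev setT P.+1 2 w ->
  exists T c, let v := @comb R d P sigma T c in
    (esqint sigma S (fun x => w x - v x)%R <=
      (C * sigma ^+ (2 * P.+1))%:E * sobolev_norm setT P.+1 2 w `^ 2)%E /\
    (\sum_(i <- S) ((sigma ^+ (2 * P.+1))%:E * \sum_(e : mindex d P.+1 | mdeg e == P.+1)
      sqint (element sigma i) (partial e v)) <=
      (C * sigma ^+ (2 * P.+1))%:E * sobolev_norm setT P.+1 2 w `^ 2)%E.
Proof.
have [Cd Cd0 HCd] := comb_partial_element R d P.
pose C := (nb%:R + Cd) * (nb%:R * nb%:R * C_BH ^+ 2).
have nb0 : 0 <= nb%:R :> R by [].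
have C0 : 0 <= C by apply: mulr_ge0; [exact: addr_ge0|apply: mulr_ge0; [exact: mulr_ge0|exact: sqr_ge0]].
exists C => // sigma Omega S w s0 uS SP BH sw.
have mw : measurable_fun setT w by have [] := sobolev_loc_integrable sw.
(* The nodes of all active elements; adjacent elements share nodes, and a repeated node would be
   counted twice by [comb]. *)
pose T := undup [seq j + corner b | j <- S, b <- enum {: {ffun 'I_d -> bool}}].
have uT : uniq T by exact: undup_uniq.
have jT j b : j \in S -> j + corner b \in T.
  by move=> jS; rewrite mem_undup; apply/allpairsP; exists (j, b); rewrite mem_enum.
have sF j : j \in S -> element sigma j `<=` fictitious sigma Omega.
  by move=> /SP aj; apply/(activeP _ s0).
have Tne i : i \in T -> patch_of sigma i `&` fictitious sigma Omega !=set0.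
  rewrite mem_undup => /allpairsP[[j b] /= [jS _ ->]].
  have [x xj] := element_nonempty j s0; exists x; split; first exact: element_sub_patch.
  exact: sF xj.
pose W i := (\sum_(a : mindex d P.+1 | mdeg a == P.+1) sqint (patch_of sigma i) (weakD setT a w))%E.
have /choice[c Hc] : forall i, exists c : mindex d P -> R, i \in T ->
    (sqint (fictitious sigma Omega `&` patch_of sigma i) (fun x => w x - multipoly c x)%R <=
      ((C_BH * sigma ^+ P.+1) ^+ 2)%:E * W i)%E.
  move=> i; have [iT|iT] := boolP (i \in T); last by exists (fun=> 0).
  by have [c Hc] := local_approximation s0 BH sw (Tne i iT); exists c.
exists T, c.
have msw (a : mindex d P.+1) : mdeg a == P.+1 -> measurable_fun setT (weakD setT a w).
  by move=> /eqP aP; have [|g wg _] := sw a; [rewrite aP|have [_ [] ] := weakDP wg].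
pose G j := (\sum_b sqint (element sigma j) (fun x => w x - multipoly (c (j + corner b)%R) x)%R)%E.
have G0 j : (0 <= G j)%E by apply: sume_ge0 => b _; exact: sqint_ge0.
have W0 i : (0 <= W i)%E by apply: sume_ge0 => b _; exact: sqint_ge0.
have cp i : continuous (multipoly (c i)).
  by have [sc _] := annih_multipoly (c i); exact: smd_continuous.
pose V := (sobolev_norm setT P.+1 2 w `^ 2)%E.
have V0 : (0 <= V)%E by exact: poweR_ge0.
(* One factor 2^d counts the corners of an element, the other the overlap of the patches. *)
have sumG : (\sum_(j <- S) G j <= (nb%:R * nb%:R * C_BH ^+ 2 * sigma ^+ (2 * P.+1))%:E * V)%E.
  apply: (@le_trans _ _ (\sum_(j <- S) ((C_BH * sigma ^+ P.+1) ^+ 2)%:E * \sum_b W (j + corner b)%R)%E).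
    rewrite big_seq [leRHS]big_seq; apply: lee_sum => j jS.
    rewrite ge0_sume_distrr//; apply: lee_sum => b _.
    apply: le_trans (Hc _ (jT j b jS)); apply: sqint_le.
    - exact: measurable_element.
    - apply: measurableI; first by apply: open_measurable_rV; exact: open_fictitious.
      by rewrite patch_ofE; exact: measurable_obox.
    - by move=> x xj; split; [exact: sF xj|exact: element_sub_patch].
    - by apply: measurable_funTS; apply: measurable_funB => //; exact: continuous_measurable_rV.
  rewrite -ge0_sume_distrr; last by move=> j _; exact: sume_ge0.
  rewrite exchange_big/= (_ : nb%:R * nb%:R * C_BH ^+ 2 * sigma ^+ (2 * P.+1) =
    (C_BH * sigma ^+ P.+1) ^+ 2 * (nb%:R * nb%:R)); last first.
    by rewrite exprMn -exprM (mulnC 2%N); ring.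
  rewrite (EFinM ((C_BH * sigma ^+ P.+1) ^+ 2)) -muleA; apply: lee_wpmul2l; first by rewrite lee_fin sqr_ge0.
  apply: (@le_trans _ _ (\sum_(b : {ffun 'I_d -> bool}) (nb%:R%:E * V))%E).
    apply: lee_sum => b _; rewrite /W exchange_big/=.
    apply: (@le_trans _ _ (\sum_(a : mindex d P.+1 | mdeg a == P.+1) (nb%:R%:E * sqint setT (weakD setT a w)))%E).
      by apply: lee_sum => a aP; apply: sum_patch_le => //; exact: msw.
    rewrite -ge0_sume_distrr; last by move=> a _; exact: sqint_ge0.
    apply: lee_wpmul2l => //; rewrite -sobolev_seminorm2; apply: gt0_ler_poweR => //.
    - by rewrite in_itv/= leey poweR_ge0.
    - by rewrite in_itv/= leey poweR_ge0.
    - exact: sobolev_seminorm_le.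
  rewrite sume_cst ?mule_ge0// muleA -EFinM.
  by rewrite (_ : (\sum_(b : {ffun 'I_d -> bool}) (1 : R)) = nb%:R)// sumr_const.
have fin Cx : 0 <= Cx -> Cx <= nb%:R + Cd -> (Cx%:E * \sum_(j <- S) G j <= (C * sigma ^+ (2 * P.+1))%:E * V)%E.
  move=> Cx0 CxC; apply: le_trans (lee_wpmul2l _ sumG) _; first by rewrite lee_fin.
  rewrite muleA -EFinM; apply: lee_wpmul2r => //; rewrite lee_fin /C -[leRHS]mulrA.
  apply: ler_wpM2r => //; apply: mulr_ge0; last by rewrite exprn_ge0// ltW.
  by apply: mulr_ge0; [exact: mulr_ge0|exact: sqr_ge0].
split.
  apply: le_trans (fin nb%:R nb0 _); last by rewrite lerDl.
  rewrite /esqint ge0_sume_distrr// big_seq [leRHS]big_seq; apply: lee_sum => j jS.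
  by apply: interpolation_element => // b; exact: jT.
apply: le_trans (fin Cd Cd0 _); last by rewrite lerDr.
rewrite ge0_sume_distrr// big_seq [leRHS]big_seq; apply: lee_sum => j jS.
by apply: HCd => // b; exact: jT.
Qed.

End interpolation_theorem.

(** * The discrete problem *)

Section forms.
Variables (R : realType) (d P : nat).
Local Notation mu := (lebesgue_rV R d).
Local Notation comb := (@comb R d P).
Implicit Types (f g : 'rV[R]_d -> R) (i j : 'rV[int]_d) (sigma : R) (x : 'rV[R]_d).
Implicit Types (S T : seq 'rV[int]_d).

Definition nsq sigma S g : R := \sum_(i <- S) sq (element sigma i) g.

(** The stabilization form for smooth, untruncated functions and an explicit list of elements;
    [stabilizationE] links it to the original. *)
Definition jform sigma S g g' : R := sigma ^+ (2 * P.+1) *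
  \sum_(i <- S) \sum_(e : mindex d P.+1 | mdeg e == P.+1)
    \int[mu]_(x in element sigma i) (partial e g x * partial e g' x).

Definition aform (I : seq (R * 'rV[R]_d)) eps sigma S g g' : R :=
  quad I (fun x => g x * g' x) + eps * jform sigma S g g'.

Lemma nsq_ge0 sigma S g : 0 <= nsq sigma S g.
Proof. by apply: sumr_ge0 => i _; exact: sq_ge0. Qed.

Lemma L2fun_element sigma i g : continuous g -> L2fun (element sigma i) g.
Proof.
by move=> cg; apply: L2fun_continuous => //; [exact: measurable_element|exact: coord_bounded_element].
Qed.

Lemma nsqE sigma S g : continuous g -> esqint sigma S g = (nsq sigma S g)%:E.
Proof.
move=> cg; rewrite /esqint /nsq -sumEFin; apply: eq_bigr => i _.
by apply: sqintE; exact: L2fun_element.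
Qed.

Lemma continuous_partial k (e : mindex d k) g : smd g -> continuous (partial e g).
Proof. by move=> sg; apply: smd_continuous; exact: smd_iter_partial. Qed.

Lemma partial_lin k (e : mindex d k) f g c : smd f -> smd g ->
  partial e (fun x => f x + c * g x) = fun x => partial e f x + c * partial e g x.
Proof.
move=> sf sg; rewrite /partial iter_partial_add ?iter_partial_scale//.
by apply: smd_mul => //; exact: smd_cst.
Qed.

Lemma jform_sym sigma S g g' : jform sigma S g g' = jform sigma S g' g.
Proof.
congr (_ * _); apply: eq_bigr => i _; apply: eq_bigr => e _; apply: eq_Rintegral => x _.
by rewrite mulrC.
Qed.

Lemma jform_lin sigma S f g h c : smd f -> smd g -> smd h ->
  jform sigma S (fun x => f x + c * g x) h = jform sigma S f h + c * jform sigma S g h.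
Proof.
move=> sf sg sh; rewrite /jform [c * _]mulrCA -mulrDr; congr (_ * _); rewrite mulr_sumr -big_split/=.
apply: eq_bigr => i _; rewrite mulr_sumr -big_split/=; apply: eq_bigr => e _.
have mE := @measurable_element R d sigma i.
have Lf := L2fun_element sigma i (continuous_partial (e := e) sf).
have Lg := L2fun_element sigma i (continuous_partial (e := e) sg).
have Lh := L2fun_element sigma i (continuous_partial (e := e) sh).
rewrite -RintegralZl//; last exact: integrable_L2.
rewrite -RintegralD//; last 2 first.
- exact: integrable_L2.
- have := integrableZl mE c (integrable_L2 mE Lg Lh); by apply: eq_integrable.
by apply: eq_Rintegral => x _; rewrite partial_lin// mulrDl mulrA.
Qed.

Lemma jform_ge0 sigma S g : 0 < sigma -> 0 <= jform sigma S g g.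
Proof.
move=> s0; rewrite mulr_ge0 ?exprn_ge0 ?(ltW s0)//; apply: sumr_ge0 => i _; apply: sumr_ge0 => e _.
by apply: Rintegral_ge0 => x _; rewrite -expr2 sqr_ge0.
Qed.

Lemma jform_young sigma S f g t : 0 < sigma -> 0 < t -> smd f -> smd g ->
  `|jform sigma S f g| <= t * jform sigma S f f + t^-1 * jform sigma S g g.
Proof.
move=> s0 t0 sf sg; rewrite /jform normrM ger0_norm ?exprn_ge0 ?(ltW s0)//.
rewrite [X in _ <= X + _]mulrCA [X in _ <= _ + X]mulrCA -mulrDr ler_wpM2l ?exprn_ge0 ?(ltW s0)//.
apply: le_trans (ler_norm_sum _ _ _) _; rewrite !mulr_sumr -big_split/=; apply: ler_sum => i _.
apply: le_trans (ler_norm_sum _ _ _) _; rewrite !mulr_sumr -big_split/=; apply: ler_sum => e _.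
have mE := @measurable_element R d sigma i.
have Lf := L2fun_element sigma i (continuous_partial (e := e) sf).
have Lg := L2fun_element sigma i (continuous_partial (e := e) sg).
exact: young_L2 mE t0 Lf Lg.
Qed.

Lemma aform_sym I eps sigma S g g' : aform I eps sigma S g g' = aform I eps sigma S g' g.
Proof.
by rewrite /aform jform_sym; congr (_ + _); apply: eq_bigr => q _; rewrite (mulrC (g _)).
Qed.

Lemma aform_lin I eps sigma S f g h c : smd f -> smd g -> smd h ->
  aform I eps sigma S (fun x => f x + c * g x) h = aform I eps sigma S f h + c * aform I eps sigma S g h.
Proof.
move=> sf sg sh; rewrite /aform jform_lin//.
have -> : quad I (fun x => (f x + c * g x) * h x) = quad I (fun x => f x * h x) + c * quad I (fun x => g x * h x).
  by rewrite /quad mulr_sumr -big_split/=; apply: eq_bigr => q _; ring.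
ring.
Qed.

Lemma aform_sum I eps sigma S (J : Type) (r : seq J) (w : J -> R) (b : J -> 'rV[R]_d -> R) h :
  (forall t, smd (b t)) -> smd h ->
  aform I eps sigma S (fun x => \sum_(t <- r) w t * b t x) h = \sum_(t <- r) w t * aform I eps sigma S (b t) h.
Proof.
move=> sb sh; have z : aform I eps sigma S (fun=> 0) h = 0.
  have := aform_lin I eps sigma S (-1) (smd_cst d 0) (smd_cst d 0) sh.
  rewrite (_ : (fun x : 'rV[R]_d => 0 + -1 * 0) = fun=> 0); first by lra.
  by apply/funext => x; rewrite mulr0 addr0.
elim: r => [|t r IH]; first by under [X in aform _ _ _ _ X]eq_fun do rewrite big_nil; rewrite z big_nil.
under [X in aform _ _ _ _ X]eq_fun do rewrite big_cons addrC.
rewrite aform_lin//; last by apply: smd_sum => k _; apply: smd_mul => //; exact: smd_cst.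
by rewrite IH big_cons addrC.
Qed.

Lemma stabilizationE sigma (Omega : set 'rV[R]_d) M S g g' : 0 < sigma -> uniq S ->
  (forall i, (i \in S) <-> active sigma Omega i) ->
  stabilization sigma Omega M P (g \_ (fictitious sigma Omega)) (g' \_ (fictitious sigma Omega)) =
  jform sigma [seq i <- S | `[< cut_index sigma Omega M i >]] g g'.
Proof.
move=> s0 uS SP; rewrite /stabilization /jform; congr (_ * _).
set S' := [seq i <- S | _]; have uS' : uniq S' by exact: filter_uniq.
have -> : [set i | element sigma i `<=` cut_part sigma Omega M] = [set` S'].
  apply/seteqP; split => i /=; rewrite mem_filter; last by move=> /andP[/asboolP].
  move=> ci; apply/andP; split; first exact/asboolP.
  by apply/SP; have [] := (cutP Omega M s0 i).1 ci.
rewrite -(fsbig_seq _ _ uS'); rewrite big_seq [RHS]big_seq; apply: eq_bigr => i iS'.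
apply: eq_bigr => e _; apply: eq_Rintegral => x /set_mem xi.
(* Every point of the open element has a neighbourhood inside the fictitious domain, where
   truncation changes nothing. *)
have H f : partial e (f \_ (fictitious sigma Omega)) x = partial e f x.
  apply: near_iter_partial; have oE := @open_element R d sigma i.
  near=> y; have yi : element sigma i y by near: y; exact: open_nbhs_nbhs.
  rewrite patchE mem_set//; apply: (activeP Omega s0 i).2 yi.
  by apply/SP; move: iS'; rewrite mem_filter => /andP[].
by rewrite !H.
Unshelve. all: by end_near.
Qed.

Lemma stabilized_formE sigma (Omega : set 'rV[R]_d) M I eps S g g' : 0 < sigma -> uniq S -> open Omega ->
  (forall i, (i \in S) <-> active sigma Omega i) -> (forall q, q \in I -> Omega q.2) ->
  stabilized_form Omega M P sigma eps I (g \_ (fictitious sigma Omega)) (g' \_ (fictitious sigma Omega)) =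
  aform I eps sigma [seq i <- S | `[< cut_index sigma Omega M i >]] g g'.
Proof.
move=> s0 uS oO SP IO; rewrite /stabilized_form (stabilizationE _ _ _ s0 uS SP); congr (_ + _).
rewrite /quad big_seq [RHS]big_seq; apply: eq_bigr => q qI.
by rewrite !patchE mem_set//; apply: sub_fictitious => //; exact: IO.
Qed.

(** Bounds the energy of the test function in the term j(v, e) by N(e). *)
Lemma jform_inverse : exists2 C, 0 <= C & forall sigma S (p : pred 'rV[int]_d) s c, 0 < sigma ->
  jform sigma [seq i <- S | p i] (comb sigma s c) (comb sigma s c) <= C * nsq sigma S (comb sigma s c).
Proof.
have [C C0 HC] := comb_partial_inverse R d P; exists C => // sigma S p s c s0.
set g := comb sigma s c; have sg : smd g by exact: smd_comb.
rewrite /jform /nsq !mulr_sumr big_filter; apply: le_trans (_ : \sum_(i <- S | p i) C * sq (element sigma i) g <= _).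
  apply: ler_sum => i _; have := HC sigma s c i s0; rewrite -/g.
  rewrite sqintE; last by apply: L2fun_element; exact: smd_continuous.
  rewrite (eq_bigr (fun e => (\int[mu]_(x in element sigma i) (partial e g x * partial e g x))%:E)).
    by rewrite sumEFin -!EFinM lee_fin.
  by move=> e _; rewrite sqintE//; apply: L2fun_element; exact: continuous_partial.
rewrite [leRHS](bigID p)/= lerDl sumr_ge0// => i _; rewrite mulr_ge0// sq_ge0//.
Qed.

Lemma nsq_stability K : exists2 C, 0 <= C & forall sigma (Omega : set 'rV[R]_d) M S s c,
  0 < sigma -> open Omega -> coord_bounded Omega -> cut_chains sigma Omega M K ->
  uniq S -> (forall i, (i \in S) <-> active sigma Omega i) ->
  nsq sigma S (comb sigma s c) <= C * (sq Omega (comb sigma s c) +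
    jform sigma [seq i <- S | `[< cut_index sigma Omega M i >]] (comb sigma s c) (comb sigma s c)).
Proof.
have [C C0 HC] := @stability R d P K; exists C => // sigma Omega M S s c s0 oO bO chains uS SP.
set g := comb sigma s c; have sg : smd g by exact: smd_comb.
have := HC _ _ _ _ s c s0 oO chains uS SP.
rewrite -/g -[X in (X <= _)%E]/(esqint sigma S g) nsqE; last exact: smd_continuous.
rewrite -[X in (_ <= _ * (X + _))%E]/(sqint Omega g) sqintE; last first.
  by apply: L2fun_continuous => //; [exact: open_measurable_rV|exact: smd_continuous].
rewrite (eq_bigr (fun i => (sigma ^+ (2 * P.+1) * \sum_(e : mindex d P.+1 | mdeg e == P.+1)
  \int[mu]_(x in element sigma i) (partial e g x * partial e g x))%:E)).
  by rewrite sumEFin -EFinD -EFinM lee_fin /jform mulr_sumr.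
move=> i _; rewrite EFinM -sumEFin; congr (_ * _)%E; apply: eq_bigr => e _.
rewrite -[LHS]/(sqint (element sigma i) (partial e g)) sqintE//.
by apply: L2fun_element; exact: continuous_partial.
Qed.

End forms.

(** * Unique solvability of the discrete problem *)

Section discrete_problem.
Variables (R : realType) (d P : nat).
Local Notation mu := (lebesgue_rV R d).
Local Notation comb := (@comb R d P).
Implicit Types (f g : 'rV[R]_d -> R) (i j : 'rV[int]_d) (sigma : R) (x : 'rV[R]_d).
Implicit Types (S T s : seq 'rV[int]_d) (c : 'rV[int]_d -> mindex d P -> R).

(* In a trial function the coefficients depend on the node only, so that a
   repeated node counts with its multiplicity. *)
Definition repeat_coef s c i a : R := (count_mem i s)%:R * c i a.

Lemma comb_undup sigma s T c : uniq T -> {subset s <= T} ->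
  comb sigma s c = comb sigma T (repeat_coef s c).
Proof.
move=> uT; rewrite /comb => sT; apply/funext => x.
pose Y i := \sum_(a : mindex d P | (mdeg a <= P)%N) c i a * (pu sigma i x * monomial a x).
transitivity (\sum_(i <- T) (count_mem i s)%:R * Y i); last first.
  apply: eq_bigr => i _; rewrite /Y mulr_sumr; apply: eq_bigr => a _.
  by rewrite /repeat_coef mulrA.
rewrite -/(Y _) (eq_bigr Y)//; elim: s sT => [|k s IH] sT.
  by rewrite big_nil big1// => i _; rewrite mul0r.
have kT : k \in T by apply: sT; rewrite mem_head.
rewrite big_cons IH; last by move=> i si; apply: sT; rewrite inE si orbT.
rewrite /=; under [RHS]eq_bigr do rewrite natrD mulrDl.
rewrite big_split/=; congr (_ + _).
by rewrite (bigD1_seq k)//= eqxx mul1r big1 ?addr0// => i /negbTE; rewrite eq_sym => ->; rewrite mul0r.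
Qed.

Lemma comb_coef_lin sigma T c c' k x :
  comb sigma T (fun i a => c i a + k * c' i a) x = comb sigma T c x + k * comb sigma T c' x.
Proof.
rewrite /comb mulr_sumr -big_split/=; apply: eq_bigr => i _.
rewrite mulr_sumr -big_split/=; apply: eq_bigr => a _; ring.
Qed.

Lemma comb_lin sigma s c s' c' k : exists s'' c'', forall x,
  comb sigma s'' c'' x = comb sigma s c x + k * comb sigma s' c' x.
Proof.
pose T := undup (s ++ s'); have uT : uniq T by exact: undup_uniq.
exists T, (fun i a => repeat_coef s c i a + k * repeat_coef s' c' i a) => x.
rewrite comb_coef_lin -!comb_undup// => i; rewrite mem_undup mem_cat => ->//; rewrite orbT//.
Qed.

Definition grid_nodes S : seq 'rV[int]_d :=
  undup [seq j + corner b | j <- S, b <- enum {: {ffun 'I_d -> bool}}].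

(** Trial functions use arbitrary finite lists of nodes. On the closures of the active elements only
    the nodes of these elements matter, which makes the trial space finite-dimensional. *)
Lemma comb_grid_nodes sigma S s c j x : 0 < sigma -> j \in S -> closure (element sigma j) x ->
  comb sigma s c x = comb sigma (grid_nodes S) (repeat_coef s c) x.
Proof.
move=> s0 jS xj; rewrite (@comb_undup sigma s (undup s) c) ?undup_uniq//; last first.
  by move=> i; rewrite mem_undup.
apply: big_seq_support; rewrite ?undup_uniq// => i Yi.
have [b ib] : exists b, i = j + corner b.
  apply: (pu_off s0 xj); apply: contraNneq Yi => p0.
  by rewrite big1// => a _; rewrite p0 mul0r mulr0.
have -> : i \in grid_nodes S.
  by rewrite mem_undup; apply/allpairsP; exists (j, b); rewrite mem_enum.
rewrite mem_undup; apply: contraNT Yi => /count_memPn si.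
by rewrite big1// => a _; rewrite /repeat_coef si !mul0r.
Qed.

Definition bidx T := ('I_(size T) * mindex d P)%type.

(** Zero for multi-indices of too high degree, so that the index type can be the full product
    [bidx]. *)
Definition bfun sigma T (t : bidx T) x : R :=
  if (mdeg t.2 <= P)%N then pu sigma (tnth (in_tuple T) t.1) x * monomial t.2 x else 0.

Lemma smd_bfun sigma T (t : bidx T) : 0 < sigma -> smd (bfun sigma t).
Proof.
move=> s0; rewrite /bfun; have [aP|aP] := boolP (mdeg t.2 <= P)%N; last exact: smd_cst.
by apply: smd_mul; [exact: smd_pu|exact: smd_monomial].
Qed.

Lemma comb_bfun sigma T c x :
  comb sigma T c x = \sum_(t : bidx T) c (tnth (in_tuple T) t.1) t.2 * bfun sigma t x.
Proof.
rewrite /comb big_tnth.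
rewrite (pair_big xpredT (fun a : mindex d P => (mdeg a <= P)%N) (fun k a => c (tnth (in_tuple T) k) a * (pu sigma (tnth (in_tuple T) k) x * monomial a x)))/=.
rewrite big_mkcond; apply: eq_bigr => -[k a] _ /=; rewrite /bfun/=.
by case: ifP => //; rewrite mulr0.
Qed.

Lemma bfun_comb sigma T (w : bidx T -> R) : uniq T ->
  exists c, forall x, comb sigma T c x = \sum_(t : bidx T) w t * bfun sigma t x.
Proof.
move=> uT; exists (fun i a => oapp (fun k => w (k, a)) 0 (insub (index i T))) => x.
rewrite comb_bfun; apply: eq_bigr => -[k a] _ /=; congr (_ * _).
have -> : index (tnth (in_tuple T) k) T = k by rewrite (tnth_nth 0) index_uniq.
by rewrite valK.
Qed.

Section problem.
Variables (sigma eps kappa : R) (Omega : set 'rV[R]_d) (M : set 'rV[int]_d).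
Variables (S : seq 'rV[int]_d) (I : seq (R * 'rV[R]_d)) (k : nat) (uh : ('rV[R]_d -> R) -> R).
Hypotheses (s0 : 0 < sigma) (oO : open Omega) (bO : coord_bounded Omega).
Hypotheses (uS : uniq S) (SP : forall i, (i \in S) <-> active sigma Omega i).
Hypothesis IO : forall q, q \in I -> Omega q.2.
Local Notation F := (fictitious sigma Omega).
Local Notation S' := [seq i <- S | `[< cut_index sigma Omega M i >]].
Hypothesis k0 : 0 < kappa.
Hypothesis coercive : forall s c, kappa * nsq sigma S (comb sigma s c) <=
  aform P I eps sigma S' (comb sigma s c) (comb sigma s c).
Hypothesis duh : sobolev_dual Omega k uh.

Lemma fictitious_closure x : F x -> exists2 j, j \in S & closure (element sigma j) x.
Proof. by move=> /interior_subset[j aj xj]; exists j => //; apply/SP. Qed.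

(** Zero norm makes [g] vanish on each active element, and continuity carries this to the closures,
    which make up the fictitious domain. *)
Lemma nsq_eq0 g : smd g -> nsq sigma S g <= 0 -> g \_ F = fun=> 0.
Proof.
move=> sg n0; have cg := smd_continuous sg.
have Z j : j \in S -> forall x, element sigma j x -> g x = 0.
  move=> jS; apply: continuous_integral_eq0 => //; first exact: open_element.
  have j0 : \int[mu]_(x in element sigma j) (g x ^+ 2) = 0.
    apply/eqP; rewrite eq_le (sq_ge0 _ g) andbT; apply: le_trans n0.
    by rewrite /nsq (big_rem j)//= lerDl sumr_ge0// => i _; exact: sq_ge0.
  by have := sqintE (L2fun_element sigma j cg); rewrite j0.
apply/funext => x; rewrite patchE; case: ifPn => // /set_mem /fictitious_closure[j jS xj].
exact: (vanishes_on_closure cg (Z j jS) xj).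
Qed.

Lemma uh_lin (r : R) f g : smd f -> smd g ->
  uh ((fun x => f x + r * g x) \_ F) = uh (f \_ F) + r * uh (g \_ F).
Proof.
move=> sf sg; have [lin _] := duh.
have OF := sub_fictitious s0 oO.
have h f' : smd f' -> sobolev Omega k 2 (f' \_ F) by move=> ?; exact: sobolev_patch2.
rewrite addrC -(lin r _ _ (h _ sg) (h _ sf)); congr uh; apply/funext => x.
by rewrite !patchE; case: ifP => _; [rewrite addrC|rewrite mulr0 addr0].
Qed.

Lemma uh0 : uh (fun=> 0) = 0.
Proof.
have := uh_lin (-1) (smd_cst d 0) (smd_cst d 0).
rewrite (_ : (fun x : 'rV[R]_d => 0 + -1 * 0) = fun=> 0); last by apply/funext => x; rewrite mulr0 addr0.
rewrite (_ : (fun=> 0) \_ F = fun=> 0 :> R); first by lra.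
by apply/funext => x; rewrite patchE; case: ifP.
Qed.

Lemma uh_sum (J : Type) (r : seq J) (w : J -> R) (b : J -> 'rV[R]_d -> R) : (forall t, smd (b t)) ->
  uh ((fun x => \sum_(t <- r) w t * b t x) \_ F) = \sum_(t <- r) w t * uh (b t \_ F).
Proof.
move=> sb; elim: r => [|t r IH].
  rewrite big_nil -[RHS]uh0; congr uh; apply/funext => x; rewrite patchE big_nil; by case: ifP.
under [X in X \_ _]eq_fun do rewrite big_cons addrC.
rewrite uh_lin//; last by apply: smd_sum => q _; apply: smd_mul => //; exact: smd_cst.
by rewrite IH big_cons addrC.
Qed.

Lemma trial_comb s c : trial_space sigma Omega P (comb sigma s c \_ F).
Proof. by exists s, c. Qed.

Lemma form_trial s c s' c' :
  stabilized_form Omega M P sigma eps I (comb sigma s c \_ F) (comb sigma s' c' \_ F) =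
  aform P I eps sigma S' (comb sigma s c) (comb sigma s' c').
Proof. exact: stabilized_formE. Qed.

Let is_solution us := trial_space sigma Omega P us /\
  forall v, trial_space sigma Omega P v -> stabilized_form Omega M P sigma eps I us v = uh v.

(** The functions [bfun] generate the trial space but may be dependent, so the matrix may be
    singular. The system is still solvable: by coercivity a null vector represents a function that
    is zero on the fictitious domain, and [uh] vanishes there too. *)
Lemma solution_exists : exists us, is_solution us.
Proof.
pose T := grid_nodes S; have uT : uniq T by exact: undup_uniq.
pose b (t : bidx T) := bfun sigma t.
have sb t : smd (b t) by exact: smd_bfun.
have sbs (w : bidx T -> R) : smd (fun x => \sum_t w t * b t x).
  by apply: smd_sum => t _; apply: smd_mul => //; exact: smd_cst.
pose B (p t : bidx T) := aform P I eps sigma S' (b p) (b t).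
have BE (w v : bidx T -> R) : aform P I eps sigma S' (fun x => \sum_t w t * b t x) (fun x => \sum_t v t * b t x) =
    \sum_p \sum_t w p * v t * B p t.
  rewrite aform_sum//; apply: eq_bigr => p _; rewrite aform_sym aform_sum// mulr_sumr.
  by apply: eq_bigr => t _; rewrite aform_sym mulrA.
have [|w Hw] := @qform_solve _ _ B (fun t => uh (b t \_ F)) (fun p t => @aform_sym R d P I eps sigma S' (b p) (b t)).
  move=> v; rewrite /qform -BE => a0; have [c' Hc'] := bfun_comb sigma v uT.
  have E : comb sigma T c' = fun x => \sum_t v t * b t x by apply/funext => x; exact: Hc'.
  rewrite /pairing -uh_sum// -E nsq_eq0 ?uh0//; first exact: smd_comb.
  by have := coercive T c'; rewrite E a0 pmulr_rle0.
have [c' Hc'] := bfun_comb sigma w uT.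
have E : comb sigma T c' = fun x => \sum_t w t * b t x by apply/funext => x; exact: Hc'.
exists (comb sigma T c' \_ F); split; first exact: trial_comb.
move=> _ [s [c ->]].
pose cc (t : bidx T) := repeat_coef s c (tnth (in_tuple T) t.1) t.2.
have EF : comb sigma s c \_ F = (fun x => \sum_t cc t * b t x) \_ F.
  apply/funext => x; rewrite !patchE; case: ifPn => // /set_mem /fictitious_closure[j jS xj].
  by rewrite (comb_grid_nodes s c s0 jS xj) comb_bfun.
rewrite -[X in stabilized_form _ _ _ _ _ _ _ X = _]/(comb sigma s c \_ F).
rewrite -[X in _ = uh X]/(comb sigma s c \_ F) EF.
rewrite (stabilized_formE _ _ _ _ _ s0 uS oO SP IO) E BE uh_sum// exchange_big/=; apply: eq_bigr => t _.
by rewrite -Hw mulr_sumr; apply: eq_bigr => q _; ring.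
Qed.

(** The difference of two solutions has zero energy, hence zero norm; extension by zero turns
    equality on the fictitious domain into equality of functions. *)
Lemma solution_unique us us' : is_solution us -> is_solution us' -> us = us'.
Proof.
move=> [[s [c Es]] H] [[s' [c' Es']] H'].
change (us = comb sigma s c \_ F) in Es; change (us' = comb sigma s' c' \_ F) in Es'.
have [t [e He]] := comb_lin sigma s c s' c' (-1).
have sg := smd_comb s c s0; have sg' := smd_comb s' c' s0.
have Ee : comb sigma t e = fun x => comb sigma s c x + -1 * comb sigma s' c' x.
  by apply/funext => x; exact: He.
have a0 : aform P I eps sigma S' (comb sigma t e) (comb sigma t e) = 0.
  rewrite {1}Ee aform_lin//; last exact: smd_comb.
  rewrite -!form_trial -Es -Es' H; last exact: trial_comb.
  rewrite H'; last exact: trial_comb.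
  lra.
have := coercive t e; rewrite a0 pmulr_rle0// => /(nsq_eq0 (smd_comb t e s0)) Z.
rewrite Es Es'; apply/funext => x; have := congr1 (@^~ x) Z; rewrite !patchE He.
by case: ifP => // _; lra.
Qed.

End problem.
End discrete_problem.

(** * Error estimate *)

Section error.
Variables (R : realType) (d P m : nat).
Local Notation mu := (lebesgue_rV R d).
Local Notation comb := (@comb R d P).
Implicit Types (f g : 'rV[R]_d -> R) (i j : 'rV[int]_d) (sigma : R) (x : 'rV[R]_d).
Implicit Types (S T s : seq 'rV[int]_d) (c : 'rV[int]_d -> mindex d P -> R).

(** The optimal weight is t = B/A. If [A] or [B] is zero, a very large or very small [t] shows X <=
    0. *)
Lemma young_cs (X A B : R) : 0 <= A -> 0 <= B -> (forall t, 0 < t -> X <= t * A ^+ 2 + t^-1 * B ^+ 2) ->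
  X <= 2 * (A * B).
Proof.
move=> A0 B0 H; have [A00|An0] := eqVneq A 0.
  rewrite A00 in H *; rewrite mul0r mulr0 leNgt; apply/negP => X0.
  (* For this t the bound becomes X B^2 / (2 (B^2 + 1)), which is less than a positive X. *)
  have t0 : 0 < 2 * (B ^+ 2 + 1) / X by rewrite !mulr_gt0 ?invr_gt0// ltr_wpDl// sqr_ge0.
  have := H _ t0; rewrite [0 ^+ 2]expr0n mulr0 add0r invf_div.
  have b1 : 0 < B ^+ 2 + 1 by rewrite ltr_wpDl// sqr_ge0.
  rewrite mulrAC ler_pdivlMr ?mulr_gt0//; have := sqr_ge0 B; nra.
have [B00|Bn0] := eqVneq B 0.
  rewrite B00 in H *; rewrite !mulr0 leNgt; apply/negP => X0.
  have a1 : 0 < 2 * (A ^+ 2 + 1) by rewrite mulr_gt0// ltr_wpDl// sqr_ge0.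
  have := H (X / (2 * (A ^+ 2 + 1))); rewrite divr_gt0// => /(_ isT).
  rewrite [0 ^+ 2]expr0n mulr0 addr0 mulrAC ler_pdivlMr//; have := sqr_ge0 A; nra.
have A1 : 0 < A by rewrite lt_def An0.
have B1 : 0 < B by rewrite lt_def Bn0.
have := H (B / A); rewrite divr_gt0// => /(_ isT)/le_trans; apply.
rewrite le_eqVlt; apply/orP; left; apply/eqP; field.
by rewrite An0 Bn0.
Qed.

Lemma mesh_ratio_small (s eta : R) : 1 < s -> 0 < eta -> exists2 sigma0 : R, 0 < sigma0 <= 1 &
  forall sigma, 0 < sigma < sigma0 -> (sigma `^ s) ^+ m.+1 * sigma ^- m.+1 <= eta.
Proof.
move=> s1 eta0; pose e1 := Num.min 1 eta.
have e0 : 0 < e1 by rewrite lt_min ltr01.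
have e11 : e1 <= 1 by rewrite ge_min lexx.
have s10 : 0 < s - 1 by rewrite subr_gt0.
(* Since h/sigma = sigma^(s-1), this threshold gives h/sigma <= e1. As e1 <= 1, the power m+1 is
   then also at most e1, hence at most eta. *)
exists (e1 `^ (s - 1)^-1).
  rewrite powR_gt0//=; apply: le_trans (_ : 1 `^ (s - 1)^-1 <= _); last by rewrite powR1.
  by apply: ge0_ler_powR; rewrite ?nnegrE ?invr_ge0 ?(ltW s10) ?(ltW e0).
move=> sigma /andP[sg0 sg1].
have -> : sigma `^ s = sigma `^ (s - 1) * sigma.
  rewrite -[X in _ * X](powRr1 (ltW sg0)) -powRD; first by rewrite subrK.
  by apply/implyP => _; rewrite gt_eqF.
rewrite exprMn -mulrA mulfV ?mulr1 ?expf_neq0 ?gt_eqF//.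
have h : sigma `^ (s - 1) <= e1.
  apply: le_trans (_ : (e1 `^ (s - 1)^-1) `^ (s - 1) <= _).
    by apply: ge0_ler_powR; rewrite ?nnegrE ?powR_ge0 ?(ltW sg0) ?(ltW sg1) ?(ltW s10).
  by rewrite -powRrM mulVf ?gt_eqF// powRr1// ltW.
apply: le_trans (_ : e1 ^+ m.+1 <= _).
  by apply: lerXn2r => //; rewrite nnegrE ?powR_ge0 ?(ltW e0).
apply: le_trans (_ : e1 <= _); last by rewrite ge_min lexx orbT.
by rewrite exprS ler_piMr ?(ltW e0)// exprn_ile1// ltW.
Qed.

Section domain.
Variables (sigma : R) (Omega : set 'rV[R]_d) (S : seq 'rV[int]_d).
Hypotheses (s0 : 0 < sigma) (oO : open Omega) (bO : coord_bounded Omega).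
Hypotheses (uS : uniq S) (SP : forall i, (i \in S) <-> active sigma Omega i).

Lemma domain_cover x : Omega x -> ~ grid_lines sigma x -> exists2 i, i \in S & element sigma i x.
Proof.
move=> Ox nx; have [i ai xi] := fictitious_off s0 (sub_fictitious s0 oO Ox) nx.
by exists i => //; apply/SP.
Qed.

Lemma sqint_domain_le w : measurable_fun setT w -> (sqint Omega w <= esqint sigma S w)%E.
Proof.
move=> mw; apply: integral_le_cover.
- exact: open_measurable_rV.
- by apply/measurable_EFinP; exact: measurable_funX.
- by move=> x; rewrite lee_fin sqr_ge0.
- exact: domain_cover.
Qed.

Lemma sq_domain_le g : smd g -> sq Omega g <= nsq sigma S g.
Proof.
move=> sg; have cg := smd_continuous sg; rewrite -lee_fin -nsqE// -sqintE.
  by apply: sqint_domain_le; exact: continuous_measurable_rV.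
by apply: L2fun_continuous => //; exact: open_measurable_rV.
Qed.

End domain.

(** A product of trial functions is smooth and can be inserted into the quadrature bound itself; its
    seminorm of order m+1 costs sigma^-(m+1). The estimates for truncated functions are used with
    the whole space as truncating set. *)
Lemma quad_comb : exists2 Cp, 0 <= Cp & forall sigma (Omega : set 'rV[R]_d) S I h C_I s c s' c' t,
  0 < sigma -> open Omega -> coord_bounded Omega -> (forall i, (i \in S) <-> active sigma Omega i) ->
  0 <= h -> quadrature_rule Omega m h C_I I -> 0 < t ->
  `|\int[mu]_(x in Omega) (comb sigma s c x * comb sigma s' c' x) -
    quad I (fun x => comb sigma s c x * comb sigma s' c' x)| <=
  (`|C_I| * Cp * (h ^+ m.+1 * sigma ^- m.+1)) *
    (t * nsq sigma S (comb sigma s c) + t^-1 * nsq sigma S (comb sigma s' c')).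
Proof.
have [Cp Cp0 HCp] := comb_product_bound R d P m.+1; exists Cp => //.
move=> sigma Omega S I h C_I s c s' c' t s0 oO bO SP h0 [_ qI] t0.
set g := comb sigma s c; set g' := comb sigma s' c'.
have sg : smd g by exact: smd_comb.
have sg' : smd g' by exact: smd_comb.
have sgg : smd (fun x => g x * g' x) by exact: smd_mul.
have pT f : f \_ setT = f by apply/funext => x; rewrite patchE mem_set.
have sob : sobolev Omega m.+1 1 (fun x => g x * g' x).
  by rewrite -(pT (fun x => g x * g' x)); exact: sobolev_patch1.
have ct : {within Omega, continuous (fun x => g x * g' x)}.
  by apply: continuous_subspaceT; exact: smd_continuous.
have := qI _ ct sob => H.
have := HCp sigma s c s' c' Omega setT S t s0 t0 oO (@subsetT _ Omega) (domain_cover s0 oO SP).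
rewrite pT !nsqE; try exact: smd_continuous.
move=> H2'; have H2 : (sobolev_seminorm Omega m.+1 1 (fun x => g x * g' x)%R <=
    (Cp * sigma ^- m.+1 * (t * nsq sigma S g + t^-1 * nsq sigma S g'))%:E)%E := H2'.
have K0 : 0 <= `|C_I| * h ^+ m.+1 by rewrite mulr_ge0// exprn_ge0.
have K1 : C_I * h ^+ m.+1 <= `|C_I| * h ^+ m.+1 by rewrite ler_wpM2r ?exprn_ge0 ?ler_norm.
have := le_trans H (lee_wpmul2r (poweR_ge0 _ _) (_ : ((C_I * h ^+ m.+1)%:E <= (`|C_I| * h ^+ m.+1)%:E)%E)).
rewrite lee_fin => /(_ K1) H3; have := le_trans H3 (lee_wpmul2l _ H2).
rewrite lee_fin => /(_ K0); rewrite -EFinM lee_fin => /le_trans; apply.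
rewrite le_eqVlt; apply/orP; left; apply/eqP; ring.
Qed.

End error.

(** * Coercivity of the perturbed form and the comparison function *)

Section main_estimate.
Variables (R : realType) (d P m : nat).
Local Notation mu := (lebesgue_rV R d).
Local Notation comb := (@comb R d P).
Implicit Types (f g w u : 'rV[R]_d -> R) (i j : 'rV[int]_d) (sigma : R) (x : 'rV[R]_d).
Implicit Types (S T s : seq 'rV[int]_d) (c : 'rV[int]_d -> mindex d P -> R).

Lemma coercivity K (eps C_I : R) : 0 < eps -> exists kappa eta : R, [/\ 0 < kappa, 0 < eta &
  forall sigma (Omega : set 'rV[R]_d) M S I h s c,
  0 < sigma -> open Omega -> coord_bounded Omega -> uniq S ->
  (forall i, (i \in S) <-> active sigma Omega i) -> cut_chains sigma Omega M K ->
  0 <= h -> quadrature_rule Omega m h C_I I -> h ^+ m.+1 * sigma ^- m.+1 <= eta ->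
  kappa * nsq sigma S (comb sigma s c) <=
  aform P I eps sigma [seq i <- S | `[< cut_index sigma Omega M i >]] (comb sigma s c) (comb sigma s c)].
Proof.
move=> eps0; have [Cs Cs0 HCs] := nsq_stability R d P K.
have [Cp Cp0 HCp] := quad_comb R d P m.
pose mn := Num.min 1 eps.
have mn0 : 0 < mn by rewrite lt_min ltr01.
(* Half of the coercivity constant of the form with exact integration; the other half absorbs the
   quadrature error. The 1 added to [Cs] makes the denominator positive. *)
pose kappa := mn / (2 * (Cs + 1)).
have Cs1 : 0 < Cs + 1 by rewrite ltr_wpDl.
have kappa0 : 0 < kappa by rewrite divr_gt0// mulr_gt0.
pose Q := 2 * (`|C_I| * Cp) + 1.
have Q0 : 0 < Q by rewrite ltr_wpDl// !mulr_ge0.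
exists kappa, (kappa / Q); split => //; first by rewrite divr_gt0.
move=> sigma Omega M S I h s c s0 oO bO uS SP chains h0 qI small.
set g := comb sigma s c; have sg : smd g by exact: smd_comb.
have hs := HCs _ _ _ _ s c s0 oO bO chains uS SP; rewrite -/g in hs.
have hq := HCp _ _ _ _ _ _ s c s c 1 s0 oO bO SP h0 qI ltr01; rewrite -/g in hq.
have N0 := nsq_ge0 sigma S g.
have J0 : 0 <= jform P sigma [seq i <- S | `[< cut_index sigma Omega M i >]] g g by exact: jform_ge0.
have L0 := sq_ge0 Omega g.
have E : \int[mu]_(x in Omega) (g x * g x) = sq Omega g.
  by apply: eq_Rintegral => x _; rewrite expr2.
rewrite /aform; move: hs hq N0 J0 L0; rewrite E.
set N := nsq _ _ _; set J := jform _ _ _ _ _; set L := sq _ _; set q := quad _ _.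
move=> hs hq N0 J0 L0.
have hq1 : L - q <= kappa * N.
  apply: le_trans (ler_norm _) _; apply: le_trans hq _.
  have h1 : `|C_I| * Cp * (h ^+ m.+1 * sigma ^- m.+1) * 2 <= kappa.
    apply: le_trans (_ : Q * (h ^+ m.+1 * sigma ^- m.+1) <= _).
      have : 0 <= h ^+ m.+1 * sigma ^- m.+1 by rewrite mulr_ge0 ?invr_ge0 ?exprn_ge0// ltW.
      rewrite /Q; move: (_ * _ ^- _) (`|C_I| * Cp) => a b; nra.
    by move: small; rewrite ler_pdivlMr// mulrC.
  have -> : 1 * N + 1^-1 * N = 2 * N by rewrite invr1; ring.
  by rewrite mulrA ler_wpM2r.
have h3 : 2 * kappa * N <= mn * (L + J).
  have : 2 * kappa * N <= 2 * kappa * ((Cs + 1) * (L + J)).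
    apply: ler_wpM2l; first by rewrite mulr_ge0// ltW.
    by apply: le_trans hs _; rewrite ler_wpM2r ?addr_ge0// lerDl.
  by rewrite (_ : 2 * kappa * ((Cs + 1) * (L + J)) = mn * (L + J))// /kappa; field; rewrite gt_eqF.
have m1 : mn * L <= L by rewrite ler_piMl// ge_min lexx.
have m2 : mn * J <= eps * J by rewrite ler_wpM2r// ge_min lexx orbT.
move: h3; rewrite mulrDr; lra.
Qed.

(** [w] extends [u], because the elements and patches at the boundary reach beyond the domain. The
    bounds are squares of multiples of a real number [U], the form in which [galerkin_error] takes
    them. *)
Lemma best_approximation (C_BH Mx : R) : 0 <= Mx -> exists c1 c2 : R, [/\ 0 <= c1, 0 <= c2 &
  forall sigma (Omega : set 'rV[R]_d) M S u w (U : R),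
  0 < sigma <= 1 -> open Omega -> coord_bounded Omega -> uniq S ->
  (forall i, (i \in S) <-> active sigma Omega i) -> bramble_hilbert sigma Omega P C_BH ->
  sobolev setT P.+1 2 w -> (sobolev_norm setT P.+1 2 w <= (Mx * U)%:E)%E -> 0 <= U ->
  measurable_fun Omega u -> {ae mu, forall x, Omega x -> w x = u x} ->
  exists T c, [/\ sqint Omega (fun x => u x - comb sigma T c x)%R <= ((c1 * (sigma ^+ P.+1 * U)) ^+ 2)%:E,
    (jform P sigma [seq i <- S | `[< cut_index sigma Omega M i >]] (comb sigma T c) (comb sigma T c) <=
      (c1 * (sigma ^+ P.+1 * U)) ^+ 2)%R &
    (nsq sigma S (comb sigma T c) <= (c2 * U) ^+ 2)%R]%E].
Proof.
move=> Mx0; have [Ci Ci0 HCi] := interpolation d P C_BH.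
(* [Ci] bounds squared norms; Ci + 1 is at least its square root, which avoids taking roots. *)
pose c1 := (Ci + 1) * Mx; have c10 : 0 <= c1 by rewrite mulr_ge0// addr_ge0.
exists c1, (2 * (Mx + c1)); split => //; first by rewrite mulr_ge0// addr_ge0.
move=> sigma Omega M S u w U /andP[s0 s1] oO bO uS SP BH sw wU U0 mu_ wu.
have mO := open_measurable_rV oO.
have mw : measurable_fun setT w by have [] := sobolev_loc_integrable sw.
have [T [c [h1 h2]]] := HCi sigma Omega S w s0 uS SP BH sw; exists T, c.
set v := comb sigma T c in h1 h2 *; have sv : smd v by exact: smd_comb.
have cv := smd_continuous sv; have mv : measurable_fun setT v by exact: continuous_measurable_rV.
have p0 : 0 <= sigma ^+ P.+1 by rewrite exprn_ge0// ltW.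
have p1 : sigma ^+ P.+1 <= 1 by rewrite exprn_ile1// ltW.
have nw : (sobolev_norm setT P.+1 2 w `^ 2 <= ((Mx * U) ^+ 2)%:E)%E.
  apply: le_trans (_ : ((Mx * U)%:E `^ 2 <= _)%E); last by rewrite poweR_EFin powR_mulrn// mulr_ge0.
  by apply: gt0_ler_poweR => //; rewrite in_itv/= leey ?sobolev_norm_ge0// lee_fin mulr_ge0.
have bound : ((Ci * sigma ^+ (2 * P.+1))%:E * sobolev_norm setT P.+1 2 w `^ 2 <=
    ((c1 * (sigma ^+ P.+1 * U)) ^+ 2)%:E)%E.
  have a0 : (0 <= (Ci * sigma ^+ (2 * P.+1))%:E)%E by rewrite lee_fin mulr_ge0// exprn_ge0// ltW.
  apply: le_trans (lee_wpmul2l a0 nw) _; rewrite -EFinM lee_fin.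
  rewrite mulnC exprM /c1; move: (sigma ^+ P.+1) => p.
  have e : ((Ci + 1) * Mx * (p * U)) ^+ 2 - Ci * p ^+ 2 * (Mx * U) ^+ 2 =
      ((Ci + 1) ^+ 2 - Ci) * (p * (Mx * U)) ^+ 2 by ring.
  rewrite -subr_ge0 e mulr_ge0 ?sqr_ge0//; nra.
have h1' := le_trans h1 bound; have h2' := le_trans h2 bound.
split.
- rewrite (@eq_sqint _ _ _ _ (fun x => w x - v x)) //.
  + by apply: le_trans (sqint_domain_le s0 oO SP _) h1'; exact: measurable_funB.
  + by apply: measurable_funB => //; exact: measurable_funTS.
  + by apply: measurable_funTS; exact: measurable_funB.
  + by apply: filterS wu => x wu Ox; rewrite wu.
- rewrite -lee_fin; apply: le_trans h2'.
  rewrite /jform mulr_sumr -sumEFin big_filter.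
  rewrite [leRHS](bigID (fun i => `[< cut_index sigma Omega M i >]))/= -[leLHS]adde0.
  apply: leeD; last first.
    apply: sume_ge0 => i _; rewrite mule_ge0 ?lee_fin ?exprn_ge0 ?(ltW s0)//.
    by apply: sume_ge0 => e _; exact: sqint_ge0.
  apply: lee_sum => i _; rewrite EFinM -sumEFin le_eqVlt; apply/orP; left; apply/eqP.
  congr (_ * _)%E; apply: eq_bigr => e _; rewrite sqintE//.
  by apply: L2fun_element; exact: continuous_partial.
rewrite -lee_fin -nsqE//.
have ew : (esqint sigma S w <= ((Mx * U) ^+ 2)%:E)%E.
  apply: le_trans nw; apply: le_trans (sqint_sobolev_norm openT sw).
  apply: sum_integral_element_le => //.
  - by apply/measurable_EFinP; exact: measurable_funX.
  - by move=> x; rewrite lee_fin sqr_ge0.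
have ev : (esqint sigma S v <= 2%:E * (esqint sigma S w + esqint sigma S (fun x => w x - v x)%R))%E.
  rewrite /esqint -big_split/= ge0_sume_distrr; last by move=> i _; rewrite adde_ge0// sqint_ge0.
  apply: lee_sum => i _; have mE := @measurable_element R d sigma i.
  have := @sqint_lin_le R d (element sigma i) w (fun x => w x - v x) (-1) mE.
  rewrite sqrrN expr1n mul1e => H; apply: le_trans (H _ _).
  - rewrite le_eqVlt; apply/orP; left; apply/eqP; apply: eq_integral => x _; congr (_ ^+ 2)%:E; ring.
  - exact: measurable_funTS.
  - by apply: measurable_funTS; exact: measurable_funB.
apply: le_trans ev _; apply: le_trans (lee_wpmul2l _ (leeD ew h1')) _ => //.
rewrite -EFinD -EFinM lee_fin.
have b1 : 0 <= Mx * U by rewrite mulr_ge0.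
have b2 : 0 <= c1 * (sigma ^+ P.+1 * U) <= c1 * U.
  apply/andP; split; first by apply: mulr_ge0 => //; exact: mulr_ge0.
  by apply: ler_wpM2l => //; rewrite -[leRHS]mul1r ler_wpM2r.
have -> : 2 * (Mx + c1) * U = 2 * (Mx * U + c1 * U) by ring.
move: b2 b1; move: (c1 * (_ * _)) (c1 * U) (Mx * U) => a b r /andP[a0 ab] r0.
have : a ^+ 2 <= b ^+ 2 by rewrite lerXn2r// nnegrE (le_trans a0).
have : 0 <= r * b by rewrite mulr_ge0// (le_trans a0).
have := sqr_ge0 r; have := sqr_ge0 b; rewrite exprMn sqrrD; lra.
Qed.

End main_estimate.

(** * Distance between the discrete solution and the comparison function *)

Section galerkin.
Variables (R : realType) (d P m : nat).
Local Notation mu := (lebesgue_rV R d).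
Local Notation comb := (@comb R d P).
Implicit Types (f g w u : 'rV[R]_d -> R) (i j : 'rV[int]_d) (sigma : R) (x : 'rV[R]_d).
Implicit Types (S T s : seq 'rV[int]_d) (c : 'rV[int]_d -> mindex d P -> R).

Lemma galerkin_error (eps C_I c1 c2 kappa Cu : R) : 0 < eps -> 0 <= c1 -> 0 <= c2 -> 0 < kappa -> 0 <= Cu ->
  exists2 C, 0 <= C & forall sigma (Omega : set 'rV[R]_d) M S I h u uh (U : R) T c us,
  0 < sigma <= 1 -> open Omega -> coord_bounded Omega -> uniq S ->
  (forall i, (i \in S) <-> active sigma Omega i) -> 0 <= h -> 0 <= U -> quadrature_rule Omega m h C_I I ->
  (forall s c, kappa * nsq sigma S (comb sigma s c) <=
    aform P I eps sigma [seq i <- S | `[< cut_index sigma Omega M i >]] (comb sigma s c) (comb sigma s c)) ->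
  (sqint Omega (fun x => u x - comb sigma T c x)%R <= ((c1 * (sigma ^+ P.+1 * U)) ^+ 2)%:E)%E ->
  jform P sigma [seq i <- S | `[< cut_index sigma Omega M i >]] (comb sigma T c) (comb sigma T c) <=
      (c1 * (sigma ^+ P.+1 * U)) ^+ 2 ->
  nsq sigma S (comb sigma T c) <= (c2 * U) ^+ 2 ->
  L2fun Omega u -> sobolev_dual Omega m.+1 uh ->
  (sobolev_dual_norm Omega m.+1 (fun v => uh v - L2_functional Omega u v)%R <=
    (Cu * h ^+ m.+1 * U)%:E)%E ->
  trial_space sigma Omega P us ->
  (forall v, trial_space sigma Omega P v -> stabilized_form Omega M P sigma eps I us v = uh v) ->
  (sqint Omega (fun x => u x - us x)%R <=
    ((C * ((sigma ^+ P.+1 + h ^+ m.+1 * sigma ^- m.+1) * U)) ^+ 2)%:E)%E.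
Proof.
move=> eps0 c10 c20 kappa0 Cu0.
have [Cn Cn0 HCn] := comb_norm_bound R d P m.+1.
have [Cj Cj0 HCj] := jform_inverse R d P.
have [Cp Cp0 HCp] := quad_comb R d P m.
pose CQ := `|C_I| * Cp; have CQ0 : 0 <= CQ by rewrite mulr_ge0.
(* The four summands belong, in this order, to the error of the data [uh], to u - v, to the
   quadrature of v e and to the stabilization. *)
pose c5 := Cu * (Cn + 1) + 2 * c1 + 2 * (CQ * c2) + eps * (2 * (c1 * (Cj + 1))).
have Cj1 : 0 <= Cj + 1 by rewrite addr_ge0.
have Cn1 : 0 <= Cn + 1 by rewrite addr_ge0.
have c50 : 0 <= c5 by rewrite !addr_ge0 ?mulr_ge0// ltW.
(* From u - us = (u - v) - e, and 2 (a^2 + b^2) <= (2 (a + b))^2 for nonnegative a and b. *)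
pose C := 2 * (c1 + c5 / kappa).
have C0 : 0 <= C by rewrite mulr_ge0// addr_ge0// divr_ge0// ltW.
exists C => // sigma Omega M S I h u uh U T c us /andP[s0 s1] oO bO uS SP h0 U0 qI coer E1 E2 E3 Lu duh Hu.
have mO := open_measurable_rV oO.
have OF := sub_fictitious s0 oO.
have [IO _] := qI.
move=> [s [c' Es]] Hsol; change (us = comb sigma s c' \_ (fictitious sigma Omega)) in Es.
set S' := [seq i <- S | _] in coer E2 *.
set v := comb sigma T c in E1 E2 E3 *; have sv : smd v by exact: smd_comb.
pose p := sigma ^+ P.+1; pose q := h ^+ m.+1 * sigma ^- m.+1; rewrite -/p -/q in E1 E2 *.
have p0 : 0 <= p by rewrite exprn_ge0// ltW.
have q0 : 0 <= q by rewrite mulr_ge0 ?invr_ge0 ?exprn_ge0// ltW.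
have [t [k Hk]] := comb_lin sigma s c' T c (-1).
set e := comb sigma t k in Hk *; have se : smd e by exact: smd_comb.
have sg : smd (comb sigma s c') by exact: smd_comb.
have Ee : e = fun x => comb sigma s c' x + -1 * v x by apply/funext => x; exact: Hk.
(* Testing the discrete equation with [e] removes the unknown solution from A_h(e, e). *)
have Ev : aform P I eps sigma S' e e = uh (e \_ (fictitious sigma Omega)) -
    (quad I (fun x => v x * e x) + eps * jform P sigma S' v e).
  rewrite {1}Ee aform_lin//.
  rewrite -(stabilized_formE P M _ (comb sigma s c') e s0 uS oO SP IO) -Es Hsol; last by exists t, k.
  by rewrite mulN1r.
pose r := Num.sqrt (nsq sigma S e).
have r0 : 0 <= r by exact: sqrtr_ge0.
have r2 : r ^+ 2 = nsq sigma S e by rewrite sqr_sqrtr// nsq_ge0.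
have Le : L2fun Omega e by apply: L2fun_continuous => //; exact: smd_continuous.
have Lv : L2fun Omega v by apply: L2fun_continuous => //; exact: smd_continuous.
have sqe : sq Omega e <= r ^+ 2 by rewrite r2; exact: (sq_domain_le s0 oO bO SP).
have Luv : L2fun Omega (fun x => u x - v x).
  have := L2fun_lin (-1) mO Lu Lv; congr L2fun; apply/funext => x; by rewrite mulN1r.
have E1' : sq Omega (fun x => u x - v x) <= (c1 * (p * U)) ^+ 2 by rewrite -lee_fin -sqintE.
have pU : 0 <= p * U by rewrite mulr_ge0.
have X0 : 0 <= c1 * (p * U) by rewrite mulr_ge0.
have rbound : r <= c5 / kappa * ((p + q) * U).
  (* The case r = 0 is set apart because the estimate is finally divided by [r], and because the
     bound [b] below must be positive. *)
  have [->|rn0] := eqVneq r 0; first by apply: mulr_ge0; [rewrite divr_ge0// ltW|rewrite mulr_ge0// addr_ge0].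
  have rp : 0 < r by rewrite lt_def rn0.
  have B1 : uh (e \_ (fictitious sigma Omega)) - \int[mu]_(x in Omega) (u x * e x) <=
      Cu * (Cn + 1) * (q * U) * r.
    apply: le_trans (ler_norm _) _.
    (* A bound for the Sobolev norm of [e] of order m+1, by the inverse estimate; Cn + 1 dominates
       the square root of [Cn]. *)
    pose b := (Cn + 1) * sigma ^- m.+1 * r.
    have b0 : 0 < b by rewrite !mulr_gt0 ?invr_gt0 ?exprn_gt0// ltr_wpDl.
    have := @dual_bound R d Omega (fictitious sigma Omega) m.+1 uh u _ b e oO bO OF duh Lu Hu se b0.
    rewrite (_ : Cu * h ^+ m.+1 * U * b = Cu * (Cn + 1) * (q * U) * r); last by rewrite /b /q; ring.
    apply; apply: poweR2_le; rewrite ?sobolev_norm_ge0// ?lee_fin ?(ltW b0)//.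
    have s01 : 0 < sigma <= 1 by rewrite s0.
    have := HCn sigma t k Omega _ S s01 oO OF (domain_cover s0 oO SP).
    rewrite -/e nsqE; last exact: smd_continuous.
    move=> /le_trans; apply; rewrite poweR_EFin powR_mulrn ?(ltW b0)// -EFinM lee_fin -r2.
    rewrite /b mulnC exprM -[in leLHS]exprVn; move: (sigma ^- m.+1) => y.
    have ee : ((Cn + 1) * y * r) ^+ 2 - Cn * y ^+ 2 * r ^+ 2 = ((Cn + 1) ^+ 2 - Cn) * (y * r) ^+ 2 by ring.
    rewrite -subr_ge0 ee mulr_ge0 ?sqr_ge0//; nra.
  have B2 : \int[mu]_(x in Omega) ((u x - v x) * e x) <= 2 * (c1 * (p * U) * r).
    apply: young_cs => // t' t0; apply: le_trans (ler_norm _) _.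
    apply: le_trans (young_L2 mO t0 Luv Le) _.
    by apply: lerD; rewrite ler_wpM2l// ?invr_ge0 ltW.
  have B3 : \int[mu]_(x in Omega) (v x * e x) - quad I (fun x => v x * e x) <= 2 * (CQ * q * (c2 * U) * r).
    have -> : 2 * (CQ * q * (c2 * U) * r) = CQ * q * (2 * (c2 * U * r)) by ring.
    (* The weight is optimised after division by CQ q, which must therefore be nonzero. *)
    have [Z|Zn] := eqVneq (CQ * q) 0.
      rewrite Z !mul0r; apply: le_trans (ler_norm _) _.
      by apply: le_trans (HCp _ _ _ _ _ _ T c t k 1 s0 oO bO SP h0 qI ltr01) _; rewrite -/CQ -/q Z mul0r.
    have Zp : 0 < CQ * q by rewrite lt_def Zn mulr_ge0.
    rewrite -ler_pdivrMl//; apply: young_cs; rewrite ?mulr_ge0// => t' t0.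
    rewrite ler_pdivrMl//; apply: le_trans (ler_norm _) _.
    apply: le_trans (HCp _ _ _ _ _ _ T c t k t' s0 oO bO SP h0 qI t0) _; rewrite -/CQ -/q.
    rewrite ler_wpM2l ?(ltW Zp)//; apply: lerD; rewrite ler_wpM2l ?invr_ge0 ?(ltW t0)//.
    by rewrite r2.
  have B4 : - jform P sigma S' v e <= 2 * (c1 * (p * U) * ((Cj + 1) * r)).
    apply: young_cs; rewrite ?mulr_ge0// => t' t0; apply: le_trans (ler_norm _) _; rewrite normrN.
    apply: le_trans (jform_young P S' s0 t0 sv se) _.
    apply: lerD; rewrite ler_wpM2l ?invr_ge0 ?(ltW t0)//.
    apply: le_trans (HCj _ _ _ _ _ s0) _; rewrite -/e -r2 exprMn ler_wpM2r ?sqr_ge0//; nra.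
  have Iuv : \int[mu]_(x in Omega) ((u x - v x) * e x) =
      \int[mu]_(x in Omega) (u x * e x) - \int[mu]_(x in Omega) (v x * e x).
    rewrite -RintegralB//; try exact: integrable_L2.
    by apply: eq_Rintegral => x _; rewrite mulrBl.
  have := coer t k; rewrite -/e Ev -r2 => H.
  have H' : kappa * r ^+ 2 <= c5 * ((p + q) * U) * r.
    have qU : 0 <= q * U by rewrite mulr_ge0.
    have B4' : eps * - jform P sigma S' v e <= eps * (2 * (c1 * (p * U) * ((Cj + 1) * r))).
      by rewrite ler_wpM2l// ltW.
    apply: le_trans H _.
    apply: (@le_trans _ _ (Cu * (Cn + 1) * (q * U) * r + 2 * (c1 * (p * U) * r) +
      2 * (CQ * q * (c2 * U) * r) + eps * (2 * (c1 * (p * U) * ((Cj + 1) * r))))).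
      move: B1 B2 B3 B4'; rewrite Iuv mulrN; lra.
    have k1 : Cu * (Cn + 1) * (q * U) * r <= Cu * (Cn + 1) * ((p + q) * U) * r.
      by rewrite ler_wpM2r// ler_wpM2l ?mulr_ge0// ler_wpM2r// lerDr.
    have k2 : 2 * (c1 * (p * U) * r) <= 2 * c1 * ((p + q) * U) * r.
      rewrite -!mulrA !ler_wpM2l// mulrA [leRHS]mulrA ler_wpM2r// ler_wpM2r// lerDl//.
    have k3 : 2 * (CQ * q * (c2 * U) * r) <= 2 * (CQ * c2) * ((p + q) * U) * r.
      have -> : 2 * (CQ * q * (c2 * U) * r) = 2 * (CQ * c2) * (q * U) * r by ring.
      by rewrite ler_wpM2r// ler_wpM2l ?mulr_ge0// ler_wpM2r// lerDr.
    have k4 : eps * (2 * (c1 * (p * U) * ((Cj + 1) * r))) <= eps * (2 * (c1 * (Cj + 1))) * ((p + q) * U) * r.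
      have -> : eps * (2 * (c1 * (p * U) * ((Cj + 1) * r))) = eps * (2 * (c1 * (Cj + 1))) * (p * U) * r by ring.
      by rewrite ler_wpM2r// ler_wpM2l ?mulr_ge0 ?(ltW eps0)// ler_wpM2r// lerDl.
    rewrite /c5 !mulrDl; move: k1 k2 k3 k4; rewrite !mulrDl; lra.
  have : kappa * r <= c5 * ((p + q) * U) by rewrite -(ler_pM2r rp) -mulrA -expr2.
  by rewrite mulrAC ler_pdivlMr// mulrC.
have EE : sqint Omega (fun x => u x - us x) = sqint Omega (fun x => (u x - v x) + -1 * e x).
  apply: eq_integral => x /set_mem Ox; congr (_ ^+ 2)%:E.
  rewrite Es patchE mem_set; last exact: OF.
  by rewrite Hk /v; ring.
have [muv _] := Luv; have [me _] := Le.
rewrite EE; apply: le_trans (sqint_lin_le (-1) mO muv me) _.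
rewrite sqrrN expr1n mul1e !sqintE// -EFinD -EFinM lee_fin.
pose Y := c5 / kappa * ((p + q) * U).
have rY : r ^+ 2 <= Y ^+ 2 by rewrite lerXn2r// nnegrE (le_trans r0).
have Y0 : 0 <= Y by exact: le_trans rbound.
have X1 : c1 * (p * U) <= c1 * ((p + q) * U) by rewrite ler_wpM2l// ler_wpM2r// lerDl.
have -> : C * ((p + q) * U) = 2 * (c1 * ((p + q) * U) + Y) by rewrite /C /Y; ring.
have X2 : (c1 * (p * U)) ^+ 2 <= (c1 * ((p + q) * U)) ^+ 2.
  by rewrite lerXn2r// nnegrE (le_trans X0).
have X3 : 0 <= c1 * ((p + q) * U) * Y by rewrite mulr_ge0// (le_trans X0).
have X4 := sqr_ge0 (c1 * ((p + q) * U)); have X5 := sqr_ge0 Y.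
rewrite exprMn sqrrD; rewrite /sq in E1' sqe; lra.
Qed.

End galerkin.

Lemma coord_bounded_shiftd (R : realType) d (tau : 'rV[R]_d) D : coord_bounded D -> coord_bounded (shiftd tau D).
Proof.
move=> [B HB]; exists (B + \sum_l `|tau ord0 l|) => x Dx l.
have := HB _ Dx l; rewrite mxE => h.
have -> : x ord0 l = (x ord0 l + tau ord0 l) - tau ord0 l by rewrite addrK.
apply: le_trans (ler_normB _ _) _; apply: lerD => //.
by rewrite (bigD1 l)//= lerDl sumr_ge0.
Qed.

Unset Implicit Arguments.

(** The domain is a translate of a fixed [Omega0], and [C] and [sigma0] are chosen before [tau]:
    this expresses that they do not depend on the position of the boundary relative to the grid. *)
Theorem theorem3p4 (R : realType) (d P m : nat) (eps s : R)
    (Omega0 : set 'rV[R]_d) (K : nat) (C_BH C_I C_u : R) :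
  (0 < d)%N -> (d%:R / 2 < m.+1%:R :> R) -> 0 < eps -> 1 < s ->
  bounded_domain Omega0 -> stein_extension Omega0 ->
  exists C sigma0 : R, 0 < sigma0 /\
  forall (tau : 'rV[R]_d) (sigma : R) (M : set 'rV[int]_d)
    (I : seq (R * 'rV[R]_d)) (u : 'rV[R]_d -> R) (uh : ('rV[R]_d -> R) -> R),
  let Omega := [set x + tau | x in Omega0] in
  let h := sigma `^ s in
  let k := maxn P m in
  0 < sigma < sigma0 ->
  cut_chains sigma Omega M K ->
  bramble_hilbert sigma Omega P C_BH ->
  quadrature_rule Omega m h C_I I ->
  sobolev Omega k.+1 2 u ->
  sobolev_dual Omega m.+1 uh ->
  (sobolev_dual_norm Omega m.+1 (fun v => uh v - L2_functional Omega u v)%R <=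
    (C_u * h ^+ m.+1)%:E * sobolev_norm Omega m.+1 2 u)%E ->
  let is_solution us := trial_space sigma Omega P us /\
    forall v, trial_space sigma Omega P v ->
      stabilized_form Omega M P sigma eps I us v = uh v in
  (exists! us, is_solution us) /\
  forall us, is_solution us ->
    (Lp_norm Omega 2 (fun x => u x - us x)%R <=
     (C * (sigma ^+ P.+1 + h ^+ m.+1 * sigma ^- m.+1))%:E *
       sobolev_norm Omega k.+1 2 u)%E.
Proof.
move=> _ _ eps0 s1 [_ oO0 _ bO0] stein.
(* This and the next lines fix all constants before [tau] and [sigma] enter; [Mx0] is valid for
   every translate. *)
have [Mx0 HM] := extension_shift P.+1 oO0 stein.
have Mx_ge0 : 0 <= `|Mx0| by [].
have [kappa [eta [kappa0 eta0 Hcoer]]] := coercivity d P m K C_I eps0.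
have [c1 [c2 [c10 c20 Hbest]]] := best_approximation d P C_BH Mx_ge0.
have [C C0 HC] := galerkin_error d P m C_I eps0 c10 c20 kappa0 (normr_ge0 C_u).
have [sigma0 /andP[sigma00 sigma01] Hsmall] := mesh_ratio_small m s1 eta0.
exists C, sigma0; split => // tau sigma M I u uh Omega h k /andP[s0 ss0] chains BH qI su duh Hu is_solution.
have OE : Omega = shiftd (- tau) Omega0 by exact: image_shiftd.
have oO : open Omega by rewrite OE; exact: open_shiftd.
have bO : coord_bounded Omega by rewrite OE; apply: coord_bounded_shiftd; exact: bounded_coord.
have s01 : 0 < sigma <= 1 by rewrite s0/= (le_trans (ltW ss0)).
have h0 : 0 <= h by exact: powR_ge0.
have [S uS SP] := active_seq s0 bO.
have IO : forall q, q \in I -> Omega q.2 by have [] := qI.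
have small : h ^+ m.+1 * sigma ^- m.+1 <= eta by apply: Hsmall; rewrite s0.
have coer t c := Hcoer sigma Omega M S I h t c s0 oO bO uS SP chains h0 qI small.
split.
  have [us sol] := solution_exists s0 oO bO uS SP IO kappa0 coer duh.
  exists us; split => // us' sol'.
  exact: (solution_unique s0 oO uS SP IO kappa0 coer sol sol').
move=> us [tus Hus].
have suP : sobolev Omega P.+1 2 u by apply: sobolevW su; rewrite ltnS leq_maxl.
have Ufin := sobolev_norm_fin oO su.
pose U := fine (sobolev_norm Omega k.+1 2 u).
have UE : sobolev_norm Omega k.+1 2 u = U%:E by rewrite fineK.
have U0 : 0 <= U by rewrite -lee_fin -UE sobolev_norm_ge0.
have [w [sw wu wM]] : exists w, [/\ sobolev setT P.+1 2 w,
    {ae lebesgue_rV R d, forall x, Omega x -> w x = u x} &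
    (sobolev_norm setT P.+1 2 w <= Mx0%:E * sobolev_norm Omega P.+1 2 u)%E].
  by move: suP; rewrite OE; exact: HM.
have wU : (sobolev_norm setT P.+1 2 w <= (`|Mx0| * U)%:E)%E.
  (* The norms of order P+1 here and m+1 in the assumption on [uh] are both dominated by the norm of
     order k+1, whose real value is [U]. *)
  apply: le_trans wM _; rewrite EFinM -UE.
  apply: (@le_trans _ _ (`|Mx0|%:E * sobolev_norm Omega P.+1 2 u)%E).
    by apply: lee_wpmul2r; rewrite ?sobolev_norm_ge0// lee_fin ler_norm.
  by apply: lee_wpmul2l; rewrite ?lee_fin//; apply: sobolev_norm_le; rewrite ltnS leq_maxl.
have Lu := L2fun_sobolev oO su; have [mu _] := Lu.
have [T [c [E1 E2 E3]]] := Hbest sigma Omega M S u w U s01 oO bO uS SP BH sw wU U0 mu wu.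
have Hu' : (sobolev_dual_norm Omega m.+1 (fun v => uh v - L2_functional Omega u v)%R <=
    (`|C_u| * h ^+ m.+1 * U)%:E)%E.
  apply: le_trans Hu _; rewrite (EFinM (`|C_u| * h ^+ m.+1) U) -UE.
  apply: (@le_trans _ _ ((`|C_u| * h ^+ m.+1)%:E * sobolev_norm Omega m.+1 2 u)%E).
    by apply: lee_wpmul2r; rewrite ?sobolev_norm_ge0// lee_fin ler_wpM2r ?exprn_ge0 ?ler_norm.
  apply: lee_wpmul2l; first by rewrite lee_fin mulr_ge0// exprn_ge0.
  by apply: sobolev_norm_le; rewrite ltnS leq_maxr.
have := HC sigma Omega M S I h u uh U T c us s01 oO bO uS SP h0 U0 qI coer E1 E2 E3 Lu duh Hu' tus Hus.
set pq := sigma ^+ P.+1 + _ => H.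
have pq0 : 0 <= pq by rewrite addr_ge0// ?mulr_ge0 ?invr_ge0 ?exprn_ge0// ltW.
rewrite UE -EFinM; apply: poweR2_le; rewrite ?Lp_norm_ge0// ?lee_fin ?mulr_ge0//.
by rewrite Lp_norm2 poweR_EFin powR_mulrn ?mulr_ge0// -mulrA.
Qed.
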